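(* Let $R$ be a $0$-Gorenstein ring. Then the category $\mathcal{K}(\mathcal{GP})$ of Gorenstein projective objects in $\mathcal{K}(R)$ is a compactly generated triangulated category.
   Context: A ring $R$ (with unity) is $0$-Gorenstein if $R$ is left and right Noetherian and the injective dimension of the left module ${}_RR$ is $0$. $\mathcal{K}(R)$ is the homotopy category of complexes of left $R$-modules, a triangulated category, and $\mathcal{C}(R)$ is the category of complexes and chain maps. Complexes are graded homologically ($\delta_n:C_n\to C_{n-1}$), with $\mathrm{Z}_n(C)=\mathrm{Ker}(\delta_n)$, $\mathrm{B}_n(C)=\mathrm{Im}(\delta_{n+1})$, $\mathrm{H}_n(C)=\mathrm{Z}_n(C)/\mathrm{B}_n(C)$. $\mathrm{Z}(C)$, $\mathrm{B}(C)$, $\mathrm{H}(C)$, $C/\mathrm{Z}(C)$, $C/\mathrm{B}(C)$ denote the complexes with components $\mathrm{Z}_n(C)$, $\mathrm{B}_n(C)$, $\mathrm{H}_n(C)$, $C_n/\mathrm{Z}_n(C)$, $C_n/\mathrm{B}_n(C)$. A complex $P$ is C-E (Cartan-Eilenberg) projective if $P_n$, $\mathrm{Z}_n(P)$, $\mathrm{B}_n(P)$ and $\mathrm{H}_n(P)$ are projective modules for all $n\in\mathbb{Z}$. A sequence of complexes $\cdots\to C^{-1}\to C^0\to C^1\to\cdots$ is C-E exact if it is exact and the induced sequences of $\mathrm{Z}(C^i)$, of $\mathrm{B}(C^i)$, of $C^i/\mathrm{Z}(C^i)$, of $C^i/\mathrm{B}(C^i)$ and of $\mathrm{H}(C^i)$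 are all exact. It is strongly C-E exact if it is C-E exact and degreewise split, i.e. for every $n$ the exact sequence of modules $\cdots\to C^{-1}_n\to C^0_n\to C^1_n\to\cdots$ is split (each of the short exact sequences into which it decomposes splits). An object $X$ of $\mathcal{K}(R)$ is Gorenstein projective if there is a strongly C-E exact sequence in $\mathcal{C}(R)$ of C-E projective complexes $\cdots\to P^{-1}\to P^0\to P^1\to\cdots$ such that $X\cong\mathrm{Ker}(P^0\to P^1)$ in $\mathcal{K}(R)$ (the kernel being taken in $\mathcal{C}(R)$) and such that the sequence remains exact after applying $\mathrm{Hom}_{\mathcal{K}(R)}(-,Q)$ for every C-E projective complex $Q$. $\mathcal{K}(\mathcal{GP})$ is the full subcategory of $\mathcal{K}(R)$ of Gorenstein projective objects; its triangulated structure is the one inherited from $\mathcal{K}(R)$. Let $\mathcal{C}$ be a triangulated category with set-indexed coproducts. An object $C$ is compact if the natural map $\coprod_{i\in I}\mathrm{Hom}_{\mathcal{C}}(C,X_i)\to\mathrm{Hom}_{\mathcal{C}}(C,\coprod_{i\in I}X_i)$ is an isomorphism for every family $\{X_i\}_{i\in I}$ of objects. A set $\mathcal{G}$ of objects is a generating set if, for every $X\in\mathcal{C}$, $\mathrm{Hom}_{\mathcal{C}}(G,X)=0$ for all $G\in\mathcal{G}$ implies $X\cong0$. $\mathcal{C}$ is compactly generated if it has a generating set consisting of compact objects. *)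

(* Defs.v *)
From HB Require Import structures.
From mathcomp Require Import all_boot all_order all_algebra.
From mathcomp Require Import boolp classical_sets functions cardinality fsbigop.

Set Implicit Arguments.
Unset Strict Implicit.
Unset Printing Implicit Defensive.

Import GRing.Theory.
Local Open Scope ring_scope.
Local Open Scope quotient_scope.

Record submod (R : pzRingType) (V : lmodType R) := Submod {
  submod_pred :> {pred V};
  submod_predP : submod_closed submod_pred }.

HB.instance Definition _ (R : pzRingType) (V : lmodType R) (U : submod V) :=
  GRing.isSubmodClosed.Build R V (submod_pred U)
    (GRing.submod_closed_semi (submod_predP U)).

Section SubQuotient.
Variable R : pzRingType.
Implicit Types V W : lmodType R.

Definition sub_of V (U : submod V) : Type := {x : V | x \in submod_pred U}.
HB.instance Definition _ V (U : submod V) := SubChoice.on (sub_of U).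
HB.instance Definition _ V (U : submod V) :=
  [SubChoice_isSubLmodule of sub_of U by <:].

Definition quot_of V (U : submod V) : Type :=
  Quotient.quot (submod_pred U : zmodClosed V).
HB.instance Definition _ V (U : submod V) :=
  GRing.Zmodule.on (quot_of U).
HB.instance Definition _ V (U : submod V) :=
  EqQuotient.on (quot_of U).

Section QuotientScale.
Variables (V : lmodType R) (U : submod V).
Local Notation Q := (quot_of U).

Lemma quot_of_eq (x y : V) : (\pi_Q x = \pi_Q y) <-> (x - y \in submod_pred U).
Proof.
rewrite (Quotient.idealrBE (submod_pred U : zmodClosed V)).
by split => [->|/eqP].
Qed.

Lemma quot_piD (x y : V) : \pi_Q (x + y) = \pi_Q x + \pi_Q y.
Proof. exact: (Quotient.pi_add (submod_pred U : zmodClosed V)). Qed.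

Definition quot_scale (a : R) (x : Q) : Q := \pi_Q (a *: repr x).

Lemma quot_scale_pi (a : R) (x : V) : quot_scale a (\pi_Q x) = \pi_Q (a *: x).
Proof.
apply/quot_of_eq; rewrite -scalerBr rpredZ //.
by apply/quot_of_eq; rewrite reprK.
Qed.

Lemma quot_scaleA a b (x : Q) : quot_scale a (quot_scale b x) = quot_scale (a * b) x.
Proof. by rewrite -[x]reprK (quot_scale_pi b) !quot_scale_pi scalerA. Qed.

Lemma quot_scale1 : left_id 1 quot_scale.
Proof. by move=> x; rewrite -[x]reprK quot_scale_pi scale1r. Qed.

Lemma quot_scaleDr : right_distributive quot_scale +%R.
Proof.
move=> a x y; rewrite -[x]reprK -[y]reprK -quot_piD !quot_scale_pi.
by rewrite scalerDr quot_piD.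
Qed.

Lemma quot_scaleDl (x : Q) : {morph quot_scale^~ x : a b / a + b}.
Proof. by move=> a b; rewrite -[x]reprK !quot_scale_pi scalerDl quot_piD. Qed.

HB.instance Definition _ := GRing.Zmodule_isLmodule.Build R Q
  quot_scaleA quot_scale1 quot_scaleDr quot_scaleDl.

Lemma quot_pi_linear : linear (\pi_Q : V -> Q).
Proof. by move=> a x y; rewrite quot_piD -quot_scale_pi. Qed.

HB.instance Definition _ := GRing.isLinear.Build R V Q *:%R \pi_Q quot_pi_linear.

End QuotientScale.

Section Induced.
Variables (V W : lmodType R) (f : {linear V -> W}).

Section Maps.
Variables (U : submod V) (U' : submod W).
Hypothesis fU : forall x, x \in submod_pred U -> f x \in submod_pred U'.

Definition sub_map_fun (x : sub_of U) : sub_of U' :=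
  exist _ (f (val x)) (fU (valP x)).

Lemma sub_map_linear : linear sub_map_fun.
Proof. by move=> a x y; apply: val_inj; rewrite /= linearP. Qed.

HB.instance Definition _ :=
  GRing.isLinear.Build R (sub_of U) (sub_of U') *:%R sub_map_fun sub_map_linear.

Definition sub_map : {linear sub_of U -> sub_of U'} := sub_map_fun.

Definition quot_map_fun (x : quot_of U) : quot_of U' :=
  \pi_(quot_of U') (f (repr x)).

Lemma quot_map_fun_pi x : quot_map_fun (\pi_(quot_of U) x) = \pi_(quot_of U') (f x).
Proof.
by apply/quot_of_eq; rewrite -linearB; apply/fU/quot_of_eq; rewrite reprK.
Qed.

Lemma quot_map_linear : linear quot_map_fun.
Proof.
move=> a x y; rewrite -[x]reprK -[y]reprK -linearP.
by rewrite !quot_map_fun_pi !linearP.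
Qed.

HB.instance Definition _ :=
  GRing.isLinear.Build R (quot_of U) (quot_of U') *:%R quot_map_fun
    quot_map_linear.

Definition quot_map : {linear quot_of U -> quot_of U'} := quot_map_fun.

End Maps.

Lemma ker_submod_closed : submod_closed [pred x | f x == 0].
Proof.
split=> [|a x y]; rewrite !inE ?linear0 // => /eqP fx /eqP fy.
by rewrite linearP fx fy scaler0 addr0.
Qed.
Definition ker_mod : submod V := Submod ker_submod_closed.

Lemma im_submod_closed : submod_closed [pred y | `[< exists x, f x = y >]].
Proof.
split=> [|a x y]; rewrite !inE; first by exists 0; rewrite linear0.
by move=> [x' <-] [y' <-]; exists (a *: x' + y'); rewrite linearP.
Qed.
Definition im_mod : submod W := Submod im_submod_closed.

End Induced.

(** Used with [U] contained in [U']; in general this is [U] intersected with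
    [U']. *)
Lemma submod_in_closed V (U U' : submod V) :
  submod_closed [pred x : sub_of U' | val x \in submod_pred U].
Proof.
by split=> [|a x y]; rewrite !inE ?rpred0 // => xU yU; rewrite /= rpredD ?rpredZ.
Qed.
Definition submod_in V (U U' : submod V) : submod (sub_of U') :=
  Submod (@submod_in_closed V U U').

Definition exact_at (A B C : zmodType) (f : A -> B) (g : B -> C) : Prop :=
  forall y, g y = 0 <-> exists x, f x = y.

Definition surjective_map (A B : Type) (f : A -> B) : Prop :=
  forall y, exists x, f x = y.

Definition projective_mod (P : lmodType R) : Prop :=
  forall (M N : lmodType R) (g : {linear M -> N}) (f : {linear P -> N}),
    surjective_map g -> exists h : {linear P -> M}, forall x, g (h x) = f x.

Definition injective_mod (E : lmodType R) : Prop :=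
  forall (M N : lmodType R) (i : {linear M -> N}) (f : {linear M -> E}),
    injective i -> exists h : {linear N -> E}, forall x, h (i x) = f x.

Fixpoint injdim_le (n : nat) (M : lmodType R) : Prop :=
  if n is m.+1 then
    exists (E C : lmodType R) (i : {linear M -> E}) (p : {linear E -> C}),
      [/\ injective_mod E, injective i, exact_at i p, surjective_map p
        & injdim_le m C]
  else injective_mod M.

Definition injdim_eq (n : nat) (M : lmodType R) : Prop :=
  injdim_le n M /\ forall m, (m < n)%N -> ~ injdim_le m M.

Definition noetherian (M : lmodType R) : Prop :=
  forall U : nat -> submod M,
    (forall k, {subset submod_pred (U k) <= submod_pred (U k.+1)}) ->
    exists n, forall k, (n <= k)%N -> submod_pred (U k) =i submod_pred (U n).

End SubQuotient.

(** Left modules over the converse ring [R^c] are the right [R]-modules. *)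
Definition zero_Gorenstein (R : pzRingType) : Prop :=
  [/\ noetherian (R^o : lmodType R), noetherian ((R^c)^o : lmodType R^c)
    & injdim_eq 0 (R^o : lmodType R)].

(** To avoid transports along equations between indices, the differential is a
    doubly indexed family, required to vanish away from the entries
    [d (n + 1) n]. *)
Record cplx (R : pzRingType) := Cplx {
  cobj :> int -> lmodType R;
  cd : forall i j : int, {linear cobj i -> cobj j};
  cd_shape : forall i j : int, i != j + 1 -> forall x, cd i j x = 0;
  cdd : forall (i j k : int) (x : cobj i), cd j k (cd i j x) = 0 }.
Arguments cd {R} c i j.

Section Complexes.
Variable R : pzRingType.
Implicit Types X Y Z : cplx R.

Record cmap X Y := Cmap {
  cmap_fun :> forall n : int, {linear X n -> Y n};
  cmapP : forall i j x, cmap_fun j (cd X i j x) = cd Y i j (cmap_fun i x) }.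

Lemma linear_ext (A B : lmodType R) (f g : {linear A -> B}) : f =1 g -> f = g.
Proof.
case: f g => [f [[a] [b]]] [g [[a'] [b']]] /= fg.
have {fg} fg : f = g by apply: funext.
subst g; have -> : a = a' by exact: Prop_irrelevance.
by have -> : b = b' by exact: Prop_irrelevance.
Qed.

Lemma cmap_ext X Y (f g : cmap X Y) : (forall n x, f n x = g n x) -> f = g.
Proof.
case: f g => [f fP] [g gP] /= fg.
have {fg} fg : f = g.
  by apply: functional_extensionality_dep => n; apply: linear_ext => x; exact: fg.
by subst g; congr Cmap; exact: Prop_irrelevance.
Qed.

Definition cmap_id X : cmap X X :=
  @Cmap X X (fun=> idfun) (fun i j x => erefl).

Lemma cmap_compP X Y Z (g : cmap Y Z) (f : cmap X Y) i j x :
  (g j \o f j) (cd X i j x) = cd Z i j ((g i \o f i) x).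
Proof. by rewrite /= !cmapP. Qed.
Definition cmap_comp X Y Z (g : cmap Y Z) (f : cmap X Y) : cmap X Z :=
  Cmap (cmap_compP g f).

Section CmapZmod.
Variables X Y : cplx R.

Lemma cmap_zeroP i j x :
  (\0 : {linear X j -> Y j}) (cd X i j x) =
  cd Y i j ((\0 : {linear X i -> Y i}) x).
Proof. by rewrite /= linear0. Qed.
Definition cmap_zero : cmap X Y := Cmap cmap_zeroP.

Lemma cmap_oppP (f : cmap X Y) i j x :
  (\- f j) (cd X i j x) = cd Y i j ((\- f i) x).
Proof. by rewrite /= cmapP linearN. Qed.
Definition cmap_opp f : cmap X Y := Cmap (cmap_oppP f).

Lemma cmap_addP (f g : cmap X Y) i j x :
  (f j \+ g j) (cd X i j x) = cd Y i j ((f i \+ g i) x).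
Proof. by rewrite /= !cmapP linearD. Qed.
Definition cmap_add f g : cmap X Y := Cmap (cmap_addP f g).

Lemma cmap_addA : associative cmap_add.
Proof. by move=> f g h; apply: cmap_ext => n x; rewrite /= addrA. Qed.
Lemma cmap_addC : commutative cmap_add.
Proof. by move=> f g; apply: cmap_ext => n x; rewrite /= addrC. Qed.
Lemma cmap_add0 : left_id cmap_zero cmap_add.
Proof. by move=> f; apply: cmap_ext => n x; rewrite /= add0r. Qed.
Lemma cmap_addN : left_inverse cmap_zero cmap_opp cmap_add.
Proof. by move=> f; apply: cmap_ext => n x; rewrite /= addNr. Qed.

HB.instance Definition _ := gen_eqMixin (cmap X Y).
HB.instance Definition _ := gen_choiceMixin (cmap X Y).
HB.instance Definition _ := GRing.isZmodule.Build (cmap X Y)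
  cmap_addA cmap_addC cmap_add0 cmap_addN.

(** Only the components [h n (n + 1)] of a homotopy matter. *)
Definition null_homotopic (f : cmap X Y) : Prop :=
  exists h : forall i j : int, {linear X i -> Y j},
    forall n x,
      f n x = cd Y (n + 1) n (h n (n + 1) x) + h (n - 1) n (cd X n (n - 1) x).

Definition null_pred : {pred cmap X Y} := [pred f | `[< null_homotopic f >]].

Lemma null_zmod_closed : zmod_closed null_pred.
Proof.
split=> [|f g]; rewrite !inE.
  by exists (fun i j => \0) => n x; rewrite /= linear0 addr0.
move=> [h fh] [k gk]; exists (fun i j => h i j \- k i j) => n x.
by rewrite /= fh gk linearB opprD addrACA.
Qed.
HB.instance Definition _ :=
  GRing.isZmodClosed.Build (cmap X Y) null_pred null_zmod_closed.

Definition homK : zmodType := Quotient.quot null_pred.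

Definition homK_pi (f : cmap X Y) : homK := \pi_(Quotient.quot null_pred) f.

Lemma homK_pi_eq f g : homK_pi f = homK_pi g <-> null_homotopic (f - g).
Proof.
have E : (homK_pi f == homK_pi g) = (f - g \in null_pred).
  by rewrite (Quotient.idealrBE null_pred).
by split=> [/eqP|H]; [rewrite E inE | apply/eqP; rewrite E inE].
Qed.

Lemma homK_piD f g : homK_pi (f + g) = homK_pi f + homK_pi g.
Proof. exact: (Quotient.pi_add null_pred). Qed.

Definition homK_repr (a : homK) : cmap X Y := repr a.

Lemma homK_reprK a : homK_pi (homK_repr a) = a.
Proof. exact: reprK. Qed.

End CmapZmod.

Lemma null_comp X Y Z (g : cmap Y Z) (f : cmap X Y) :
  null_homotopic g \/ null_homotopic f -> null_homotopic (cmap_comp g f).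
Proof.
case=> [[h gh]|[h fh]].
- exists (fun i j => h i j \o f i) => n x.
  by rewrite /= gh !cmapP.
- exists (fun i j => g j \o h i j) => n x.
  by rewrite /= fh linearD cmapP.
Qed.

Definition compK X Y Z (b : homK Y Z) (a : homK X Y) : homK X Z :=
  homK_pi (cmap_comp (homK_repr b) (homK_repr a)).

Lemma compK_pi X Y Z (g : cmap Y Z) (f : cmap X Y) :
  compK (homK_pi g) (homK_pi f) = homK_pi (cmap_comp g f).
Proof.
pose g' := homK_repr (homK_pi g); pose f' := homK_repr (homK_pi f).
transitivity (homK_pi (cmap_comp g' f)); apply/homK_pi_eq.
- have -> : cmap_comp g' f' - cmap_comp g' f = cmap_comp g' (f' - f).
    by apply: cmap_ext => n x; rewrite /= linearB.
  by apply: null_comp; right; apply/homK_pi_eq; rewrite homK_reprK.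
- have -> : cmap_comp g' f - cmap_comp g f = cmap_comp (g' - g) f.
    by apply: cmap_ext => n x.
  by apply: null_comp; left; apply/homK_pi_eq; rewrite homK_reprK.
Qed.

Lemma compKA X Y Z W (c : homK Z W) (b : homK Y Z) (a : homK X Y) :
  compK c (compK b a) = compK (compK c b) a.
Proof.
rewrite -(homK_reprK a) -(homK_reprK b) -(homK_reprK c) !compK_pi.
by congr homK_pi; apply: cmap_ext.
Qed.

Lemma compK1m X Y (a : homK X Y) : compK (homK_pi (cmap_id Y)) a = a.
Proof.
rewrite -(homK_reprK a) compK_pi.
by congr homK_pi; apply: cmap_ext.
Qed.

Lemma compKm1 X Y (a : homK X Y) : compK a (homK_pi (cmap_id X)) = a.
Proof.
rewrite -(homK_reprK a) compK_pi.
by congr homK_pi; apply: cmap_ext.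
Qed.

Lemma compKDl X Y Z (b c : homK Y Z) (a : homK X Y) :
  compK (b + c) a = compK b a + compK c a.
Proof.
rewrite -(homK_reprK a) -(homK_reprK b) -(homK_reprK c) -homK_piD !compK_pi.
by rewrite -homK_piD; congr homK_pi; apply: cmap_ext.
Qed.

Lemma compKDr X Y Z (c : homK Y Z) (a b : homK X Y) :
  compK c (a + b) = compK c a + compK c b.
Proof.
rewrite -(homK_reprK a) -(homK_reprK b) -(homK_reprK c) -homK_piD !compK_pi.
rewrite -homK_piD; congr homK_pi; apply: cmap_ext => n x.
by rewrite /= linearD.
Qed.

Section Shift.
Variable X : cplx R.

Definition shift_d (i j : int) : {linear X (i - 1) -> X (j - 1)} :=
  \- cd X (i - 1) (j - 1).

Lemma shift_shape (i j : int) : i != j + 1 -> forall x, shift_d i j x = 0.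
Proof.
move=> ij x; rewrite /= cd_shape ?oppr0 //.
by apply: contra ij => /eqP e; rewrite -[i](subrK 1) e addrNK.
Qed.

Lemma shift_dd i j k x : shift_d j k (shift_d i j x) = 0.
Proof. by rewrite /= linearN cdd !oppr0. Qed.

Definition shift : cplx R :=
  @Cplx R (fun n => X (n - 1)) shift_d shift_shape shift_dd.
End Shift.

Lemma shift_mapP X Y (f : cmap X Y) i j x :
  f (j - 1) (cd (shift X) i j x) = cd (shift Y) i j (f (i - 1) x).
Proof. by rewrite /= linearN cmapP. Qed.
Definition shift_map X Y (f : cmap X Y) : cmap (shift X) (shift Y) :=
  @Cmap (shift X) (shift Y) (fun n => f (n - 1)) (shift_mapP f).

Definition shiftK X Y (a : homK X Y) : homK (shift X) (shift Y) :=
  homK_pi (shift_map (homK_repr a)).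

(** The identity of [X i] when [i = j], and zero otherwise. In the cone it
    carries [f x], which lies in [Y (i - 1)], to [Y j]; only [j = i - 1]
    contributes. *)
Definition cid_fun X (i j : int) (x : X i) : X j :=
  if @eqP _ i j is ReflectT e then ecast k (X k) e x else 0.

Lemma cid_linear X i j : linear (@cid_fun X i j).
Proof.
rewrite /cid_fun; case: eqP => [e|_] a x y; last by rewrite scaler0 addr0.
by case: j / e.
Qed.
HB.instance Definition _ X i j :=
  GRing.isLinear.Build R (X i) (X j) *:%R (@cid_fun X i j) (@cid_linear X i j).

Lemma cid_refl X i x : @cid_fun X i i x = x.
Proof. by rewrite /cid_fun; case: eqP => // e; rewrite eq_axiomK. Qed.

Lemma cid_d X (i j k : int) (x : X i) :
  cid_fun k (cd X i (j - 1) x) = cd X j k (cid_fun j x).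
Proof.
rewrite /cid_fun; case: eqP => [ek|nk]; case: eqP => [ej|nj].
- by case: k / ek; case: j / ej.
- rewrite linear0; case: k / ek => /=; apply: cd_shape.
  by apply/eqP; rewrite subrK.
- by rewrite cd_shape //; apply/eqP => e; apply: nk; rewrite e addrK.
- by rewrite linear0.
Qed.

Section Cone.
Variables (X Y : cplx R) (f : cmap X Y).

(** Differential [(x, y) |-> (- d x, f x + d y)] *)
Definition cone_obj (n : int) : lmodType R := (X (n - 1) * Y n)%type.

Definition cone_d_fun (i j : int) (z : cone_obj i) : cone_obj j :=
  (- cd X (i - 1) (j - 1) z.1,
   cid_fun j (f (i - 1) z.1) + cd Y i j z.2).

Lemma cone_d_linear i j : linear (@cone_d_fun i j).
Proof.
move=> a [x y] [x' y']; congr (_, _); rewrite /= !linearP //.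
by rewrite scalerDr addrACA.
Qed.
HB.instance Definition _ i j :=
  GRing.isLinear.Build R (cone_obj i) (cone_obj j) *:%R (@cone_d_fun i j)
    (@cone_d_linear i j).

Lemma cone_shape (i j : int) : i != j + 1 -> forall z : cone_obj i, cone_d_fun j z = 0.
Proof.
move=> ij [x y]; rewrite /cone_d_fun /= (cd_shape ij) addr0 cd_shape; last first.
  by apply: contra ij => /eqP e; rewrite -[i](subrK 1) e addrNK.
rewrite oppr0 /cid_fun; case: eqP => // e.
by rewrite -e subrK eqxx in ij.
Qed.

Lemma cone_dd i j k (z : cone_obj i) : cone_d_fun k (cone_d_fun j z) = 0.
Proof.
case: z => x y; congr (_, _); rewrite /= !(linearN, linearD) /=.
  by rewrite cdd !oppr0.
by rewrite cdd addr0 cmapP cid_d addNr.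
Qed.

Definition cone : cplx R :=
  @Cplx R cone_obj (fun i j => @cone_d_fun i j) cone_shape cone_dd.

End Cone.

Section ConeMaps.
Variables (X Y : cplx R) (f : cmap X Y).

Definition cone_in_fun n (y : Y n) : cone f n := (0, y).
Lemma cone_in_linear n : linear (@cone_in_fun n).
Proof. by move=> a y y'; congr (_, _); rewrite /= scaler0 addr0. Qed.
HB.instance Definition _ n :=
  GRing.isLinear.Build R (Y n) (cone f n) *:%R (@cone_in_fun n)
    (@cone_in_linear n).
Lemma cone_inP i j (y : Y i) :
  cone_in_fun (cd Y i j y) = cd (cone f) i j (cone_in_fun y).
Proof. by congr (_, _); rewrite /= !linear0 ?oppr0 ?add0r. Qed.
Definition cone_in : cmap Y (cone f) :=
  @Cmap Y (cone f) (fun n => @cone_in_fun n) cone_inP.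

Definition cone_out_fun n (z : cone f n) : shift X n := z.1.
Lemma cone_out_linear n : linear (@cone_out_fun n).
Proof. by []. Qed.
HB.instance Definition _ n :=
  GRing.isLinear.Build R (cone f n) (shift X n) *:%R (@cone_out_fun n)
    (@cone_out_linear n).
Lemma cone_outP i j (z : cone f i) :
  cone_out_fun (cd (cone f) i j z) = cd (shift X) i j (cone_out_fun z).
Proof. by []. Qed.
Definition cone_out : cmap (cone f) (shift X) :=
  @Cmap (cone f) (shift X) (fun n => @cone_out_fun n) cone_outP.

End ConeMaps.

Section Kernel.
Variables (X Y : cplx R) (f : cmap X Y).

Lemma kerC_d_subproof i j x :
  x \in submod_pred (ker_mod (f i)) -> cd X i j x \in submod_pred (ker_mod (f j)).
Proof. by rewrite !inE cmapP => /eqP ->; rewrite linear0. Qed.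

Definition kerC_d i j :
    {linear sub_of (ker_mod (f i)) -> sub_of (ker_mod (f j))} :=
  sub_map (@kerC_d_subproof i j).

Lemma kerC_shape (i j : int) : i != j + 1 -> forall x, kerC_d i j x = 0.
Proof. by move=> ij x; apply: val_inj; rewrite /= cd_shape. Qed.

Lemma kerC_dd i j k x : kerC_d j k (kerC_d i j x) = 0.
Proof. by apply: val_inj; rewrite /= cdd. Qed.

Definition kerC : cplx R :=
  @Cplx R (fun n => sub_of (ker_mod (f n))) kerC_d kerC_shape kerC_dd.

End Kernel.

Section CycleBoundary.
Variables (X : cplx R) (n : int).

Definition Zsub : submod (X n) := ker_mod (cd X n (n - 1)).
Definition Bsub : submod (X n) := im_mod (cd X (n + 1) n).

Definition Zc : lmodType R := sub_of Zsub.
Definition Bc : lmodType R := sub_of Bsub.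
Definition CZ : lmodType R := quot_of Zsub.
Definition CB : lmodType R := quot_of Bsub.
Definition Hc : lmodType R := quot_of (submod_in Bsub Zsub).

End CycleBoundary.

Section InducedMaps.
Variables (X Y : cplx R) (f : cmap X Y) (n : int).

Lemma Zsub_map x : x \in submod_pred (Zsub X n) -> f n x \in submod_pred (Zsub Y n).
Proof. by rewrite !inE -cmapP => /eqP ->; rewrite linear0. Qed.

Lemma Bsub_map x : x \in submod_pred (Bsub X n) -> f n x \in submod_pred (Bsub Y n).
Proof. by rewrite !inE => -[y <-]; exists (f (n + 1) y); rewrite cmapP. Qed.

Definition Zmap : {linear Zc X n -> Zc Y n} := sub_map Zsub_map.
Definition Bmap : {linear Bc X n -> Bc Y n} := sub_map Bsub_map.
Definition CZmap : {linear CZ X n -> CZ Y n} := quot_map Zsub_map.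
Definition CBmap : {linear CB X n -> CB Y n} := quot_map Bsub_map.

Lemma Hsub_map (x : Zc X n) :
  x \in submod_pred (submod_in (Bsub X n) (Zsub X n)) ->
  Zmap x \in submod_pred (submod_in (Bsub Y n) (Zsub Y n)).
Proof. exact: Bsub_map. Qed.

Definition Hmap : {linear Hc X n -> Hc Y n} := quot_map Hsub_map.

End InducedMaps.

Definition CE_projective (P : cplx R) : Prop :=
  forall n : int, [/\ projective_mod (P n), projective_mod (Zc P n),
    projective_mod (Bc P n) & projective_mod (Hc P n)].

(** The place [i + 1] runs over all integers, so this is exactness everywhere. *)
Definition exact_seq (M : int -> lmodType R)
    (f : forall i, {linear M i -> M (i + 1)}) : Prop :=
  forall i, exact_at (f i) (f (i + 1)).

(** Each [0 -> Ker (f i) -> M i -> Im (f i) -> 0] splits. *)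
Definition split_seq (M : int -> lmodType R)
    (f : forall i, {linear M i -> M (i + 1)}) : Prop :=
  forall i, exists s : {linear sub_of (im_mod (f i)) -> M i},
    forall y, f i (s y) = val y.

Section Sequence.
Variables (P : int -> cplx R) (f : forall i, cmap (P i) (P (i + 1))).

(** Exactness of a sequence of complexes is exactness in every degree [n]. *)
Definition CE_exact : Prop := forall n : int,
  exact_seq (fun i => f i n) /\
  [/\ exact_seq (fun i => Zmap (f i) n), exact_seq (fun i => Bmap (f i) n),
    exact_seq (fun i => CZmap (f i) n), exact_seq (fun i => CBmap (f i) n)
    & exact_seq (fun i => Hmap (f i) n)].

Definition strongly_CE_exact : Prop :=
  CE_exact /\ forall n : int, split_seq (fun i => f i n).

End Sequence.

End Complexes.

Record preadditive := Preadditive {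
  obj :> Type;
  hom : obj -> obj -> zmodType;
  idm : forall X, hom X X;
  comp : forall X Y Z, hom Y Z -> hom X Y -> hom X Z;
  compA : forall X Y Z W (h : hom Z W) (g : hom Y Z) (f : hom X Y),
    comp h (comp g f) = comp (comp h g) f;
  comp1m : forall X Y (f : hom X Y), comp (idm Y) f = f;
  compm1 : forall X Y (f : hom X Y), comp f (idm X) = f;
  compDl : forall X Y Z (g h : hom Y Z) (f : hom X Y),
    comp (g + h) f = comp g f + comp h f;
  compDr : forall X Y Z (h : hom Y Z) (f g : hom X Y),
    comp h (f + g) = comp h f + comp h g }.
Arguments hom {p} X Y.
Arguments idm {p} X.
Arguments comp {p X Y Z} g f.

Section Preadditive.
Variable C : preadditive.

Definition is_iso (X Y : C) (f : hom X Y) : Prop :=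
  exists g : hom Y X, comp g f = idm X /\ comp f g = idm Y.

Definition isomorphic (X Y : C) : Prop := exists f : hom X Y, is_iso f.

Definition is_zero (X : C) : Prop :=
  forall Y : C, (forall f : hom X Y, f = 0) /\ (forall f : hom Y X, f = 0).

Definition is_additive : Prop :=
  (exists X : C, is_zero X) /\
  forall X Y : C, exists (S : C) (i : hom X S) (j : hom Y S)
      (p : hom S X) (q : hom S Y),
    [/\ comp p i = idm X, comp q j = idm Y, comp p j = 0, comp q i = 0
      & comp i p + comp j q = idm S].

Definition is_coproduct (I : Type) (X : I -> C) (S : C)
    (inj : forall i, hom (X i) S) : Prop :=
  forall (Y : C) (f : forall i, hom (X i) Y),
    exists! g : hom S Y, forall i, comp g (inj i) = f i.

(** The index "sets" are the [choiceType]s; [small_index] bounds their size. *)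
Definition has_coproducts : Prop :=
  forall (I : choiceType) (X : I -> C),
    exists (S : C) (inj : forall i, hom (X i) S), is_coproduct inj.

Definition dsum_hom (I : choiceType) (A : C) (X : I -> C) : Type :=
  {g : forall i, hom A (X i) | finite_set [set i | g i != 0]}.

Definition dsum_hom_map (I : choiceType) (A : C) (X : I -> C) (S : C)
    (inj : forall i, hom (X i) S) (g : dsum_hom A X) : hom A S :=
  \sum_(i \in [set: I]) comp (inj i) (sval g i).

Definition compact_obj (A : C) : Prop :=
  forall (I : choiceType) (X : I -> C) (S : C) (inj : forall i, hom (X i) S),
    is_coproduct inj -> bijective (dsum_hom_map (A := A) inj).

Definition generating_set (J : choiceType) (G : J -> C) : Prop :=
  forall X : C, (forall j (f : hom (G j) X), f = 0) -> is_zero X.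

Definition compactly_generated : Prop :=
  exists (J : choiceType) (G : J -> C),
    (forall j, compact_obj (G j)) /\ generating_set G.

End Preadditive.

Record tridata := TriData {
  tcat :> preadditive;
  sh : tcat -> tcat;
  shm : forall X Y : tcat, hom X Y -> hom (sh X) (sh Y);
  dist : forall X Y Z : tcat, hom X Y -> hom Y Z -> hom Z (sh X) -> Prop }.
Arguments sh {t} X.
Arguments shm {t X Y} f.
Arguments dist {t X Y Z} u v w.

Section Triangulated.
Variable T : tridata.

(** The shift is only an autoequivalence: the shifts by [1] and by [-1] of
    complexes are inverse to each other up to isomorphism. *)
Definition shift_autoequivalence : Prop :=
  [/\ forall X : T, shm (idm X) = idm (sh X),
    forall (X Y Z : T) (g : hom Y Z) (f : hom X Y),
      shm (comp g f) = comp (shm g) (shm f),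
    forall (X Y : T) (f g : hom X Y), shm (f + g) = shm f + shm g,
    forall X Y : T, bijective (@shm T X Y)
    & forall Y : T, exists X : T, isomorphic (sh X) Y].

Definition tri_morphism (X Y Z X' Y' Z' : T)
    (u : hom X Y) (v : hom Y Z) (w : hom Z (sh X))
    (u' : hom X' Y') (v' : hom Y' Z') (w' : hom Z' (sh X'))
    (a : hom X X') (b : hom Y Y') (c : hom Z Z') : Prop :=
  [/\ comp b u = comp u' a, comp c v = comp v' b
    & comp (shm a) w = comp w' c].

Definition TR1 : Prop :=
  [/\ forall (X Y Z X' Y' Z' : T) (u : hom X Y) (v : hom Y Z)
        (w : hom Z (sh X)) (u' : hom X' Y') (v' : hom Y' Z')
        (w' : hom Z' (sh X')) (a : hom X X') (b : hom Y Y') (c : hom Z Z'),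
      dist u v w -> tri_morphism u v w u' v' w' a b c ->
      is_iso a -> is_iso b -> is_iso c -> dist u' v' w',
    forall X Z : T, is_zero Z ->
      dist (idm X) (0 : hom X Z) (0 : hom Z (sh X))
    & forall (X Y : T) (u : hom X Y), exists (Z : T) (v : hom Y Z)
      (w : hom Z (sh X)), dist u v w].

Definition TR2 : Prop :=
  forall (X Y Z : T) (u : hom X Y) (v : hom Y Z) (w : hom Z (sh X)),
    dist u v w <-> dist v w (- shm u).

Definition TR3 : Prop :=
  forall (X Y Z X' Y' Z' : T)
    (u : hom X Y) (v : hom Y Z) (w : hom Z (sh X))
    (u' : hom X' Y') (v' : hom Y' Z') (w' : hom Z' (sh X'))
    (a : hom X X') (b : hom Y Y'),
    dist u v w -> dist u' v' w' -> comp b u = comp u' a ->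
    exists c : hom Z Z', tri_morphism u v w u' v' w' a b c.

Definition TR4 : Prop :=
  forall (X Y Z X' Y' Z' : T) (u : hom X Y) (v : hom Y Z)
    (j : hom Y Z') (k : hom Z' (sh X))
    (l : hom Z X') (m : hom X' (sh Y))
    (p : hom Z Y') (q : hom Y' (sh X)),
    dist u j k -> dist v l m -> dist (comp v u) p q ->
    exists (f : hom Z' Y') (g : hom Y' X'),
      dist f g (comp (shm j) m) /\
      [/\ comp f j = comp p v, comp q f = k, comp g p = l
        & comp m g = comp (shm u) q].

Definition triangulated : Prop :=
  is_additive T /\
  [/\ shift_autoequivalence, TR1, TR2, TR3 & TR4].

Definition compactly_generated_triangulated : Prop :=
  [/\ triangulated, has_coproducts T & compactly_generated T].

Section FullSub.
Variable P : T -> Prop.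

Definition full_preadditive : preadditive :=
  @Preadditive {X : T | P X} (fun X Y => hom (sval X) (sval Y))
    (fun X => idm (sval X)) (fun X Y Z => @comp T (sval X) (sval Y) (sval Z))
    (fun X Y Z W => @compA T (sval X) (sval Y) (sval Z) (sval W))
    (fun X Y => @comp1m T (sval X) (sval Y))
    (fun X Y => @compm1 T (sval X) (sval Y))
    (fun X Y Z => @compDl T (sval X) (sval Y) (sval Z))
    (fun X Y Z => @compDr T (sval X) (sval Y) (sval Z)).

Variable shP : forall X : T, P X -> P (sh X).

Definition full_tridata : tridata :=
  @TriData full_preadditive
    (fun X => exist P (sh (sval X)) (shP (svalP X)))
    (fun X Y => @shm T (sval X) (sval Y))
    (fun X Y Z => @dist T (sval X) (sval Y) (sval Z)).

End FullSub.

End Triangulated.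

(** Function modules [I -> V] make the universe of the carriers of the
    [choiceType]s a lower bound for that of the carriers of modules. The index
    types in [has_coproducts] and [compactly_generated] are therefore small
    relatively to the class of all modules. *)
Definition small_index (R : pzRingType) (I : choiceType) (V : lmodType R) :
  lmodType R := I -> V.

Section HomotopyCategory.
Variable R : pzRingType.

Definition catK : preadditive :=
  @Preadditive (cplx R) (@homK R) (fun X => homK_pi (cmap_id X)) (@compK R)
    (@compKA R) (@compK1m R) (@compKm1 R) (@compKDl R) (@compKDr R).

(** The triangles isomorphic in [K(R)] to the standard one
    [X' -> Y' -> cone f -> shift X'] of a chain map [f]. *)
Definition distK (X Y Z : catK) (u : hom X Y) (v : hom Y Z)
    (w : hom Z (shift X : catK)) : Prop :=
  exists (X' Y' : cplx R) (f : cmap X' Y')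
    (a : @hom catK X' X) (b : @hom catK Y' Y) (c : @hom catK (cone f) Z),
    [/\ is_iso a, is_iso b & is_iso c] /\
    [/\ comp b (homK_pi f : @hom catK X' Y') = comp u a,
      comp c (homK_pi (cone_in f) : @hom catK Y' (cone f)) = comp v b
      & comp (shiftK a : @hom catK (shift X') (shift X))
          (homK_pi (cone_out f) : @hom catK (cone f) (shift X'))
        = comp w c].

Definition triK : tridata := @TriData catK (@shift R) (@shiftK R) distK.

Definition Gorenstein_projective (X : triK) : Prop :=
  exists (P : int -> cplx R) (f : forall i, cmap (P i) (P (i + 1))),
    [/\ forall i, CE_projective (P i),
      strongly_CE_exact f,
      isomorphic X (kerC (f 0) : triK)
      & forall Q : cplx R, CE_projective Q ->
        forall i : int, exact_at
          (fun b : homK (P (i + 1 + 1)) Q => compK b (homK_pi (f (i + 1))))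
          (fun b : homK (P (i + 1)) Q => compK b (homK_pi (f i)))].

End HomotopyCategory.

(* Main.v *)
(** A 0-Gorenstein ring is quasi-Frobenius: projective modules are injective, by
    Baer's criterion and the left Noetherian condition, and every module embeds in
    a projective one, because every nonzero module contains a simple submodule and
    every simple module embeds in [R]. Consequently an object of [K(R)] is
    Gorenstein projective if and only if it is isomorphic to a complex of
    projectives: such a complex has syzygies and cosyzygies made of discs and
    spheres, and a Cartan-Eilenberg projective complex is homotopy equivalent to its
    homology, whose components are injective. Complexes of projectives are closed
    under shifts, cones and direct sums. Compact generators are the projective
    coresolutions of the cyclic modules [R / L]: homotopy classes of maps from such
    a coresolution into a complex [X] of (injective) projectives are the same as
    homotopy classes of maps from [R / L]. These commute with direct sums, and if
    they all vanish then [X] is acyclic with injective cycles by Baer's criterion,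
    hence contractible. *)

From Pilot Require Import Defs.
From HB Require Import structures.
From mathcomp Require Import all_boot all_order all_algebra.
From mathcomp Require Import finmap boolp classical_sets functions cardinality fsbigop.
From mathcomp Require Import zify.
(* [mathcomp.algebra.vector] shadows [hom]. *)
Import Pilot.Defs.

Set Implicit Arguments.
Unset Strict Implicit.
Unset Printing Implicit Defensive.

Import GRing.Theory.
Local Open Scope ring_scope.
Local Open Scope quotient_scope.
Local Open Scope classical_set_scope.

(** * Modules *)

Section Modules.
Variable R : pzRingType.
Implicit Types V W X E : lmodType R.

(** The embedding into projectives is the hard part: the descending chain condition is never
    established, and idempotents take its place. Left self-injectivity turns an inclusion of left
    annihilators into a divisibility, and with both chain conditions it puts a high power of every
    [a] in [R] into a group whose identity is an idempotent lying in [a R] and in [R a]. This has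
    two uses. A maximal left ideal over the annihilator [I] of a suitable module is generated modulo
    [I] by an idempotent, whose complement yields a simple submodule. And a minimal idempotent [f]
    has a local corner ring [f R f] with nil radical, so that a simple module with a nonzero element
    fixed by [f] is determined by [f]. Passing from [f] to the idempotent of a simple submodule of
    [R f] is injective on isomorphism classes, and every sequence of classes has a repetition; this
    is why no simple module is missing from the socle of [R]. *)

Definition lin_of V W (f : V -> W) (Hf : linear f) : {linear V -> W} :=
  HB.pack f (GRing.isLinear.Build R V W *:%R f Hf).

Definition is_submod V (S : set V) : Prop :=
  S 0 /\ forall a x y, S x -> S y -> S (a *: x + y).

Lemma mksub_closed V (S : set V) : is_submod S -> submod_closed [pred x | `[< S x >]].
Proof.
by move=> [S0 SL]; split=> [|a x y]; rewrite !inE //; apply: SL.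
Qed.
Definition mksub V (S : set V) (HS : is_submod S) : submod V :=
  Submod (mksub_closed HS).

Lemma mksubE V (S : set V) (HS : is_submod S) x :
  (x \in submod_pred (mksub HS)) <-> S x.
Proof. by rewrite inE. Qed.

Lemma submodP V (U : submod V) : is_submod [set x | x \in submod_pred U].
Proof. by split=> [|a x y] /=; [exact: rpred0 | move=> xU yU; rewrite rpredD ?rpredZ]. Qed.

Definition sub_elt V (U : submod V) x (Ux : x \in submod_pred U) : sub_of U :=
  exist (fun y => y \in submod_pred U) x Ux.

Section IsSubmod.
Variables (V : lmodType R) (S : set V) (HS : is_submod S).
Lemma submZ a x : S x -> S (a *: x).
Proof. by move=> Sx; rewrite -[_ *: _]addr0; apply: HS.2 => //; apply: HS.1. Qed.
Lemma submD x y : S x -> S y -> S (x + y).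
Proof. by move=> Sx Sy; rewrite -[x]scale1r; apply: HS.2. Qed.
Lemma submB x y : S x -> S y -> S (x - y).
Proof. by move=> Sx Sy; rewrite addrC -scaleN1r; apply: HS.2. Qed.
End IsSubmod.

(** Without a maximal member, choice would iterate strict enlargements into a chain that never
    stabilizes. *)
Lemma noetherian_max V (Phi : set V -> Prop) : noetherian V ->
  (exists2 S, is_submod S & Phi S) ->
  exists S, [/\ is_submod S, Phi S &
    forall S', is_submod S' -> Phi S' -> S `<=` S' -> S' `<=` S].
Proof.
move=> NV [S0 HS0 PS0]; apply: contrapT => nomax.
pose T := {S : set V | is_submod S /\ Phi S}.
have next (t : T) : exists t' : T, sval t `<=` sval t' /\ ~ sval t' `<=` sval t.
  case: t => S [HS PS]; apply: contrapT => H; apply: nomax.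
  exists S; split=> // S' HS' PS' SS'; apply: contrapT => nSS.
  by apply: H; exists (exist _ S' (conj HS' PS')).
pose F t := projT1 (cid (next t)).
have FP t : sval t `<=` sval (F t) /\ ~ sval (F t) `<=` sval t.
  exact: (projT2 (cid (next t))).
pose s n : T := iter n F (exist _ S0 (conj HS0 PS0)).
have [n Hn] := NV (fun k => mksub (svalP (s k)).1)
  ltac:(move=> k x /mksubE xk; apply/mksubE; exact: (FP (s k)).1).
apply: (FP (s n)).2 => x xs; apply/(mksubE (svalP (s n)).1).
by rewrite -(Hn n.+1 (leqnSn n)); apply/mksubE.
Qed.

Lemma im_linE V W (f : {linear V -> W}) y :
  (y \in submod_pred (im_mod f)) <-> exists x, f x = y.
Proof. by rewrite inE. Qed.

Lemma ker_linE V W (f : {linear V -> W}) x :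
  (x \in submod_pred (ker_mod f)) <-> f x = 0.
Proof. by rewrite inE; split=> [/eqP|->]. Qed.

Lemma linear_factor V W X (g : {linear V -> W}) (f : {linear V -> X}) :
  surjective_map g -> (forall x, g x = 0 -> f x = 0) ->
  exists h : {linear W -> X}, forall x, h (g x) = f x.
Proof.
move=> gsurj gf.
pose s y := projT1 (cid (gsurj y)).
have sP y : g (s y) = y by exact: (projT2 (cid (gsurj y))).
have fE x y : g x = g y -> f x = f y.
  by move=> e; apply/eqP; rewrite -subr_eq0 -linearB gf // linearB e subrr.
have L : linear (fun y => f (s y)).
  by move=> a x y; rewrite -linearP; apply: fE; rewrite linearP !sP.
by exists (lin_of L) => x; apply: fE; rewrite sP.
Qed.

Lemma linear_inj0 V W (f : {linear V -> W}) :
  (forall x, f x = 0 -> x = 0) -> injective f.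
Proof.
move=> f0 x y e; apply/eqP; rewrite -subr_eq0; apply/eqP/f0.
by rewrite linearB e subrr.
Qed.

Lemma linear_inverse V W (f : {linear V -> W}) :
  injective f -> surjective_map f ->
  exists g : {linear W -> V}, cancel f g /\ cancel g f.
Proof.
move=> finj fsurj.
have [x fx0|g gf] := @linear_factor V W V f (idfun : {linear V -> V}) fsurj.
  by apply: finj; rewrite linear0.
by exists g; split=> // y; have [x <-] := fsurj y; rewrite gf.
Qed.

Lemma projective_retract V W (i : {linear W -> V}) (p : {linear V -> W}) :
  cancel i p -> projective_mod V -> projective_mod W.
Proof.
move=> ip PV M N g f gsurj.
have [h hP] := PV M N g (f \o p : {linear V -> N}) gsurj.
by exists (h \o i : {linear W -> M}) => x; rewrite /= hP /= ip.
Qed.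

Lemma injective_retract V W (i : {linear W -> V}) (p : {linear V -> W}) :
  cancel i p -> injective_mod V -> injective_mod W.
Proof.
move=> ip IV M N j f jinj.
have [h hP] := IV M N j (i \o f : {linear M -> V}) jinj.
by exists (p \o h : {linear N -> W}) => x; rewrite /= hP /= ip.
Qed.

Lemma projective_section V W (g : {linear V -> W}) :
  projective_mod W -> surjective_map g -> exists s : {linear W -> V}, cancel s g.
Proof.
move=> PW gsurj; have [s sP] := PW V W g (idfun : {linear W -> W}) gsurj.
by exists s.
Qed.

Lemma projective_pair V W : projective_mod V -> projective_mod W ->
  projective_mod (V * W)%type.
Proof.
move=> PV PW M N g f gs.
have L1 : linear (fun x : V => f (x, 0)).
  by move=> a x y; rewrite -linearP; congr (f (_, _)); rewrite /= scaler0 addr0.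
have L2 : linear (fun x : W => f (0, x)).
  by move=> a x y; rewrite -linearP; congr (f (_, _)); rewrite /= scaler0 addr0.
have [h1 H1] := PV M N g (lin_of L1) gs.
have [h2 H2] := PW M N g (lin_of L2) gs.
have L : linear (fun z : V * W => h1 z.1 + h2 z.2).
  by move=> a x y; rewrite /= !linearP scalerDr addrACA.
exists (lin_of L) => -[x y] /=; rewrite linearD H1 H2 /= -linearD.
by congr (f (_, _)); rewrite /= ?addr0 ?add0r.
Qed.

Lemma lin_to_sub V W (U : submod W) (f : {linear V -> W}) :
  (forall x, f x \in submod_pred U) ->
  exists g : {linear V -> sub_of U}, forall x, val (g x) = f x.
Proof.
move=> fU; have L : linear (fun x => sub_elt (fU x)).
  by move=> a x y; apply: val_inj; rewrite /= linearP.
by exists (lin_of L).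
Qed.

Lemma im_surj V W (f : {linear V -> W}) :
  exists2 g : {linear V -> sub_of (im_mod f)}, forall x, val (g x) = f x & surjective_map g.
Proof.
have [x|g gP] := @lin_to_sub V W (im_mod f) f; first by apply/im_linE; exists x.
exists g => // y; have /im_linE[x xy] := valP y.
by exists x; apply: val_inj; rewrite gP.
Qed.

Lemma quot_pi0 V (U : submod V) (x : V) :
  (\pi_(quot_of U) x = 0) <-> x \in submod_pred U.
Proof. by rewrite -(linear0 (\pi_(quot_of U))) quot_of_eq subr0. Qed.

Lemma quot_pi_surj V (U : submod V) : surjective_map (\pi_(quot_of U) : V -> quot_of U).
Proof. by move=> y; exists (repr y); rewrite reprK. Qed.

(** Both maps descend to [V / Ker d], where [d] becomes injective. With a differential for [d], this
    produces the components of chain maps and of homotopies into injective modules. *)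
Lemma injective_factor V W E (d : {linear V -> W}) (f : {linear V -> E}) :
  injective_mod E -> (forall x, d x = 0 -> f x = 0) ->
  exists g : {linear W -> E}, forall x, g (d x) = f x.
Proof.
move=> IE df; pose Q := quot_of (ker_mod d).
have pE x : (\pi_Q x = 0) <-> d x = 0 by rewrite quot_pi0 ker_linE.
have [x /pE //|d' d'P] := @linear_factor V Q W \pi_Q d (@quot_pi_surj _ _).
have [x /pE /df //|f' f'P] := @linear_factor V Q E \pi_Q f (@quot_pi_surj _ _).
have d'inj : injective d'.
  apply: linear_inj0 => y; have [x <-] := quot_pi_surj y.
  by rewrite d'P => /pE.
have [g gP] := IE _ _ d' f' d'inj.
by exists g => x; rewrite -d'P gP f'P.
Qed.

End Modules.

(** * Zorn's lemma and Baer's criterion *)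

Lemma Zorn_above T (S0 : set T) (Q : set T -> Prop) : Q S0 ->
  (forall F : set (set T), F !=set0 -> (forall S, F S -> Q S /\ S0 `<=` S) ->
     total_on F subset -> Q (\bigcup_(S in F) S)) ->
  exists S, [/\ S0 `<=` S, Q S & forall S', Q S' -> S `<=` S' -> S' `<=` S].
Proof.
(* [Zorn_bigcup] also tests the empty chain, whose union is empty; asking [Q] of the union of [A]
   with [S0] reduces that case to [Q S0]. *)
move=> Q0 Qchain; have [F FP Ftot|A [QA Amax]] := @Zorn_bigcup T (fun A => Q (A `|` S0)).
  have [->|/set0P[A0 FA0]] := eqVneq F set0; first by rewrite bigcup_set0 set0U.
  rewrite (_ : _ `|` _ = \bigcup_(S in [set A `|` S0 | A in F]) S); last first.
    apply/seteqP; split=> [x [[A FA Ax]|S0x]|x [_ [A FA <-]] [Ax|S0x]].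
    - by exists (A `|` S0); [exists A | left].
    - by exists (A0 `|` S0); [exists A0 | right].
    - by left; exists A.
    - by right.
  apply: Qchain; first by exists (A0 `|` S0), A0.
    by move=> _ [A FA <-]; split; [exact: FP | move=> x; right].
  move=> _ _ [A FA <-] [B FB <-].
  by case: (Ftot _ _ FA FB) => AB; [left|right]; apply: setSU.
exists (A `|` S0); split=> [x||S' QS' AS']; [by right | by [] |].
move=> x S'x; apply: contrapT => nAx.
have S0S' : S' `|` S0 = S' by apply/setUidPl => y Sy; apply: AS'; right.
apply: (Amax S'); last by rewrite S0S'.
split=> [y Ay|S'A]; first by apply: AS'; left.
by apply: nAx; left; apply: S'A.
Qed.

Section Baer.
Variable R : pzRingType.
Implicit Types V W E : lmodType R.

Lemma chain_submod V (F : set (set V)) : F !=set0 -> (forall S, F S -> is_submod S) ->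
  total_on F subset -> is_submod (\bigcup_(S in F) S).
Proof.
move=> [S0 FS0] FP Ftot; split; first by exists S0 => //; case: (FP _ FS0).
move=> a x y [S FS Sx] [S' FS' S'y].
case: (Ftot _ _ FS FS') => SS.
  by exists S' => //; apply: (FP _ FS').2 => //; apply: SS.
by exists S => //; apply: (FP _ FS).2 => //; apply: SS.
Qed.

Definition linear_on V W (L : set V) (f : V -> W) : Prop :=
  forall a x y, L x -> L y -> f (a *: x + y) = a *: f x + f y.

(** A map on a left ideal is encoded as a total function that is linear on [L], so that no subtype
    of [R] appears. *)
Definition Baer E : Prop := forall (L : set R) (f : R -> E),
  is_submod (L : set R^o) -> linear_on (L : set R^o) f ->
  exists c : E, forall r : R, L r -> f r = r *: c.

Lemma injective_Baer E : injective_mod E -> Baer E.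
Proof.
move=> IE L f HL fL.
pose U := mksub HL.
have Lval (x : sub_of U) : L (val x) by apply/(mksubE HL); exact: valP.
have H : linear (fun x : sub_of U => f (val x)).
  by move=> a x y; rewrite linearP fL //; exact: Lval.
have [h hP] := IE _ _ (val : {linear sub_of U -> R^o}) (lin_of H) val_inj.
exists (h 1) => r Lr; have Ur : (r : R^o) \in submod_pred U by apply/(mksubE HL).
by have /= <- := hP (sub_elt Ur); rewrite -linearZ /= /GRing.scale /= mulr1.
Qed.

(* Zorn's lemma is applied to the graphs of the partial extensions. *)
Lemma Baer_injective E : Baer E -> injective_mod E.
Proof.
move=> BE M N i f iinj.
pose G0 : set (N * E) := [set z | exists m, z = (i m, f m)].
pose Q (G : set (N * E)) := is_submod G /\ forall e, G (0, e) -> e = 0.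
have [|F F0 FP Ftot|G [G0G [HG Gfun] Gmax]] := @Zorn_above _ G0 Q.
- split=> [|e [m [/esym im0 ->]]]; last first.
    by rewrite (_ : m = 0) ?linear0 //; apply: iinj; rewrite im0 linear0.
  split=> [|a x y [m ->] [m' ->]]; first by exists 0; rewrite !linear0.
  by exists (a *: m + m'); rewrite !linearP.
- split=> [|e [S FS S0e]]; first by apply: chain_submod => // S /FP[[]].
  by have [[_ SP] _] := FP _ FS; apply: SP.
have Guniq x e e' : G (x, e) -> G (x, e') -> e = e'.
  move=> Ge Ge'; apply/eqP; rewrite -subr_eq0; apply/eqP/Gfun.
  have -> : (0, e - e') = (x, e) - (x, e') :> N * E by congr (_, _); rewrite /= subrr.
  exact: submB.
have Gtot x : exists e, G (x, e).
  (* Multipliers of [x] into the domain of [G]. Baer's criterion on this ideal gives a value [c] for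
     [x] that does not conflict with [G]. *)
  pose L : set R := [set r | exists e, G (r *: x, e)].
  have LL (a r s : R) : L r -> L s -> L (a * r + s).
    move=> [e Ge] [e' Ge']; exists (a *: e + e').
    rewrite (_ : (_, _) = a *: (r *: x, e) + (s *: x, e')) //; first exact: HG.2.
    by congr (_, _); rewrite /= scalerDl -scalerA.
  have HL : is_submod (L : set R^o).
    split=> [|a r s]; last exact: LL.
    by exists 0; rewrite scale0r; exact: HG.1.
  have [p pP] : {p : R -> E | forall r, L r -> G (r *: x, p r)}.
    apply/cid; have pp r : exists e, L r -> G (r *: x, e).
      by have [[e Ge]|nL] := pselect (L r); [exists e | exists 0].
    by exists (fun r => projT1 (cid (pp r))) => r; exact: (projT2 (cid (pp r))).
  have pLL (a r s : R) : L r -> L s -> p (a * r + s) = a *: p r + p s.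
    move=> Lr Ls; apply: (Guniq ((a * r + s) *: x)); first by apply: pP; exact: LL.
    rewrite (_ : (_, _) = a *: (r *: x, p r) + (s *: x, p s)).
      by apply: HG.2; exact: pP.
    by congr (_, _); rewrite /= scalerDl -scalerA.
  have pL : linear_on (L : set R^o) p by move=> a r s; exact: pLL.
  have [c cP] := BE L p HL pL.
  have Gc (r : R) e : G (r *: x, e) -> e = r *: c.
    move=> Ge; have Lr : L r by exists e.
    by rewrite -cP //; apply: Guniq (pP _ Lr).
  exists c.
  pose G' : set (N * E) := [set z | exists (r : R) n e, G (n, e) /\ z = (n + r *: x, e + r *: c)].
  have GG' : G `<=` G'.
    by move=> [n e] Gne; exists 0, n, e; rewrite !scale0r !addr0.
  have G'Q : Q G'.
    split=> [|e [r [n [e' [Gne [/esym nr ->]]]]]]; last first.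
      have nE : n = (- r) *: x by rewrite scaleNr; apply/eqP; rewrite -addr_eq0 nr.
      by move: Gne; rewrite nE => /Gc ->; rewrite scaleNr addNr.
    split=> [|a _ _ [r [n [e [Gne ->]]]] [r' [n' [e' [Gne' ->]]]]].
      by apply: GG'; exact: HG.1.
    exists (a * r + r'), (a *: n + n'), (a *: e + e'); split; first exact: (HG.2 a _ _ Gne Gne').
    by congr (_, _); rewrite /= !scalerDr !scalerDl !scalerA addrACA.
  apply: (Gmax _ G'Q GG'); exists 1, 0, 0; split; first exact: HG.1.
  by rewrite !add0r !scale1r.
pose h x := projT1 (cid (Gtot x)).
have hP x : G (x, h x) by exact: (projT2 (cid (Gtot x))).
have hL : linear h.
  move=> a x y; apply: Guniq (hP _) _.
  exact: (HG.2 a _ _ (hP x) (hP y)).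
exists (lin_of hL) => x; apply: Guniq (hP _) _.
by apply: G0G; exists x.
Qed.

End Baer.

(** * Direct sums of modules *)

Section DirectSum.
Variables (R : pzRingType) (I : choiceType) (M : I -> lmodType R).

Definition dprod_of : Type := forall i, M i.
HB.instance Definition _ := gen_eqMixin dprod_of.
HB.instance Definition _ := gen_choiceMixin dprod_of.

Definition dprod_zero : dprod_of := fun=> 0.
Definition dprod_opp (x : dprod_of) : dprod_of := fun i => - x i.
Definition dprod_add (x y : dprod_of) : dprod_of := fun i => x i + y i.
Definition dprod_scale (a : R) (x : dprod_of) : dprod_of := fun i => a *: x i.

Lemma dprod_ext (x y : dprod_of) : (forall i, x i = y i) -> x = y.
Proof. exact: functional_extensionality_dep. Qed.

Lemma dprod_addA : associative dprod_add.
Proof. by move=> x y z; apply: dprod_ext => i; exact: addrA. Qed.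
Lemma dprod_addC : commutative dprod_add.
Proof. by move=> x y; apply: dprod_ext => i; exact: addrC. Qed.
Lemma dprod_add0 : left_id dprod_zero dprod_add.
Proof. by move=> x; apply: dprod_ext => i; exact: add0r. Qed.
Lemma dprod_addN : left_inverse dprod_zero dprod_opp dprod_add.
Proof. by move=> x; apply: dprod_ext => i; exact: addNr. Qed.
HB.instance Definition _ := GRing.isZmodule.Build dprod_of
  dprod_addA dprod_addC dprod_add0 dprod_addN.

Lemma dprod_scaleA a b (x : dprod_of) :
  dprod_scale a (dprod_scale b x) = dprod_scale (a * b) x.
Proof. by apply: dprod_ext => i; exact: scalerA. Qed.
Lemma dprod_scale1 : left_id 1 dprod_scale.
Proof. by move=> x; apply: dprod_ext => i; exact: scale1r. Qed.
Lemma dprod_scaleDr : right_distributive dprod_scale +%R.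
Proof. by move=> a x y; apply: dprod_ext => i; exact: scalerDr. Qed.
Lemma dprod_scaleDl (x : dprod_of) : {morph dprod_scale^~ x : a b / a + b}.
Proof. by move=> a b; apply: dprod_ext => i; exact: scalerDl. Qed.
HB.instance Definition _ := GRing.Zmodule_isLmodule.Build R dprod_of
  dprod_scaleA dprod_scale1 dprod_scaleDr dprod_scaleDl.

Definition fsupp (x : dprod_of) : set I := [set i | x i != 0].

Lemma dsum_submod : is_submod [set x : dprod_of | finite_set (fsupp x)].
Proof.
split=> [|a x y /= xf yf].
  by apply: sub_finite_set (finite_set0 I) => i; change ((0 : M i) != 0 -> False); rewrite eqxx.
apply: sub_finite_set (_ : finite_set (fsupp x `|` fsupp y)); last by rewrite finite_setU.
move=> i /= nz; have [xi|xi] := eqVneq (x i) 0; [right | by left].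
by apply: contra nz => /eqP yi; apply/eqP; change (a *: x i + y i = 0); rewrite xi yi scaler0 addr0.
Qed.

Definition dsum : lmodType R := sub_of (mksub dsum_submod).

Definition dsum_val (x : dsum) (i : I) : M i := (val x : dprod_of) i.

Lemma dsum_ext (x y : dsum) : (forall i, dsum_val x i = dsum_val y i) -> x = y.
Proof. by move=> xy; apply: val_inj; apply: dprod_ext. Qed.

Lemma dsum_val_linear i : linear (dsum_val^~ i).
Proof. by move=> a x y; rewrite /dsum_val linearP. Qed.

Definition dsum_proj i : {linear dsum -> M i} := lin_of (dsum_val_linear i).

Lemma dsum_finite (x : dsum) : finite_set [set i | dsum_val x i != 0].
Proof. by apply/(mksubE dsum_submod); exact: (valP x). Qed.

Lemma dsum_mk (x : forall i, M i) : finite_set [set i | x i != 0] ->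
  exists y : dsum, forall i, dsum_val y i = x i.
Proof.
move=> xf; have xP : (x : dprod_of) \in submod_pred (mksub dsum_submod) by apply/mksubE.
by exists (sub_elt xP).
Qed.

Definition dsum_inj_fun i (x : M i) : dprod_of := fun j =>
  if @eqP _ i j is ReflectT e then ecast k (M k) e x else 0.

Lemma dsum_inj_refl i x : @dsum_inj_fun i x i = x.
Proof. by rewrite /dsum_inj_fun; case: eqP => // e; rewrite eq_axiomK. Qed.
Lemma dsum_inj_neq i j x : i != j -> @dsum_inj_fun i x j = 0.
Proof. by rewrite /dsum_inj_fun; case: eqP. Qed.

Lemma dsum_inj_fin i (x : M i) : dsum_inj_fun x \in submod_pred (mksub dsum_submod).
Proof.
apply/mksubE; apply: sub_finite_set (finite_set1 i) => j /=.
move=> xj; apply: contrapT => ji; move: xj; rewrite /fsupp /= dsum_inj_neq ?eqxx //.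
by apply/eqP => e; apply: ji.
Qed.

Definition dsum_inj_elt i (x : M i) : dsum :=
  sub_elt (dsum_inj_fin x).

Lemma dsum_inj_linear i : linear (@dsum_inj_elt i).
Proof.
move=> a x y; apply: val_inj; apply: dprod_ext => j.
rewrite linearP /=; change (dsum_inj_fun (a *: x + y) j = a *: dsum_inj_fun x j + dsum_inj_fun y j).
have [<-|ij] := eqVneq i j; first by rewrite !dsum_inj_refl.
by rewrite !dsum_inj_neq // scaler0 addr0.
Qed.

Definition dsum_inj i : {linear M i -> dsum} := lin_of (@dsum_inj_linear i).

Lemma dsum_injE i x j : dsum_val (dsum_inj i x) j = dsum_inj_fun x j.
Proof. by []. Qed.

Lemma dsum_sum (x : dsum) : x = \sum_(i \in [set: I]) dsum_inj i (dsum_val x i).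
Proof.
apply: dsum_ext => j; rewrite -(fsbig_widen [set i | dsum_val x i != 0] setT) //; last first.
  move=> i [_ /=/negP]; rewrite negbK => /eqP e.
  by change (dsum_inj i (dsum_val x i) = 0); rewrite e linear0.
rewrite fsbig_finite; last exact: dsum_finite.
rewrite -[RHS]/(dsum_proj j _) linear_sum.
rewrite [RHS](_ : _ = \sum_(i <- fset_set [set i | dsum_val x i != 0])
  dsum_val (dsum_inj i (dsum_val x i)) j) //.
have [xj|xj] := eqVneq (dsum_val x j) 0.
  rewrite xj big1 // => i _; rewrite dsum_injE; have [e|ij] := eqVneq i j.
    by case: j / e xj => xj; rewrite dsum_inj_refl.
  by rewrite dsum_inj_neq.
rewrite (bigD1_seq j) /= ?fset_uniq //; last first.
  by rewrite in_fset_set; [apply/mem_set | exact: dsum_finite].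
by rewrite dsum_injE dsum_inj_refl big1 ?addr0 // => i ij; rewrite dsum_injE dsum_inj_neq.
Qed.

Section Out.
Variables (N : lmodType R) (g : forall i, {linear M i -> N}).

Lemma dsum_out_linear : linear (fun x : dsum => \sum_(i \in [set: I]) g i (dsum_val x i)).
Proof.
move=> a x y.
(* The three sums have different supports; all of them can be taken over this finite set. *)
pose A := [set i | dsum_val x i != 0] `|` [set i | dsum_val y i != 0].
have Af : finite_set A by rewrite finite_setU; split; exact: dsum_finite.
have AE (z : dsum) : (forall i, ~ A i -> dsum_val z i = 0) ->
    \sum_(i \in [set: I]) g i (dsum_val z i) = \sum_(i <- fset_set A) g i (dsum_val z i).
  move=> zA; rewrite -(fsbig_widen A setT) ?fsbig_finite //.
  by move=> i [_ /= /zA e]; rewrite /preimage /= e linear0.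
have xA i : ~ A i -> dsum_val x i = 0 by move=> nA; apply/eqP/negPn/negP => H; apply: nA; left.
have yA i : ~ A i -> dsum_val y i = 0 by move=> nA; apply/eqP/negPn/negP => H; apply: nA; right.
rewrite !AE //; last first.
  by move=> i nA; rewrite dsum_val_linear xA // yA // scaler0 addr0.
rewrite scaler_sumr -big_split /=; apply: eq_bigr => i _.
by rewrite -linearP /= dsum_val_linear.
Qed.

Definition dsum_out : {linear dsum -> N} := lin_of dsum_out_linear.

Lemma dsum_outK i x : dsum_out (dsum_inj i x) = g i x.
Proof.
rewrite -[LHS]/(\sum_(j \in [set: I]) g j (dsum_val (dsum_inj i x) j)) -(fsbig_widen [set i] setT) //; last first.
  move=> j [_ /= ji]; rewrite /preimage /= dsum_injE dsum_inj_neq ?linear0 //.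
  by apply/eqP => e; apply: ji.
by rewrite fsbig_set1 dsum_injE dsum_inj_refl.
Qed.

End Out.

Lemma dsum_hom_ext (N : lmodType R) (f g : {linear dsum -> N}) :
  (forall i x, f (dsum_inj i x) = g (dsum_inj i x)) -> f =1 g.
Proof.
move=> fg x; rewrite (dsum_sum x) -(fsbig_widen [set i | dsum_val x i != 0] setT) //; last first.
  move=> i [_ /=/negP]; rewrite negbK => /eqP e.
  by change (dsum_inj i (dsum_val x i) = 0); rewrite e linear0.
rewrite fsbig_finite; last exact: dsum_finite.
by rewrite !linear_sum; apply: eq_bigr => i _.
Qed.
End DirectSum.

(** * Free covers, and injectivity of projective modules *)

Section Free.
Variable R : pzRingType.

Lemma dsum_projective (I : choiceType) (M : I -> lmodType R) :
  (forall i, projective_mod (M i)) -> projective_mod (dsum M).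
Proof.
move=> PM A B g f gs.
have H i : exists h : {linear M i -> A}, forall x, g (h x) = f (dsum_inj M i x).
  exact: (PM i A B g (f \o dsum_inj M i : {linear M i -> B}) gs).
pose h i := projT1 (cid (H i)).
have hP i x : g (h i x) = f (dsum_inj M i x) by exact: (projT2 (cid (H i)) x).
exists (dsum_out h).
apply: (@dsum_hom_ext R I M B (g \o dsum_out h : {linear dsum M -> B}) f) => i x.
by rewrite -hP -(dsum_outK h).
Qed.

Lemma regular_projective : projective_mod (R^o : lmodType R).
Proof.
move=> A B g f gs; have [a aP] := gs (f 1).
have L : linear (fun r : R^o => (r : R) *: a).
  by move=> c x y; rewrite scalerDl -scalerA.
exists (lin_of L) => x /=; rewrite linearZ /= aP -linearZ /=.
by congr (f _); exact: mulr1.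
Qed.

Lemma free_cover (V : lmodType R) :
  exists (F : lmodType R) (p : {linear F -> V}), projective_mod F /\ surjective_map p.
Proof.
have L (v : V) : linear (fun r : R^o => (r : R) *: v).
  by move=> c x y; rewrite scalerDl -scalerA.
pose M := fun _ : V => (R^o : lmodType R).
exists (dsum M), (dsum_out (fun v => lin_of (L v) : {linear M v -> V})).
split; first by apply: dsum_projective => v; exact: regular_projective.
move=> v; exists (dsum_inj M v 1).
by rewrite dsum_outK; exact: scale1r.
Qed.

Lemma finite_nat_bound (B : set nat) : finite_set B -> exists k, forall m, B m -> (m < k)%N.
Proof.
move=> Bf; exists (\big[maxn/0%N]_(m <- fset_set B) m).+1 => m Bm; rewrite ltnS.
by apply: (@leq_bigmax_seq _ _ _ (fun m => m)) => //; rewrite in_fset_set //; apply/mem_set.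
Qed.

Lemma infinite_set_sequence (I : choiceType) (A : set I) : ~ finite_set A ->
  exists s : nat -> I, injective s /\ forall m, A (s m).
Proof.
move=> /infiniteP/card_leP[f].
pose i (m : nat) : set_type [set: nat] := SigSub (mem_setT m).
exists (fun m => val (f (i m))); split=> [m m' /val_inj|m]; last exact/set_mem/valP.
by move=> /(inj (in_setT _) (in_setT _)) /(congr1 val).
Qed.

Hypothesis NR : noetherian (R^o : lmodType R).

(** Each coordinate of [f] has the form [r -> r *: c i], and the point is that almost all [c i]
    vanish. If [c] were nonzero along an infinite sequence of indices, the ideals of those [r] whose
    coordinates vanish from the [k]-th index on would exhaust [L] and stabilize, so some coordinate
    of the sequence would vanish on all of [L]. *)
Lemma noetherian_dsum_injective (I : choiceType) (E : I -> lmodType R) :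
  (forall i, injective_mod (E i)) -> injective_mod (dsum E).
Proof.
move=> IE; apply: Baer_injective => L f HL fL.
(* The second clause normalizes [c i] to zero for a vanishing coordinate; the finiteness of the
   support depends on it. *)
have [c cP] : exists c : forall i, E i, forall i, (forall r, L r -> dsum_val (f r) i = r *: c i) /\
    ((forall r, L r -> dsum_val (f r) i = 0) -> c i = 0).
  have H i : exists c : E i, (forall r, L r -> dsum_val (f r) i = r *: c) /\
      ((forall r, L r -> dsum_val (f r) i = 0) -> c = 0).
    have [z|nz] := pselect (forall r, L r -> dsum_val (f r) i = 0).
      by exists 0; split=> // r Lr; rewrite z // scaler0.
    have [|c cP] := injective_Baer (IE i) (f := fun r => dsum_val (f r) i) HL.
      by move=> a x y Lx Ly; rewrite fL // (dsum_val_linear i).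
    by exists c.
  by exists (fun i => projT1 (cid (H i))) => i; exact: (projT2 (cid (H i))).
have cf : finite_set [set i | c i != 0].
  apply: contrapT => /infinite_set_sequence[s [sinj sc]].
  pose Lk k : set R^o := [set r | L r /\ forall m, (k <= m)%N -> dsum_val (f r) (s m) = 0].
  have HLk k : is_submod (Lk k).
    have f0 : f 0 = 0.
      have := fL (-1) 0 0 HL.1 HL.1.
      by rewrite scaler0 add0r scaleN1r addNr.
    split=> [|a x y [Lx xz] [Ly yz]]; first by split=> [|m _]; [exact: HL.1 | rewrite f0].
    split=> [|m km]; first exact: HL.2.
    by rewrite fL // (dsum_val_linear (s m)) xz // yz // scaler0 addr0.
  have [k k' /mksubE[Lk' z]|k kP] := NR (U := fun k => mksub (HLk k)).
    by apply/mksubE; split=> // m /ltnW; exact: z.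
  have ck : c (s k) = 0.
    apply: (cP (s k)).2 => r Lr.
    pose B := [set m | dsum_val (f r) (s m) != 0].
    have Bf : finite_set B.
      apply: (@finite_preimage _ _ [set i | dsum_val (f r) i != 0] s); last exact: dsum_finite.
      by move=> x y _ _; exact: sinj.
    have [k' k'P] := finite_nat_bound Bf.
    have : (r : R^o) \in submod_pred (mksub (HLk (maxn k k'))).
      apply/mksubE; split=> // m; rewrite geq_max => /andP[_ k'm].
      apply/eqP/negPn/negP => /k'P; by rewrite ltnNge k'm.
    by rewrite kP ?leq_maxl // => /mksubE[_]; apply.
  by have := sc k; rewrite /= ck eqxx.
have [c' c'P] := dsum_mk cf.
exists c' => r Lr; apply: dsum_ext => i; rewrite (cP i).1 // -c'P.
by rewrite -[RHS]/(dsum_proj E i (r *: c')) linearZ.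
Qed.

(** [P] is a direct summand of a direct sum of copies of the injective module [R]. *)
Lemma projective_injective (P : lmodType R) : injective_mod (R^o : lmodType R) ->
  projective_mod P -> injective_mod P.
Proof.
move=> IR PP.
have L (v : P) : linear (fun r : R^o => (r : R) *: v).
  by move=> c x y; rewrite scalerDl -scalerA.
pose M := fun _ : P => (R^o : lmodType R).
pose p := dsum_out (fun v => lin_of (L v) : {linear M v -> P}).
have [s sp] : exists s : {linear P -> dsum M}, cancel s p.
  apply: projective_section => // v; exists (dsum_inj M v 1).
  by rewrite dsum_outK; exact: scale1r.
apply: injective_retract sp _.
by apply: noetherian_dsum_injective.
Qed.
End Free.

(** * Left modules over the ring embed in projective modules *)

(** Equivalently, [R x] is a simple module. *)
Definition simple_elt (R : pzRingType) (V : lmodType R) (x : V) : Prop :=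
  x != 0 /\ forall r : R, r *: x != 0 -> exists r' : R, r' *: (r *: x) = x.

(* The nonzero idempotents [f] such that [f R f] is local with nil radical. *)
Definition primitive_idem (R : pzRingType) (f : R) : Prop :=
  [/\ f != 0, f * f = f & forall a, f * a = a -> a * f = a ->
    (exists n, a ^+ n = 0) \/ exists w, [/\ f * w = w, w * f = w, a * w = f & w * a = f]].

(* [R f] and [R g] are isomorphic. *)
Definition eqv_idem (R : pzRingType) (f g : R) : Prop :=
  exists u v, [/\ f * u = u, u * g = u, g * v = v & v * f = v] /\ (u * v = f /\ v * u = g).

Section SimpleElements.
Variable R : pzRingType.
Implicit Types V W : lmodType R.

Lemma simple_eltZ V (x : V) r : simple_elt x -> r *: x != 0 -> simple_elt (r *: x).
Proof.
move=> [x0 xs] rx0; split=> // q qrx.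
have [|r' r'P] := xs (q * r); first by rewrite -scalerA.
by exists (r * r'); rewrite -scalerA (scalerA q r) r'P.
Qed.

Lemma expr_fix V (a : R) (x : V) n : a *: x = x -> a ^+ n *: x = x.
Proof. by move=> ax; elim: n => [|n IH]; rewrite ?expr0 ?scale1r // exprS -scalerA IH. Qed.

(** If [r] kills [x] but not [y], some [g * (r' * r) * g] kills [x] and fixes [y], so in the local
    corner ring of [g] it is neither invertible nor nilpotent. By symmetry, two simple elements
    fixed by [g] have the same annihilator. *)
Lemma simple_ann V W (g : R) (x : V) (y : W) : primitive_idem g ->
  x != 0 -> simple_elt y -> g *: x = x -> g *: y = y ->
  forall r, r *: x = 0 -> r *: y = 0.
Proof.
move=> [g0 gg gP] x0 [y0 ys] gx gy r rx; apply/eqP/negPn/negP => /ys [r' r'P].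
have ay : (g * (r' * r) * g) *: y = y by rewrite -!scalerA gy r'P gy.
have ax : (g * (r' * r) * g) *: x = 0 by rewrite -!scalerA gx rx !scaler0.
have [||[n an]|[w [_ _ _ wa]]] := gP (g * (r' * r) * g).
- by rewrite !mulrA gg.
- by rewrite -!mulrA gg.
- by move: y0; rewrite -(expr_fix n ay) an scale0r eqxx.
- by move: x0; rewrite -gx -wa -scalerA ax scaler0 eqxx.
Qed.

Lemma idem_nilpotent0 (p : R) n : p * p = p -> p ^+ n = 0 -> p = 0.
Proof.
move=> pp pn; have := @expr_fix (R^o : lmodType R) p p n pp.
by rewrite pn scale0r.
Qed.

Lemma eqv_idem_sym (f g : R) : eqv_idem f g -> eqv_idem g f.
Proof. by move=> [u [v [[? ? ? ?] [? ?]]]]; exists v, u. Qed.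

(** [c * d] has an inverse [w] in the local ring [f R f]. Then [d * w * c] is an idempotent of
    [g R g], nonzero because [f] factors through it, hence equal to [g]. *)
Lemma eqv_idem_nonnilpotent (f g c d : R) : primitive_idem f -> primitive_idem g ->
  f * c = c -> c * g = c -> g * d = d -> d * f = d ->
  (forall n, (c * d) ^+ n <> 0) -> eqv_idem f g.
Proof.
move=> [f0 ff fP] [_ _ gP] fc cg gd df cdn.
have [||[n /cdn//]|[w [fw wf cdw wcd]]] := fP (c * d).
- by rewrite mulrA fc.
- by rewrite -mulrA df.
exists c, (d * w); split; first by split; rewrite // ?mulrA ?gd // -mulrA wf.
have pp : d * w * c * (d * w * c) = d * w * c.
  by rewrite -!mulrA (mulrA c) (mulrA (c * d)) cdw (mulrA w f) wf.
split; first by rewrite mulrA.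
have [||[n pn]|[w' [_ _ pw' _]]] := gP (d * w * c).
- by rewrite !mulrA gd.
- by rewrite -!mulrA cg.
- have p0 := idem_nilpotent0 pp pn.
  have E : f = c * (d * w * c) * (d * w) by rewrite !mulrA cdw fc cdw.
  by move: f0; rewrite E p0 mulr0 mul0r eqxx.
- have pg : d * w * c * g = d * w * c by rewrite -mulrA cg.
  by rewrite -[LHS]pg -pw' mulrA pp.
Qed.

(** [f - z] fixes the last nonzero [f * z ^+ k], so it is not nilpotent. This makes the nilpotents
    of a local corner ring closed under addition. *)
Lemma primitive_sum (f z : R) n m : primitive_idem f -> f * z = z -> z * f = z ->
  z ^+ n = 0 -> (f - z) ^+ m = 0 -> False.
Proof.
move=> [f0 ff _] fz zf zn fzm.
have H : exists n, f * z ^+ n == 0 by exists n; rewrite zn mulr0.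
case: (ex_minnP H) => -[|k] /eqP k0 kmin.
  by move: f0; rewrite -[f]mulr1 -(expr0 z) k0 eqxx.
have y0 : f * z ^+ k != 0 by apply/negP => /kmin; rewrite ltnn.
have zk : z ^+ k.+1 = 0 by rewrite -[RHS]k0 exprS mulrA fz.
have fy : (f - z) *: (f * z ^+ k : R^o) = f * z ^+ k.
  by rewrite -[LHS]/((f - z) * (f * z ^+ k)) mulrBl !mulrA ff zf -exprS zk subr0.
by move: y0; rewrite -(expr_fix m fy) fzm scale0r eqxx.
Qed.

Lemma annihilator_submod V (x : V) : is_submod ([set r : R | r *: x = 0] : set R^o).
Proof.
split=> [|a r s /= rx sx]; first by rewrite /= scale0r.
by rewrite -[_ *: r]/(a * r) scalerDl -scalerA rx sx scaler0 addr0.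
Qed.

Hypothesis NL : noetherian (R^o : lmodType R).
Hypothesis NR : noetherian ((R^c)^o : lmodType R^c).
Hypothesis IR : injective_mod (R^o : lmodType R).

(** The map [r * x -> r * y] on [R x] extends to [R] by injectivity, and left linear endomorphisms
    of [R] are right multiplications. *)
Lemma ann_divides (x y : R) : (forall r, r * x = 0 -> r * y = 0) -> exists c, y = x * c.
Proof.
move=> xy.
have L (z : R) : linear (fun r : R^o => (r : R) * z : R^o).
  by move=> c r s; rewrite mulrDl; congr (_ + _); exact/esym/mulrA.
have [g gP] := @injective_factor R R^o R^o R^o (lin_of (L x)) (lin_of (L y)) IR xy.
exists (g 1); have := gP 1; rewrite /= !mul1r => <-.
by rewrite -[in RHS]/(x *: g 1) -linearZ; congr (g _); rewrite /= /GRing.scale /= mulr1.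
Qed.

(* For [N] large, [b := a ^+ N.+1] and [b * b] have the same left and right
   annihilators; then [b] lies in a group with identity [h]. *)
Lemma idempotent_power (a : R) : exists h n, [/\ h * h = h, exists u, h = a * u,
  exists v, h = v * a & a ^+ n * h = a ^+ n].
Proof.
have [k x xk|n nP] := NL (U := fun k => mksub (annihilator_submod (a ^+ k : R^o))).
  move: xk => /mksubE xk; apply/mksubE.
  by rewrite /= exprSr; change (x * (a ^+ k * a) = 0); rewrite mulrA (_ : x * _ = 0) ?mul0r.
(* Right annihilators are right ideals, that is, left submodules over [R^c]; the right chain
   condition enters here. *)
have HS k : is_submod ([set r : R | a ^+ k * r = 0] : set (R^c)^o).
  split=> [|b r s /= ar as_]; first by rewrite /= mulr0.
  change (a ^+ k * ((r : R) * (b : R) + (s : R)) = 0).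
  by rewrite mulrDr mulrA ar as_ mul0r addr0.
have [k x xk|m mP] := NR (U := fun k => mksub (HS k)).
  move: xk => /mksubE xk; apply/mksubE.
  by rewrite /= exprS -mulrA; change (a * (a ^+ k * (x : R)) = 0); rewrite xk mulr0.
pose N := maxn n m; pose b := a ^+ N.+1.
have bb : b * b = a ^+ (N.+1 + N.+1) by rewrite exprD.
have lb r : r * (b * b) = 0 -> r * b = 0.
  move=> rbb; have : (r : R^o) \in submod_pred (mksub (annihilator_submod (a ^+ (N.+1 + N.+1) : R^o))).
    by apply/mksubE; rewrite -bb.
  have nN : (n <= N.+1)%N by rewrite ltnW // ltnS leq_maxl.
  by rewrite nP ?(leq_trans nN) ?leq_addr // -(nP N.+1) // => /mksubE.
have rb r : b * (b * r) = 0 -> b * r = 0.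
  move=> bbr; have : (r : (R^c)^o) \in submod_pred (mksub (HS (N.+1 + N.+1)%N)).
    by apply/mksubE; rewrite /= -bb -mulrA.
  have mN : (m <= N.+1)%N by rewrite ltnW // ltnS leq_maxr.
  by rewrite mP ?(leq_trans mN) ?leq_addr // -(mP N.+1) // => /mksubE.
(* Now [b = b * b * c]. Cancelling a factor [b] on the left, as [rb] allows, gives [b * c * b = b]
   and [b * c * c * b = b * c]; thus [h = b * c] is idempotent and is also a left multiple of
   [b]. *)
have [c cP] := ann_divides lb.
have bcb : b * c * b = b.
  apply/eqP; rewrite -subr_eq0 -mulrA -{3}[b]mulr1 -mulrBr; apply/eqP/rb.
  by rewrite mulrA mulrBr mulr1 mulrA -cP subrr.
have hcb : b * c * c * b = b * c.
  apply/eqP; rewrite -subr_eq0 -!mulrA -mulrBr; apply/eqP/rb.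
  by rewrite mulrA mulrBr !mulrA -cP bcb subrr.
exists (b * c), N.+1; split.
- by rewrite mulrA bcb.
- by exists (a ^+ N * c); rewrite mulrA -exprS.
- by exists (b * c * c * a ^+ N); rewrite -mulrA -exprSr.
- by rewrite mulrA -cP.
Qed.

(* The maximality of [I] among annihilators of nonzero submodules of [S] makes it
   a prime ideal. Modulo a prime ideal nil one-sided ideals vanish, so that every
   left ideal not contained in [I] contains an idempotent outside [I]. *)
Section PrimeAnnihilator.
Variables (V : lmodType R) (S : set V) (I : set R).
Hypotheses (HS : is_submod S) (Snz : exists2 x, S x & x != 0).
Hypothesis IE : forall r, I r <-> forall x, S x -> r *: x = 0.
Hypothesis Imax : forall S' : set V, is_submod S' -> S' `<=` S ->
  (exists2 x, S' x & x != 0) -> forall r, (forall x, S' x -> r *: x = 0) -> I r.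

Let I0 : I 0. Proof. by apply/IE => x _; rewrite scale0r. Qed.
Let ID r s : I r -> I s -> I (r + s).
Proof. by move=> /IE Ir /IE Is; apply/IE => x Sx; rewrite scalerDl Ir // Is // addr0. Qed.
Let IN r : I r -> I (- r).
Proof. by move=> /IE Ir; apply/IE => x Sx; rewrite scaleNr Ir // oppr0. Qed.
Let IMl r s : I s -> I (r * s).
Proof. by move=> /IE Is; apply/IE => x Sx; rewrite -scalerA Is // scaler0. Qed.
Let IMr r s : I r -> I (r * s).
Proof. by move=> /IE Ir; apply/IE => x Sx; rewrite -scalerA Ir //; exact: submZ. Qed.
Let I1 : ~ I 1.
Proof. by move=> /IE H; have [x Sx] := Snz; rewrite -[x]scale1r H // eqxx. Qed.

(** If [b] does not kill [m] in [S], the elements of [S] killed by all [a * r] form a nonzero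
    submodule, since [b *: m] is one of them. Its annihilator contains [a] and lies in [I] by
    maximality. *)
Let Iprime a b : (forall r, I (a * r * b)) -> ~ I b -> I a.
Proof.
move=> ab /IE/existsNP[m /not_implyP[Sm bm]].
apply: (Imax (S' := [set x | S x /\ forall r, (a * r) *: x = 0])).
- split=> [|c x y [Sx xr] [Sy yr]]; first by split=> [|r]; [exact: HS.1 | rewrite scaler0].
  split=> [|r]; first exact: HS.2.
  by rewrite scalerDr scalerA -mulrA xr yr addr0.
- by move=> x [].
- exists (b *: m); last exact/eqP.
  split=> [|r]; first exact: submZ.
  by rewrite scalerA; move/IE: (ab r) => ->.
- by move=> x [_ /(_ 1)]; rewrite mulr1.
Qed.

(** If some [u * a] is not nilpotent modulo [I], its idempotent lies outside [I]. Otherwise the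
    right ideal [a R] is nil modulo [I], which Levitzki's argument excludes. *)
Let idem_outside a : ~ I a -> exists h, [/\ h * h = h, exists v, h = v * a & ~ I h].
Proof.
move=> nIa; suff [u uP] : exists u, forall n, ~ I ((u * a) ^+ n).
  have [h [n [hh _ [v hv] uah]]] := idempotent_power (u * a).
  exists h; split=> //; first by exists (v * u); rewrite -mulrA.
  by move=> Ih; apply: (uP n); rewrite -uah; exact: IMl.
apply: contrapT => H.
have nil u : exists n, I ((a * u) ^+ n).
  apply: contrapT => Hn; apply: H; exists u => n In; apply: Hn; exists n.+1.
  have -> : (a * u) ^+ n.+1 = a * (u * a) ^+ n * u.
    elim: n {In} => [|n IH]; first by rewrite expr1 expr0 mulr1.
    by rewrite exprS IH [in RHS]exprS !mulrA.
  exact/IMr/IMl.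
(* Among the [a * u] outside [I], let [y] have maximal left annihilator modulo [I]. If [y * r] is
   outside [I], its last power [z] outside [I] has the same annihilator as [y], and [y * r * z] is
   in [I]. So [y * r * y] is in [I] for all [r], against primeness. *)
pose lann y := [set r : R | I (r * y)].
have Hlann y : is_submod (lann y : set R^o).
  split=> [|c r s /= ry sy]; first by rewrite /lann /= mul0r.
  by rewrite /lann /= mulrDl; apply: ID => //; rewrite -[_ *: r]/(c * r) -mulrA; exact: IMl.
have [|L [_ [u [nIau ->]]] Lmax] :=
    noetherian_max (Phi := fun L : set R^o => exists u, ~ I (a * u) /\ L = lann (a * u)) NL.
  by exists (lann a); rewrite //; exists 1; rewrite mulr1.
set y := a * u in nIau Lmax.
suff : I y by [].
apply: (@Iprime y y) => // r.
have nily : exists n, `[< I ((y * r) ^+ n) >].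
  by have [n In] := nil (u * r); exists n; apply/asboolP; rewrite -mulrA.
case: (ex_minnP nily) => -[|[|k]] /asboolP Ik kmin.
- by case: I1; rewrite expr0 in Ik.
- by rewrite expr1 in Ik; exact: IMr.
pose z := (y * r) ^+ k.+1.
have nIz : ~ I z by move=> Iz; have /kmin := asboolT Iz; rewrite ltnn.
have zE : z = a * (u * r * (y * r) ^+ k) by rewrite /z exprS /y !mulrA.
apply: (Lmax (lann z) (Hlann z)).
- by exists (u * r * (y * r) ^+ k); rewrite -zE.
- move=> s /= sy; rewrite /lann /= /z exprS !mulrA; apply: IMr; apply: IMr.
  by rewrite -mulrA.
- by rewrite /lann /= /z -exprS.
Qed.

Let max_over : exists M : set R, [/\ is_submod (M : set R^o), I `<=` M, ~ M 1 &
  forall r, ~ M r -> exists m s, M m /\ 1 = m + s * r].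
Proof.
have [|M [HM [IM M1] Mmax]] :=
    noetherian_max (Phi := fun L : set R^o => (I : set R^o) `<=` L /\ ~ L 1) NL.
  exists (I : set R^o) => //; split=> // a x y Ix Iy; apply: ID => //; exact: IMl.
exists (M : set R); split=> // r nMr; apply: contrapT => H; apply: nMr.
pose M' : set R := [set x | exists m s, M m /\ x = m + s * r].
have MM' : M `<=` M' by move=> m Mm; exists m, 0; rewrite mul0r addr0.
apply: (Mmax (M' : set R^o)) => //; last first.
- by exists 0, 1; rewrite mul1r add0r; split=> //; exact: HM.1.
- by split=> // x /IM /MM'.
- split=> [|a _ _ [m [s [Mm ->]]] [m' [s' [Mm' ->]]]]; first by apply: MM'; exact: HM.1.
  exists (a *: (m : R^o) + m'), (a * s + s'); split; first exact: HM.2.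
  by rewrite scalerDr mulrDl addrACA; congr (_ + (_ + _)); exact: mulrA.
Qed.

(** Let [M] be a maximal left ideal over [I], and [e] an idempotent of [M] with [R e + I] maximal.
    Then [M = R e + I]: otherwise there is an idempotent [g] of [M] outside [I] with [g * e = 0],
    and [e + g - e * g] enlarges [R e + I]. Hence [M] kills every [(1 - e) *: m], and a nonzero one
    generates a copy of [R / M]. *)
Lemma simple_in_prime : exists2 x, S x & simple_elt x.
Proof.
have [M [HM IM M1 Mmax]] := max_over.
pose gen e : set R := [set x | exists r i, I i /\ x = r * e + i].
have Hgen e : is_submod (gen e : set R^o).
  split=> [|a _ _ [r [i [Ii ->]]] [r' [i' [Ii' ->]]]].
    by exists 0, 0; rewrite mul0r addr0.
  exists (a * r + r'), (a * i + i'); split; first by apply: ID => //; exact: IMl.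
  by rewrite mulrDl -[_ *: (_ + _)]/(a * (r * e + i)) mulrDr !mulrA addrACA.
have [|L [_ [e [Me [ee ->]]] Lmax]] :=
  noetherian_max (Phi := fun L : set R^o => exists e : R, M e /\ e * e = e /\ L = gen e) NL.
  exists (gen 0 : set R^o) => //; exists 0; rewrite mul0r; split=> //; exact: HM.1.
have MB x y : M x -> M y -> M (x - y) by exact: (submB HM).
have MM r x : M x -> M (r * x) by exact: (submZ HM).
have Mgen y : M y -> gen e y.
  move=> My; have [Iye|] := pselect (I (y - y * e)).
    by exists y, (y - y * e); rewrite addrCA subrr addr0.
  move=> /idem_outside[g [gg [v gv] nIg]]; case: nIg.
  have ge : g * e = 0 by rewrite gv -mulrA mulrBl -mulrA ee subrr mulr0.
  have Mg : M g by rewrite gv; apply: (MM v _); apply: (MB y _) => //; exact: MM.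
  pose e' := e + g - e * g.
  have ge' : g * e' = g by rewrite /e' mulrBr mulrDr ge gg mulrA ge mul0r add0r subr0.
  have ee' : e * e' = e by rewrite /e' mulrBr mulrDr ee mulrA ee addrK.
  have e'e' : e' * e' = e'.
    by rewrite {1}/e' mulrBl mulrDl ee' ge' -mulrA ge'.
  have Me' : M e' by apply: MB; [exact: (submD HM Me Mg) | exact: MM].
  have gen_ee' : gen e `<=` gen e'.
    by move=> _ [r [i [Ii ->]]]; exists (r * e), i; rewrite -mulrA ee'.
  have gen_g : gen e' g by exists g, 0; rewrite ge' addr0.
  have [|r [i [Ii gE]]] := Lmax (gen e' : set R^o) (Hgen e') _ gen_ee' g gen_g.
    by exists e'.
  have -> : g = i - i * e.
    by rewrite -[LHS]subr0 -ge {2}gE mulrDl -mulrA ee {1}gE opprD addrACA subrr add0r.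
  by apply: ID => //; apply: IN; exact: IMr.
have nIf : ~ I (1 - e).
  move=> /IM M1e; apply: M1; rewrite -[1](subrK e); exact: (submD HM).
have /IE/existsNP[m /not_implyP[Sm fm]] := nIf.
have Mx r : M r -> r *: ((1 - e) *: m) = 0.
  move=> /Mgen[q [i [Ii ->]]]; rewrite scalerA mulrDl -mulrA mulrBr mulr1 ee subrr mulr0 add0r.
  by have /IE -> := IMr (1 - e) Ii.
exists ((1 - e) *: m); first exact: submZ.
split=> [|r rx]; first exact/eqP.
have nMr : ~ M r by move=> /Mx e0; rewrite e0 eqxx in rx.
have [m' [s [Mm' E]]] := Mmax r nMr.
set x := (1 - e) *: m in Mx rx *.
exists s; have := congr1 (fun c => c *: x) E.
by rewrite /= scale1r scalerDl (Mx _ Mm') add0r -scalerA.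
Qed.

End PrimeAnnihilator.

(** A nonzero submodule of [S] whose annihilator is maximal meets the assumptions of
    [simple_in_prime]. *)
Lemma simple_exists V (S : set V) : is_submod S -> (exists2 x, S x & x != 0) ->
  exists2 x, S x & simple_elt x.
Proof.
move=> HS Snz.
pose ann (S' : set V) : set R := [set r | forall x, S' x -> r *: x = 0].
have Hann S' : is_submod (ann S' : set R^o).
  split=> [|a r s ra sa x S'x]; first by move=> x _; exact: scale0r.
  by rewrite -[_ *: r]/(a * r) scalerDl -scalerA ra // sa // scaler0 addr0.
have [|I [_ [S' [HS' S'S S'nz ->]] Imax]] := noetherian_max (Phi := fun I : set R^o =>
    exists S', [/\ is_submod S', S' `<=` S, exists2 x, S' x & x != 0 & I = ann S']) NL.
  by exists (ann S) => //; exists S; split.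
have [//||x S'x xs] := @simple_in_prime V S' (ann S') HS' S'nz; last by exists x => //; exact: S'S.
- move=> S'' HS'' SS nz r rP.
  apply: (Imax (ann S'') (Hann S'')) => //.
    by exists S''; split=> // x /SS /S'S.
  by move=> s sP x /SS; exact: sP.
Qed.

(** Among the idempotents [f] with [f R t] nonzero, take one with maximal left annihilator. For [a]
    in [f R f], let [h] be the idempotent of a high power of [a]. If [h R t] is nonzero, maximality
    gives [h = f] and [a] is invertible; otherwise [f - h] competes with [f], whence [h = 0] and [a]
    is nilpotent. *)
Lemma primitive_exists V (t : V) : t != 0 ->
  exists f r, primitive_idem f /\ f *: (r *: t) != 0.
Proof.
move=> t0.
pose lann (y : R) := [set r : R | r *: (y : R^o) = 0].
have [|L [_ [f [ff [r frt] ->]] Lmax]] := noetherian_max (Phi := fun L : set R^o =>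
    exists f : R, [/\ f * f = f, exists r : R, f *: (r *: t) != 0 & L = lann f]) NL.
  exists (lann 1); first exact: annihilator_submod.
  by exists 1; split; rewrite ?mulr1 //; exists 1; rewrite !scale1r.
have Lf g : g * g = g -> (forall x, x * f = 0 -> x * g = 0) ->
    (exists r : R, g *: (r *: t) != 0) -> f = g * f.
  move=> gg fg gt; apply/eqP; rewrite -subr_eq0 -{1}[f]mul1r -mulrBl; apply/eqP.
  apply: (Lmax (lann g)) => //; first exact: annihilator_submod.
  - by exists g.
  - by rewrite /lann /=; change ((1 - g) * g = 0); rewrite mulrBl mul1r gg subrr.
exists f, r; split=> //; split=> //.
  by apply: contra frt => /eqP ->; rewrite scale0r.
move=> a fa af; have [h [n [hh [u hu] [v hv] anh]]] := idempotent_power a.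
have fh : f * h = h by rewrite hu mulrA fa.
have hf : h * f = h by rewrite hv -mulrA af.
have [ht|nht] := pselect (exists r : R, h *: (r *: t) != 0).
  right; have hE : f = h.
    by rewrite -[RHS]hf; apply: Lf => // x xf; rewrite -fh mulrA xf mul0r.
  have e1 : a * (f * u * f) = f by rewrite !mulrA af -hu -hE.
  have e2 : (f * v * f) * a = f by rewrite -mulrA fa -mulrA -hv -hE.
  have e3 : f * v * f = f * u * f.
    transitivity (f * v * f * (a * (f * u * f))); first by rewrite e1 -[RHS]mulrA ff.
    by rewrite mulrA e2 !mulrA ff.
  exists (f * u * f); split=> //; rewrite ?mulrA ?ff //; first by rewrite -mulrA ff.
  by rewrite -e3.
left; exists n.
have ht s : h *: (s *: t) = 0 by apply/eqP/negPn/negP => H; apply: nht; exists s.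
have fE : f = (f - h) * f.
  apply: Lf.
  - by rewrite mulrBl !mulrBr ff fh hf hh subrr subr0.
  - by move=> x xf; rewrite -fh -{1}[f]mulr1 -mulrBr mulrA xf mul0r.
  - by exists r; rewrite scalerBl ht subr0.
have h0 : h = 0.
  by move: fE; rewrite mulrBl ff hf => /eqP; rewrite -subr_eq0 opprB addrC subrK => /eqP.
by rewrite -anh h0 mulr0.
Qed.

(** [s] and [u * s'] are simple elements fixed by [g], so they have the same left annihilator and
    are right multiples of each other. The product of the two multipliers, cut down by [f] and [f'],
    fixes [s] and therefore is not nilpotent. *)
Lemma eqv_idem_socle (f f' g g' s s' : R) :
  primitive_idem f -> primitive_idem f' -> primitive_idem g -> eqv_idem g g' ->
  simple_elt (s : R^o) -> simple_elt (s' : R^o) ->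
  g * s = s -> s * f = s -> g' * s' = s' -> s' * f' = s' -> eqv_idem f f'.
Proof.
move=> pf pf' pg [u [v [[gu ug' _ _] [_ vu]]]] ss ss' gs sf gs' sf'.
have us : simple_elt (u * s' : R^o).
  apply: (@simple_eltZ R^o s' u ss'); apply/eqP => us0.
  case: ss' => /eqP s'0 _; apply: s'0.
  by rewrite -gs' -vu -mulrA (_ : u * s' = 0) ?mulr0.
have gus : g * (u * s') = u * s' by rewrite mulrA gu.
have [c cP] : exists c, u * s' = s * c.
  by apply: ann_divides; exact: (@simple_ann R^o R^o g s (u * s') pg ss.1 us gs gus).
have [d dP] : exists d, s = u * s' * d.
  by apply: ann_divides; exact: (@simple_ann R^o R^o g (u * s') s pg us.1 ss gus gs).
have [_ ff _] := pf; have [_ ff' _] := pf'.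
have sc : s * (f * c * f') = u * s' by rewrite !mulrA sf -cP -mulrA sf'.
have sd : u * s' * (f' * d * f) = s by rewrite !mulrA -(mulrA u) sf' -dP sf.
apply: (@eqv_idem_nonnilpotent f f' (f * c * f') (f' * d * f)) => //.
- by rewrite !mulrA ff.
- by rewrite -!mulrA ff'.
- by rewrite !mulrA ff'.
- by rewrite -!mulrA ff.
move=> n H; case: ss => /eqP s0 _; apply: s0.
have E : s * (f * c * f' * (f' * d * f)) = s by rewrite mulrA sc sd.
have En : s * (f * c * f' * (f' * d * f)) ^+ n = s.
  by elim: {H} n => [|n IH]; rewrite ?expr0 ?mulr1 // exprS mulrA E.
by rewrite -En H mulr0.
Qed.

(* The two-sided ideals generated by [f 0, ..., f (n - 1)] stabilize, so some
   [f n] is a sum of elements [x * f i * y] with [i < n], one of which is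
   invertible in the local ring [f n R f n]. *)
Lemma eqv_idem_repeat (f : nat -> R) : (forall n, primitive_idem (f n)) ->
  exists i j, (i < j)%N /\ eqv_idem (f i) (f j).
Proof.
move=> pf.
pose two_sided (S : set R) := is_submod (S : set R^o) /\ forall x r, S x -> S (x * r).
pose J k : set R^o := [set x | forall S, two_sided S -> (forall i, (i < k)%N -> S (f i)) -> S x].
have HJ k : is_submod (J k).
  split=> [S HS _|a x y Jx Jy S HS Sf]; first exact: HS.1.1.
  by apply: HS.1.2; [exact: Jx | exact: Jy].
have [k x /mksubE Jx|n nP] := NL (U := fun k => mksub (HJ k)).
  apply/mksubE => S HS Sf; apply: Jx => // i ik; apply: Sf; exact: ltnW.
have fn : J n (f n).
  apply/(mksubE (HJ n)); rewrite -(nP n.+1) //; apply/mksubE => S HS; exact.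
have [f0 ff fP] := pf n; set e := f n in fn f0 ff fP.
(* The two-sided ideal of elements that contribute only nilpotents to [e R e]. It omits [e], hence
   also one of the generators [f i] of an ideal that contains [e]. *)
pose S : set R := [set x | forall p q, exists m, (e * p * x * q * e) ^+ m = 0].
have unit_e (p x q : R) : (exists m, (e * p * x * q * e) ^+ m = 0) \/
    exists w, [/\ e * w = w, w * e = w & w * (e * p * x * q * e) = e].
  have [||?|[w [ew we _ wE]]] := fP (e * p * x * q * e).
  - by rewrite !mulrA ff.
  - by rewrite -!mulrA ff.
  - by left.
  - by right; exists w.
have SD x y : S x -> S y -> S (x + y).
  (* In the remaining case [w] is a left inverse, and replacing [p] by [w * p] would make [e] a sum
     of two nilpotents. *)
  move=> Sx Sy p q; have [//|[w [ew we wE]]] := unit_e p (x + y) q.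
  have [m1 E1] := Sx (w * p) q; have [m2 E2] := Sy (w * p) q.
  have wp z : e * (w * p) * z * q * e = w * p * z * q * e by rewrite mulrA ew.
  rewrite wp in E1; rewrite wp in E2; exfalso.
  apply: (@primitive_sum e (w * p * x * q * e) m1 m2 (pf n)) => //.
  - by rewrite !mulrA ew.
  - by rewrite -!mulrA ff.
  - rewrite (_ : e - _ = w * p * y * q * e) //; apply/eqP; rewrite subr_eq addrC.
    by rewrite -[X in X == _]wE !mulrA we mulrDr !mulrDl.
have Sideal : two_sided S.
  split; last by move=> x r Sx p q; have [m H] := Sx p (r * q); exists m; rewrite !mulrA in H *.
  split=> [|a x y Sx Sy]; first by move=> p q; exists 1%N; rewrite mulr0 !mul0r expr1.
  apply: SD => // p q; have [m H] := Sx (p * a) q; exists m.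
  by rewrite -[_ *: x]/(a * x) !mulrA in H *.
have [i [ni nSi]] : exists i, (i < n)%N /\ ~ S (f i).
  apply: contrapT => H; have Se : S e.
    by apply: fn => // i ni; apply: contrapT => nS; apply: H; exists i.
  have [m] := Se 1 1; rewrite !mulr1 ff ff => em.
  by move: f0; rewrite (idem_nilpotent0 ff em) eqxx.
exists i, n; split=> //; apply: eqv_idem_sym.
have [fi0 ffi _] := pf i.
have [p [q pq]] : exists p q, forall m, (e * p * f i * q * e) ^+ m <> 0.
  apply: contrapT => H; apply: nSi => p q; apply: contrapT => nm; apply: H.
  by exists p, q => m em; apply: nm; exists m.
apply: (@eqv_idem_nonnilpotent e (f i) (e * p * f i) (f i * q * e)) => //.
- by rewrite !mulrA ff.
- by rewrite -!mulrA ffi.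
- by rewrite !mulrA ffi.
- by rewrite -!mulrA ff.
by move=> m; rewrite !mulrA -(mulrA _ (f i) (f i)) ffi.
Qed.

(* Pigeonhole: [F k.+1] is the idempotent of a simple submodule of [R (F k)]. By
   [eqv_idem_socle] the class of [F k] is determined by that of [F k.+1], hence the
   class of [F 0] recurs, and every simple module occurs in the socle of [R]. *)
Lemma simple_embeds V (t : V) : simple_elt t -> exists s : R, forall r : R, r *: t = 0 <-> r * s = 0.
Proof.
move=> ts; have [f0 [r0 [pf0 ft]]] := primitive_exists ts.1.
have step (f : {f : R | primitive_idem f}) : exists g : {f : R | primitive_idem f},
    exists s, [/\ simple_elt (s : R^o), sval g * s = s & s * sval f = s].
  case: f => f pf; have [fn0 ff _] := pf.
  have HRf : is_submod ([set x : R | x * f = x] : set R^o).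
    split=> [|a x y /= xf yf]; first by rewrite /= mul0r.
    by rewrite mulrDl yf -[_ *: x]/(a * x) -mulrA xf.
  have [|s sf ss] := simple_exists HRf; first by exists (f : R^o).
  have [g [r [pg gs]]] := primitive_exists ss.1.
  have grs : simple_elt (g *: (r *: (s : R^o))).
    rewrite scalerA in gs *; exact: simple_eltZ.
  exists (exist _ g pg), (g * (r * s)); have [_ gg _] := pg; split=> //=.
    by rewrite mulrA gg.
  by rewrite -!mulrA (_ : s * f = s).
pose nxt f := projT1 (cid (step f)).
pose F n := iter n nxt (exist _ f0 pf0).
have FP n : exists s, [/\ simple_elt (s : R^o), sval (F n.+1) * s = s & s * sval (F n) = s].
  exact: (projT2 (cid (step (F n)))).
have [a [b [ab eab]]] := eqv_idem_repeat (fun n => svalP (F n)).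
(* [eqv_idem_socle] lowers both indices by one at a time, until the first one is [F 0]. *)
have descend k i : eqv_idem (sval (F i)) (sval (F (i + k)%N)) -> eqv_idem f0 (sval (F k)).
  elim: i => // i IH; rewrite addSn => e; apply: IH.
  have [s [ss gs sf]] := FP i; have [s' [ss' gs' sf']] := FP (i + k)%N.
  exact: (eqv_idem_socle (svalP _) (svalP _) (svalP _) e ss ss' gs sf gs' sf').
have [k bE] : exists k, b = (a + k.+1)%N by exists (b - a).-1; rewrite prednK ?subn_gt0 // subnKC // ltnW.
rewrite bE in eab; have [u [v [[fu ug gv vf] [uv vu]]]] := descend _ _ eab.
(* [s] is a simple element fixed by [F k.+1]; multiplied by [u] it becomes fixed by [f0], like the
   multiple [f0 *: (r0 *: t)] of [t], so these two have the same annihilator. *)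
have [s [ss gs sf]] := FP k.
have us0 : u * s != 0.
  by apply/eqP => us; case: ss => /eqP s0 _; apply: s0; rewrite -gs -vu -mulrA us mulr0.
have uss : simple_elt (u * s : R^o) by exact: (simple_eltZ (r := u) ss).
have t'ts : simple_elt (f0 *: (r0 *: t)) by rewrite scalerA in ft *; exact: simple_eltZ.
have [r' r'P] : exists r', r' *: (f0 *: (r0 *: t)) = t.
  by have [_ H] := ts; have := H (f0 * r0); rewrite -scalerA; exact.
have [_ f00 _] := pf0.
have ft' : f0 *: (f0 *: (r0 *: t)) = f0 *: (r0 *: t) by rewrite scalerA f00.
have fus : f0 *: (u * s : R^o) = u * s by rewrite -[LHS]/(f0 * (u * s)) mulrA fu.
exists (r' * (u * s)) => r; rewrite -{1}r'P scalerA mulrA; split.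
  exact: (@simple_ann _ R^o f0 _ (u * s) pf0 t'ts.1 uss ft' fus).
exact: (@simple_ann R^o _ f0 (u * s) _ pf0 uss.1 t'ts fus ft').
Qed.

(* Zorn's lemma is applied to the graphs of injective partial maps into a free
   module on the set of elements of [V]. Requiring that the elements supporting
   an image belong to the domain makes each element outside it a fresh index. *)
Lemma embeds_in_projective V :
  exists (P : lmodType R) (i : {linear V -> P}), projective_mod P /\ injective i.
Proof.
pose F : lmodType R := dsum (fun _ : V => (R^o : lmodType R)).
have PF : projective_mod F by apply: dsum_projective => v; exact: regular_projective.
have IF : injective_mod F by exact: noetherian_dsum_injective.
pose Q (G : set (V * F)) := [/\ is_submod G, forall e, G (0, e) -> e = 0,
  forall x, G (x, 0) -> x = 0 &
  forall x e y, G (x, e) -> dsum_val e y != 0 -> exists e', G (y, e')].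
have [|C C0 CP Ctot|G [_ [HG Gfun Ginj Gsupp] Gmax]] := @Zorn_above _ [set (0 : V * F)] Q.
- split=> [|e [->]//|x [->]//|x e y [_ ->]].
    by split=> // a x y /= -> ->; rewrite scaler0 addr0.
  by rewrite (_ : dsum_val 0 y = 0) ?eqxx.
- split=> [|e [S CS Se]|x [S CS Sx]|x e y [S CS Sxe] ey].
  + by apply: chain_submod => // S /CP[[]].
  + by have [[_ H _ _] _] := CP _ CS; apply: H.
  + by have [[_ _ H _] _] := CP _ CS; apply: H.
  + by have [[_ _ _ H] _] := CP _ CS; have [e' ?] := H _ _ _ Sxe ey; exists e', S.
(* The domain of a maximal [G] meets every simple submodule: otherwise [x] could be sent to the copy
   [E] of [s] at the index [x], which no image under [G] uses. *)
have essential x : simple_elt x -> exists r e, r *: x != 0 /\ G (r *: x, e).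
  move=> xs; apply: contrapT => H.
  have Gx r e : G (r *: x, e) -> r *: x = 0.
    by move=> Gr; apply/eqP/negPn/negP => rx; apply: H; exists r, e.
  have [s sP] := simple_embeds xs.
  pose E := dsum_inj (fun _ : V => (R^o : lmodType R)) x s : F.
  pose G' : set (V * F) := [set z | exists (r : R) n e, G (n, e) /\ z = (n + r *: x, e + r *: E)].
  have GG' : G `<=` G'.
    by move=> [n e] Gne; exists 0, n, e; rewrite !scale0r !addr0.
  have xnot e : ~ G (x, e).
    by move=> Gxe; case: xs => /eqP x0 _; apply: x0; rewrite -[x]scale1r (Gx 1 e) // scale1r.
  have rE0 r : r *: x = 0 <-> r *: E = 0.
    rewrite sP -linearZ; split=> [rs|].
      by rewrite (_ : r *: _ = 0) ?linear0.
    move=> /(congr1 (fun e => dsum_val e x)); rewrite dsum_injE dsum_inj_refl.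
    exact.
  have G'Q : Q G'.
    split.
    - split=> [|a _ _ [r [n [e [Gne ->]]]] [r' [n' [e' [Gne' ->]]]]].
        by apply: GG'; exact: HG.1.
      exists (a * r + r'), (a *: n + n'), (a *: e + e'); split; first exact: (HG.2 a _ _ Gne Gne').
      by congr (_, _); rewrite /= !scalerDr !scalerDl !scalerA addrACA.
    - move=> _ [r [n [e [Gne [/esym nr ->]]]]].
      have nE : n = (- r) *: x by rewrite scaleNr; apply/eqP; rewrite -addr_eq0 nr.
      have n0 : n = 0 by rewrite nE; apply: (Gx _ e); rewrite -nE.
      have rx : r *: x = 0 by rewrite -nr n0 add0r.
      by move/rE0: rx => ->; rewrite addr0; apply: Gfun; rewrite -n0.
    - move=> x0 [r [n [e [Gne E0]]]].
      have er : e + r *: E = 0 by exact: esym (congr1 snd E0).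
      rewrite (_ : x0 = n + r *: x); last exact: (congr1 fst E0).
      have ex : dsum_val e x = 0.
        by apply/eqP/negPn/negP => /(Gsupp _ _ _ Gne) [e' /xnot].
      have rE : r *: E = 0.
        apply/rE0/sP; have := congr1 (fun e => dsum_val e x) er.
        by rewrite addrC (dsum_val_linear x) ex addr0 dsum_injE dsum_inj_refl.
      have rx : r *: x = 0 by apply/rE0.
      by move: er; rewrite rE rx !addr0 => e0; apply: Ginj; rewrite -e0.
    - move=> x0 e0 y [r [n [e [Gne E0]]]].
      rewrite (_ : e0 = e + r *: E); last exact: (congr1 snd E0).
      move=> ey.
      have [->|yx] := eqVneq y x.
        by exists E; exists 1, 0, 0; rewrite !add0r !scale1r; split=> //; exact: HG.1.
      have [|e' Ge'] := Gsupp _ e y Gne; last by exists e'; exact: GG'.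
      move: ey; rewrite addrC (dsum_val_linear y) dsum_injE dsum_inj_neq; last by rewrite eq_sym.
      by rewrite (_ : r *: 0 = 0) ?add0r //; exact: scaler0.
  apply: (xnot E); apply: (Gmax _ G'Q GG'); exists 1, 0, 0; split; first exact: HG.1.
  by rewrite !add0r !scale1r.
pose D : set V := [set x | exists e, G (x, e)].
have HD : is_submod D.
  split=> [|a x y [e Gx] [e' Gy]]; first by exists 0; exact: HG.1.
  by exists (a *: e + e'); exact: (HG.2 a _ _ Gx Gy).
have Guniq x e e' : G (x, e) -> G (x, e') -> e = e'.
  move=> Ge Ge'; apply/eqP; rewrite -subr_eq0; apply/eqP/Gfun.
  have -> : (0, e - e') = (x, e) - (x, e') :> V * F by congr (_, _); rewrite /= subrr.
  exact: submB.
pose U := mksub HD.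
have UP (x : sub_of U) : exists e, G (val x, e) by apply/(mksubE HD); exact: valP.
pose g x := projT1 (cid (UP x)).
have gP x : G (val x, g x) by exact: (projT2 (cid (UP x))).
have gL : linear g.
  by move=> a x y; apply: Guniq (gP _) _; rewrite linearP; exact: (HG.2 a _ _ (gP x) (gP y)).
(* A nonzero kernel of the extension [h] would contain a simple element, with a nonzero multiple in
   the domain of [G], where [h] is injective. *)
have [h hP] := IF _ _ (val : {linear sub_of U -> V}) (lin_of gL) val_inj.
exists F, h; split=> //; apply: linear_inj0 => x hx; apply/eqP/negPn/negP => x0.
have HK : is_submod [set x | h x = 0].
  by split=> [|a y z /= hy hz]; rewrite /= ?linear0 // linearP hy hz scaler0 addr0.
have [|y hy /essential [r [e [ry Gr]]]] := simple_exists HK; first by exists x.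
have ryU : r *: y \in submod_pred U by apply/(mksubE HD); exists e.
have hr : h (r *: y) = g (sub_elt ryU) by exact: (hP (sub_elt ryU)).
have : G (r *: y, g (sub_elt ryU)) by exact: (gP (sub_elt ryU)).
rewrite -hr linearZ /= (_ : h y = 0) // scaler0 => /Ginj ry0.
by rewrite /= ry0 eqxx in ry.
Qed.

End SimpleElements.

(** * Formal consequences of the triangulated axioms *)

Section PreadditiveFacts.
Variable C : preadditive.
Implicit Types X Y Z : C.

Lemma comp0m X Y Z (f : hom X Y) : comp (0 : hom Y Z) f = 0.
Proof. by apply: (addIr (comp (0 : hom Y Z) f)); rewrite -compDl !add0r. Qed.
Lemma compm0 X Y Z (g : hom Y Z) : comp g (0 : hom X Y) = 0.
Proof. by apply: (addIr (comp g (0 : hom X Y))); rewrite -compDr !add0r. Qed.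
Lemma compNm X Y Z (g : hom Y Z) (f : hom X Y) : comp (- g) f = - comp g f.
Proof. by apply/eqP; rewrite -addr_eq0 -compDl addNr comp0m. Qed.
Lemma compmN X Y Z (g : hom Y Z) (f : hom X Y) : comp g (- f) = - comp g f.
Proof. by apply/eqP; rewrite -addr_eq0 -compDr addNr compm0. Qed.

Lemma is_iso_id X : is_iso (idm X).
Proof. by exists (idm X); rewrite comp1m. Qed.
Lemma is_iso_comp X Y Z (g : hom Y Z) (f : hom X Y) :
  is_iso g -> is_iso f -> is_iso (comp g f).
Proof.
move=> [g' [g'g gg']] [f' [f'f ff']]; exists (comp f' g'); split.
  by rewrite -compA (compA g') g'g comp1m.
by rewrite -compA (compA f) ff' comp1m.
Qed.
Lemma isomorphic_sym X Y : isomorphic X Y -> isomorphic Y X.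
Proof. by move=> [f [g [gf fg]]]; exists g, f. Qed.
Lemma isomorphic_trans Y X Z : isomorphic X Y -> isomorphic Y Z -> isomorphic X Z.
Proof. by move=> [f If] [g Ig]; exists (comp g f); exact: is_iso_comp. Qed.

Lemma id0_zero X : idm X = 0 -> is_zero X.
Proof.
by move=> i0 Y; split=> f; [rewrite -[f]compm1 i0 compm0 | rewrite -[f]comp1m i0 comp0m].
Qed.

Lemma coproduct_hom_ext (I : Type) (X : I -> C) (S : C) (inj : forall i, hom (X i) S) :
  is_coproduct inj -> forall Y (g g' : hom S Y),
  (forall i, comp g (inj i) = comp g' (inj i)) -> g = g'.
Proof.
move=> cop Y g g' gg'; have [h [_ hu]] := cop Y (fun i => comp g' (inj i)).
by rewrite -(hu g) // -(hu g').
Qed.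

Lemma coproducts_additive : has_coproducts C -> is_additive C.
Proof.
move=> cop; split.
  have [S [inj HS]] := cop void (fun v => match v with end).
  by exists S; apply: id0_zero; apply: coproduct_hom_ext HS _ _ _ _ => -[].
move=> X Y.
have [S [inj HS]] := cop bool (fun b => if b then X else Y).
have [p [pP _]] := HS X (fun b : bool =>
  match b return hom (if b then X else Y) X with true => idm X | false => 0 end).
have [q [qP _]] := HS Y (fun b : bool =>
  match b return hom (if b then X else Y) Y with true => 0 | false => idm Y end).
exists S, (inj true), (inj false), p, q.
rewrite (pP true) (pP false) (qP true) (qP false); split=> //.
apply: coproduct_hom_ext HS _ _ _ _ => b.
rewrite compDl -!compA comp1m pP qP; case: b.
  by rewrite compm1 compm0 addr0.
by rewrite compm1 compm0 add0r.
Qed.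

Lemma coproduct_precomp_iso (I : Type) (X X' : I -> C) (S : C)
    (inj : forall i, hom (X' i) S) (a : forall i, hom (X i) (X' i)) :
  is_coproduct inj -> (forall i, is_iso (a i)) -> is_coproduct (fun i => comp (inj i) (a i)).
Proof.
move=> HS Ia Y f.
pose a' i := projT1 (cid (Ia i)).
have a'P i : comp (a' i) (a i) = idm (X i) /\ comp (a i) (a' i) = idm (X' i).
  exact: (projT2 (cid (Ia i))).
have [g [gP gu]] := HS Y (fun i => comp (f i) (a' i)).
exists g; split=> [i|g' g'P]; first by rewrite compA gP -compA (a'P i).1 compm1.
by apply: gu => i; rewrite -g'P -!compA (a'P i).2 compm1.
Qed.

Lemma coproduct_iso_unique (I : Type) (X : I -> C) (S S' : C)
    (inj : forall i, hom (X i) S) (inj' : forall i, hom (X i) S') :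
  is_coproduct inj -> is_coproduct inj' ->
  exists t : hom S S', forall i, comp t (inj i) = inj' i.
Proof. by move=> HS _; have [t [tP _]] := HS S' inj'; exists t. Qed.

Section Compact.
Variables (I : choiceType) (A : C) (X : I -> C) (S : C) (inj : forall i, hom (X i) S).
Hypothesis HS : is_coproduct inj.

Lemma comp_sumr J (Y Z : C) (g : hom Y Z) (s : seq J) (F : J -> hom A Y) :
  comp g (\sum_(j <- s) F j) = \sum_(j <- s) comp g (F j).
Proof.
elim: s => [|j s IH]; first by rewrite !big_nil compm0.
by rewrite !big_cons compDr IH.
Qed.

Lemma dsum_hom_mapE (g : dsum_hom A X) : dsum_hom_map inj g =
  \sum_(i <- fset_set [set i | sval g i != 0]) comp (inj i) (sval g i).
Proof.
rewrite /dsum_hom_map -(fsbig_widen [set i | sval g i != 0] setT) //.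
  by rewrite fsbig_finite //; exact: (svalP g).
move=> i [_ /=/negP]; rewrite negbK => /eqP e.
by change (comp (inj i) (sval g i) = 0); rewrite e compm0.
Qed.

(* Each component of [g] is recovered from its image by the projection of the
   coproduct onto the corresponding summand. *)
Lemma dsum_hom_map_injective : injective (dsum_hom_map (A := A) inj).
Proof.
move=> g g' gg'; suff E : sval g = sval g'.
  case: g g' {gg'} E => [g gf] [g' gf'] /= E; subst g'.
  by congr exist; exact: Prop_irrelevance.
apply: functional_extensionality_dep => j.
pose d i : hom (X i) (X j) := if @eqP _ i j is ReflectT e then ecast k (hom (X i) (X k)) e (idm (X i)) else 0.
have djj : d j = idm (X j) by rewrite /d; case: eqP => // e; rewrite eq_axiomK.
have dij i : i != j -> d i = 0 by rewrite /d; case: eqP.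
have [p [pP _]] := HS d.
have pg (h : dsum_hom A X) : comp p (dsum_hom_map inj h) = sval h j.
  rewrite dsum_hom_mapE comp_sumr.
  have [hj|hj] := eqVneq (sval h j) 0.
    rewrite hj big1_seq // => i _; rewrite compA pP; have [e|ij] := eqVneq i j.
      by rewrite e hj compm0.
    by rewrite dij // comp0m.
  rewrite (bigD1_seq j) /= ?fset_uniq //; last first.
    by rewrite in_fset_set; [apply/mem_set | exact: (svalP h)].
  rewrite compA pP djj comp1m big1 ?addr0 // => i ij.
  by rewrite compA pP dij // comp0m.
by rewrite -!pg gg'.
Qed.

Lemma dsum_hom_map_bijective : (forall f : hom A S, exists g : dsum_hom A X,
    dsum_hom_map inj g = f) -> bijective (dsum_hom_map (A := A) inj).
Proof.
move=> surj; pose r f := projT1 (cid (surj f)).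
have rP f : dsum_hom_map inj (r f) = f by exact: (projT2 (cid (surj f))).
by exists r => [g|//]; apply: dsum_hom_map_injective.
Qed.

End Compact.

(** Coproducts are unique up to isomorphism and injectivity is automatic, so surjectivity for one
    well-chosen coproduct suffices. *)
Lemma compact_objI (A : C) :
  (forall (I : choiceType) (X : I -> C), exists (S : C) (inj : forall i, hom (X i) S),
    is_coproduct inj /\ forall f : hom A S, exists g : dsum_hom A X, dsum_hom_map inj g = f) ->
  compact_obj A.
Proof.
move=> H I X S inj HS; apply: dsum_hom_map_bijective => // f.
have [S0 [inj0 [HS0 surj]]] := H I X.
have [t tP] := coproduct_iso_unique HS HS0; have [t' t'P] := coproduct_iso_unique HS0 HS.
have t't : comp t' t = idm S.
  by apply: coproduct_hom_ext HS _ _ _ _ => i; rewrite -compA tP t'P comp1m.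
have [g gP] := surj (comp t f); exists g.
rewrite -[f]comp1m -t't -compA -gP !dsum_hom_mapE comp_sumr.
by apply: eq_bigr => i _; rewrite compA t'P.
Qed.

End PreadditiveFacts.

(** * The five lemma, and TR2 and TR4 from special cases *)

Section FormalTriangulated.
Variable T : tridata.
Implicit Types X Y Z : T.
Hypothesis Tzero : exists Z : T, is_zero Z.
Hypothesis SH : shift_autoequivalence T.
Hypothesis HTR1 : TR1 T.
Hypothesis HTR2 : forall (X Y Z : T) (u : hom X Y) (v : hom Y Z) (w : hom Z (sh X)),
  dist u v w -> dist v w (- shm u).
Hypothesis HTR3 : TR3 T.

Lemma shm_id X : shm (idm X) = idm (sh X). Proof. by case: SH. Qed.
Lemma shm_comp X Y Z (g : hom Y Z) (f : hom X Y) : shm (comp g f) = comp (shm g) (shm f).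
Proof. by case: SH. Qed.
Lemma shmD X Y (f g : hom X Y) : shm (f + g) = shm f + shm g.
Proof. by case: SH. Qed.
Lemma shm_inj X Y : injective (@shm T X Y).
Proof. by apply: bij_inj; case: SH. Qed.
Lemma shm_surj X Y (g : hom (sh X) (sh Y)) : exists f, shm f = g.
Proof. by case: SH => _ _ _ /(_ X Y)[h _ hK] _; exists (h g). Qed.
Lemma shm_iso X Y (f : hom X Y) : is_iso f -> is_iso (shm f).
Proof. by move=> [g [gf fg]]; exists (shm g); rewrite -!shm_comp gf fg !shm_id. Qed.
Lemma shm_iso_inv X Y (f : hom X Y) : is_iso (shm f) -> is_iso f.
Proof.
move=> [g' []]; have [g <-] := shm_surj g'; rewrite -!shm_comp -!shm_id.
by move=> /shm_inj gf /shm_inj fg; exists g.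
Qed.

Lemma dist_comp0 X Y Z (u : hom X Y) (v : hom Y Z) (w : hom Z (sh X)) :
  dist u v w -> comp v u = 0.
Proof.
move=> D; have [Z0 Z0P] := Tzero; have [_ H1 _] := HTR1.
have [|c [_ + _]] := HTR3 (a := idm X) (b := u) (H1 X Z0 Z0P) D.
  by rewrite !compm1.
by rewrite compm0 => <-.
Qed.

(** TR3 maps the rotated trivial triangle on [W] to the rotated given one; the resulting map between
    shifts comes from a map [W -> X], as the shift is full. *)
Lemma dist_lift X Y Z (u : hom X Y) (v : hom Y Z) (w : hom Z (sh X)) :
  dist u v w -> forall W (g : hom W Y), comp v g = 0 -> exists h : hom W X, comp u h = g.
Proof.
move=> D W g vg; have [Z0 Z0P] := Tzero; have [_ H1 _] := HTR1.
have [|c [_ _ H]] := HTR3 (a := g) (b := (0 : hom Z0 Z)) (HTR2 (H1 W Z0 Z0P)) (HTR2 D).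
  by rewrite compm0 vg.
have [h hE] := shm_surj c; exists h; apply: shm_inj; apply: oppr_inj.
move: H; rewrite -hE shm_id compNm -shm_comp compmN compm1 => <-.
by [].
Qed.

(** A chase of generalized elements [W -> Z], with [dist_lift] on the rotated triangles as
    exactness. Composition with [c] is bijective on them, and [W := Z'] yields the inverse. *)
Lemma five_lemma X Y Z X' Y' Z' (u : hom X Y) (v : hom Y Z) (w : hom Z (sh X))
    (u' : hom X' Y') (v' : hom Y' Z') (w' : hom Z' (sh X'))
    (a : hom X X') (b : hom Y Y') (c : hom Z Z') :
  dist u v w -> dist u' v' w' -> tri_morphism u v w u' v' w' a b c ->
  is_iso a -> is_iso b -> is_iso c.
Proof.
move=> D D' [ba cb ac] Ia Ib.
have [a' [a'a aa']] := Ia; have [b' [b'b bb']] := Ib.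
have D2 := HTR2 D; have D2' := HTR2 D'; have D3 := HTR2 D2; have D3' := HTR2 D2'.
have cinj W (z : hom W Z) : comp c z = 0 -> z = 0.
  move=> cz; have wz : comp w z = 0.
    have [sa' [sa'a _]] := shm_iso Ia.
    by rewrite -[w]comp1m -sa'a -compA -compA (compA (shm a)) ac -compA cz !compm0.
  have [y yz] := dist_lift D2 wz.
  have v'by : comp v' (comp b y) = 0 by rewrite compA -cb -compA yz cz.
  have [x' x'P] := dist_lift D' v'by.
  have yE : y = comp u (comp a' x').
    have ua' : comp u a' = comp b' u'.
      by rewrite -[LHS]comp1m -b'b -!compA (compA b) ba -compA aa' compm1.
    by rewrite compA ua' -compA x'P compA b'b comp1m.
  by rewrite -yz yE compA (dist_comp0 D) comp0m.
have csurj W (z' : hom W Z') : exists z : hom W Z, comp c z = z'.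
  have [sa' [sa'a saa']] := shm_iso Ia.
  have [|z zP] := dist_lift D3 (g := comp sa' (comp w' z')).
    have sb : comp (shm b) (shm u) = comp (shm u') (shm a) by rewrite -!shm_comp ba.
    have [sb' [sb'b _]] := shm_iso Ib.
    have su : comp (shm u) sa' = comp sb' (shm u').
      by rewrite -[LHS]comp1m -sb'b -!compA (compA (shm b)) sb -compA saa' compm1.
    have uw : comp (shm u') w' = 0.
      by have /eqP := dist_comp0 D3'; rewrite compNm oppr_eq0 => /eqP.
    by rewrite compNm compA su -compA (compA (shm u')) uw comp0m compm0 oppr0.
  have w'0 : comp w' (z' - comp c z) = 0.
    by rewrite compDr compmN compA -ac -compA zP compA saa' comp1m subrr.
  have [y' y'P] := dist_lift D2' w'0.
  exists (z + comp v (comp b' y')).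
  by rewrite compDr compA cb -compA (compA b) bb' comp1m y'P addrC subrK.
have [c' cc'] := csurj _ (idm Z'); exists c'; split=> //.
apply/eqP; rewrite -subr_eq0; apply/eqP/cinj.
by rewrite compDr compmN compA cc' comp1m compm1 subrr.
Qed.

(** Two rotations of the given triangle and three of a triangle on [u] both begin with [- shm u].
    The five lemma makes their comparison an isomorphism, and full faithfulness of the shift brings
    it back to [Z]. *)
Lemma TR2_from_rotation : TR2 T.
Proof.
move=> X Y Z u v w; split; first exact: HTR2.
move=> D; have [Hiso _ Hcone] := HTR1.
have [Z' [v' [w' D']]] := Hcone _ _ u.
have E := HTR2 (HTR2 D); have E' := HTR2 (HTR2 (HTR2 D')).
have c1 : comp (idm (sh Y)) (- shm u) = comp (- shm u) (idm (sh X)) by rewrite compm1 comp1m.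
have [c [_ c2 c3]] := HTR3 E' E c1.
have Ic := five_lemma E' E (And3 c1 c2 c3) (is_iso_id _) (is_iso_id _).
have [c0 c0E] := shm_surj c; rewrite -c0E in Ic c2 c3.
apply: (Hiso _ _ _ _ _ _ u v' w' u v w (idm X) (idm Y) c0 D') => //; try exact: is_iso_id.
- split; first by rewrite compm1 comp1m.
    by apply: shm_inj; rewrite compm1 shm_comp; apply: oppr_inj; rewrite -compmN c2 compm1.
  rewrite shm_id comp1m; apply: shm_inj; apply: oppr_inj; rewrite shm_comp -compNm -c3.
  by rewrite shm_id comp1m.
- exact: shm_iso_inv.
Qed.

(* By TR3 and the five lemma the octahedron may be tested on one choice of the
   three cones. *)
Hypothesis octahedron : forall (X Y Z : T) (u : hom X Y) (v : hom Y Z),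
  exists (Z' : T) (j : hom Y Z') (k : hom Z' (sh X))
    (X' : T) (l : hom Z X') (m : hom X' (sh Y))
    (Y' : T) (p : hom Z Y') (q : hom Y' (sh X)) (f : hom Z' Y') (g : hom Y' X'),
    [/\ dist u j k, dist v l m, dist (comp v u) p q & dist f g (comp (shm j) m)] /\
    [/\ comp f j = comp p v, comp q f = k, comp g p = l & comp m g = comp (shm u) q].

Lemma cone_compare X Y Z Z' (u : hom X Y) (v : hom Y Z) (w : hom Z (sh X))
    (v' : hom Y Z') (w' : hom Z' (sh X)) : dist u v w -> dist u v' w' ->
  exists c : hom Z Z', [/\ is_iso c, comp c v = v' & comp w' c = w].
Proof.
move=> D D'; have [|c [c1 c2 c3]] := HTR3 (a := idm X) (b := idm Y) D D'.
  by rewrite compm1 comp1m.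
exists c; split; last by rewrite -c3 shm_id comp1m.
  by apply: (five_lemma D D' (And3 c1 c2 c3)); exact: is_iso_id.
by rewrite c2 compm1.
Qed.

Lemma TR4_from_octahedron : TR4 T.
Proof.
move=> X Y Z X' Y' Z' u v j k l m p q Du Dv Dvu.
have [Z0 [j0 [k0 [X0 [l0 [m0 [Y0 [p0 [q0 [f [g [[Du0 Dv0 Dvu0 Dfg] [e1 e2 e3 e4]]]]]]]]]]]]] :=
  octahedron u v.
have [a [Ia aj ka]] := cone_compare Du Du0.
have [b [[b' [b'b bb']] bl mb]] := cone_compare Dv Dv0.
have [c [[c' [c'c cc']] cp qc]] := cone_compare Dvu Dvu0.
have [a' [a'a aa']] := Ia; have [Hiso _ _] := HTR1.
exists (comp c' (comp f a)), (comp b' (comp g c)); split.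
  apply: (Hiso _ _ _ _ _ _ _ _ _ _ _ _ a' c' b' Dfg) => //.
  - split.
    + by rewrite -!compA aa' compm1.
    + by rewrite -!compA cc' compm1.
    + by rewrite compA -shm_comp -aj compA a'a comp1m -mb -!compA bb' compm1.
  - by exists a.
  - by exists c.
  - by exists b.
split.
- by rewrite -!compA aj e1 -cp compA compA c'c comp1m.
- by rewrite -qc -!compA (compA c) cc' comp1m compA e2.
- by rewrite -!compA cp e3 -bl compA b'b comp1m.
- by rewrite -mb -!compA (compA b) bb' comp1m compA e4 -compA qc.
Qed.

End FormalTriangulated.

(** * Cones in the homotopy category *)

Lemma addNKB (V : zmodType) (a b c : V) : - a - b + (a - c) = - b - c.
Proof. by rewrite addrAC addrA addNr add0r addrC. Qed.

Section HomotopyCalculus.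
Variable R : pzRingType.
Implicit Types X Y Z : cplx R.

Lemma cmap_intro X Y (f : forall n, {linear X n -> Y n}) :
  (forall i x, f (i - 1) (cd X i (i - 1) x) = cd Y i (i - 1) (f i x)) ->
  forall i j x, f j (cd X i j x) = cd Y i j (f i x).
Proof.
move=> H i j x; have [e|ij] := eqVneq i (j + 1); last by rewrite !cd_shape // linear0.
have -> : j = i - 1 by rewrite e addrK.
exact: H.
Qed.

Definition mk_cmap X Y (f : forall n, {linear X n -> Y n})
  (H : forall i x, f (i - 1) (cd X i (i - 1) x) = cd Y i (i - 1) (f i x)) : cmap X Y :=
  Cmap (cmap_intro H).

(** With [n = m - 1] the homotopy lands in degree [m] and not in [m - 1 + 1], which avoids a
    transport. *)
Lemma null_homotopicI X Y (f : cmap X Y) (h : forall i j, {linear X i -> Y j}) :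
  (forall m x, f (m - 1) x = cd Y m (m - 1) (h (m - 1) m x) +
    h (m - 1 - 1) (m - 1) (cd X (m - 1) (m - 1 - 1) x)) -> null_homotopic f.
Proof.
move=> H; exists h => n.
suff E m : n = m - 1 -> forall x : X n, f n x = cd Y m n (h n m x) + h (n - 1) n (cd X n (n - 1) x).
  by apply: E; rewrite addrK.
by move=> ->; exact: H.
Qed.

Lemma null_homotopicE X Y (f : cmap X Y) : null_homotopic f ->
  exists h : forall i j, {linear X i -> Y j}, forall m n k, n = m - 1 -> k = n - 1 ->
  forall x, f n x = cd Y m n (h n m x) + h k n (cd X n k x).
Proof.
move=> [h H]; exists h => m n k nm -> x.
have -> : m = n + 1 by rewrite nm subrK.
exact: H.
Qed.

Notation homc X Y := (@hom (catK R) X Y).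

Lemma homKP X Y (a : homc X Y) : exists f : cmap X Y, a = homK_pi f.
Proof. by exists (homK_repr a); rewrite homK_reprK. Qed.

Lemma compKE X Y Z (g : cmap Y Z) (f : cmap X Y) :
  comp (homK_pi g : homc Y Z) (homK_pi f : homc X Y) = homK_pi (cmap_comp g f).
Proof. exact: compK_pi. Qed.

Lemma homK_ext X Y (f g : cmap X Y) : (forall n x, f n x = g n x) -> homK_pi f = homK_pi g.
Proof. by move=> fg; congr homK_pi; exact: cmap_ext. Qed.

Lemma homK_pi0 X Y : homK_pi (0 : cmap X Y) = 0.
Proof. by apply: (addIr (homK_pi (0 : cmap X Y))); rewrite -homK_piD !add0r. Qed.

Lemma homK_piN X Y (f : cmap X Y) : homK_pi (- f) = - homK_pi f.
Proof. by apply/eqP; rewrite -addr_eq0 -homK_piD addNr homK_pi0. Qed.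

Lemma homK_null X Y (f : cmap X Y) : homK_pi f = 0 <-> null_homotopic f.
Proof. by rewrite -homK_pi0 homK_pi_eq subr0. Qed.

Lemma homK_eqI X Y (f g : cmap X Y) (h : forall i j, {linear X i -> Y j}) :
  (forall m x, f (m - 1) x - g (m - 1) x = cd Y m (m - 1) (h (m - 1) m x) +
    h (m - 1 - 1) (m - 1) (cd X (m - 1) (m - 1 - 1) x)) -> homK_pi f = homK_pi g.
Proof. by move=> H; apply/homK_pi_eq; exact: (@null_homotopicI _ _ (f - g) h H). Qed.

Lemma cid_trans X i j k (x : X i) : i = j -> cid_fun k (cid_fun j x) = cid_fun k x.
Proof. by move=> e; case: j / e; rewrite cid_refl. Qed.

Lemma cd_cid X i i' j j' (x : X i) : i = i' -> j = j' ->
  cd X i' j' (cid_fun i' x) = cid_fun j' (cd X i j x).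
Proof. by move=> e e'; case: i' / e; case: j' / e'; rewrite !cid_refl. Qed.

Definition cidl X i j : {linear X i -> X j} := @cid_fun R X i j.

Lemma cplx_isoI X Y (f : cmap X Y) : (forall n, injective (f n)) ->
  (forall n, surjective_map (f n)) -> @is_iso (catK R) X Y (homK_pi f).
Proof.
move=> finj fsurj.
pose g n := projT1 (cid (linear_inverse (finj n) (fsurj n))).
have gP n : cancel (f n) (g n) /\ cancel (g n) (f n).
  exact: (projT2 (cid (linear_inverse (finj n) (fsurj n)))).
have H i x : g (i - 1) (cd Y i (i - 1) x) = cd X i (i - 1) (g i x).
  by apply: (finj (i - 1)); rewrite (gP _).2 cmapP (gP _).2.
exists (homK_pi (mk_cmap H)); rewrite !compKE; split; apply: homK_ext => n x /=.
  by rewrite (gP n).1.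
by rewrite (gP n).2.
Qed.

Section Shift.
Variables X Y : cplx R.

Lemma shift_null (f : cmap X Y) : null_homotopic f -> null_homotopic (shift_map f).
Proof.
move=> /null_homotopicE[h H].
apply: (@null_homotopicI (shift X) (shift Y) (shift_map f)
  (fun i j => \- h (i - 1) (j - 1) : {linear shift X i -> shift Y j})) => m x.
rewrite [LHS](H (m - 1) (m - 1 - 1) (m - 1 - 1 - 1) erefl erefl x).
by rewrite /= !linearN !opprK.
Qed.

Lemma shiftK_pi (f : cmap X Y) : shiftK (homK_pi f) = homK_pi (shift_map f).
Proof.
apply/homK_pi_eq.
have -> : shift_map (homK_repr (homK_pi f)) - shift_map f = shift_map (homK_repr (homK_pi f) - f).
  exact: cmap_ext.
by apply: shift_null; apply/homK_pi_eq; rewrite homK_reprK.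
Qed.

Definition unshift_fun (g : cmap (shift X) (shift Y)) n : {linear X n -> Y n} :=
  cidl Y (n + 1 - 1) n \o g (n + 1) \o cidl X n (n + 1 - 1).

Lemma unshift_funE (g : cmap (shift X) (shift Y)) n m x : n = m - 1 ->
  unshift_fun g n x = cidl Y (m - 1) n (g m (cidl X n (m - 1) x)).
Proof. by move=> e; have -> : m = n + 1 by rewrite e subrK. Qed.

Lemma unshift_mapP (g : cmap (shift X) (shift Y)) i x :
  unshift_fun g (i - 1) (cd X i (i - 1) x) = cd Y i (i - 1) (unshift_fun g i x).
Proof.
rewrite (unshift_funE g (m := i) _ erefl) (unshift_funE g (n := i) (m := i + 1)) ?addrK //.
rewrite /= !cid_refl.
set y := cid_fun _ x.
have E := @cmapP R _ _ g (i + 1) i y; rewrite /= in E.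
have Ey : cd X (i + 1 - 1) (i - 1) y = cd X i (i - 1) x.
  by rewrite /y (@cd_cid X i _ (i - 1)) ?addrK // cid_refl.
rewrite -Ey.
apply: oppr_inj; rewrite -linearN -[X in g i X]/(shift_d X (i + 1) i y).
rewrite [LHS]E.
congr (- _).
by rewrite (@cd_cid Y (i + 1 - 1) i (i - 1) (i - 1)) ?addrK // cid_refl.
Qed.

Lemma unshift_null (f : cmap X Y) : null_homotopic (shift_map f) -> null_homotopic f.
Proof.
move=> /null_homotopicE[h H].
(* The sign undoes that of the shifted differential. *)
pose h' i j : {linear X i -> Y j} :=
  \- (cidl Y (j + 1 - 1) j \o h (i + 1) (j + 1) \o cidl X i (i + 1 - 1)).
have h'E i j a b x : i = a - 1 -> j = b - 1 ->
    h' i j x = - cidl Y (b - 1) j (h a b (cidl X i (a - 1) x)).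
  move=> ia jb; have -> : a = i + 1 by rewrite ia subrK.
  by have -> : b = j + 1 by rewrite jb subrK.
apply: (@null_homotopicI X Y f h') => m x.
rewrite (h'E (m - 1) m m (m + 1)) ?addrK //.
rewrite (h'E (m - 1 - 1) (m - 1) (m - 1) m) //= !cid_refl linearN.
rewrite (@cd_cid Y (m + 1 - 1) m (m - 1) (m - 1)) ?addrK // cid_refl.
have -> := H (m + 1) m (m - 1) _ _ x; rewrite ?addrK //.
by rewrite /= linearN.
Qed.

Lemma shiftK_bij : bijective (@shiftK R X Y).
Proof.
have inj : injective (@shiftK R X Y).
  move=> a b; have [f ->] := homKP a; have [g ->] := homKP b.
  rewrite !shiftK_pi => /homK_pi_eq fg; apply/homK_pi_eq/unshift_null.
  by rewrite (_ : shift_map (f - g) = shift_map f - shift_map g) //; exact: cmap_ext.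
have surj b : exists a, shiftK a = b :> homK (shift X) (shift Y).
  have [g ->] := homKP b; exists (homK_pi (mk_cmap (unshift_mapP g))).
  rewrite shiftK_pi; apply: homK_ext => n x.
  by rewrite -[LHS]/(unshift_fun g (n - 1) x) (unshift_funE _ (m := n)) //= !cid_refl.
exists (fun b => projT1 (cid (surj b))) => [a|b]; last exact: (projT2 (cid (surj b))).
exact/inj/(projT2 (cid (surj (shiftK a)))).
Qed.

End Shift.

Lemma shiftK_id X : shiftK (homK_pi (cmap_id X)) = homK_pi (cmap_id (shift X)).
Proof. by rewrite shiftK_pi; exact: homK_ext. Qed.

Lemma shiftK_comp X Y Z (b : homc Y Z) (a : homc X Y) :
  shiftK (comp b a) = comp (shiftK b : homc (shift Y) (shift Z)) (shiftK a : homc (shift X) (shift Y)).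
Proof.
have [f ->] := homKP a; have [g ->] := homKP b.
by rewrite compKE !shiftK_pi compKE; exact: homK_ext.
Qed.

Lemma shiftKD X Y (a b : homK X Y) : shiftK (a + b) = shiftK a + shiftK b.
Proof.
have [f ->] := homKP a; have [g ->] := homKP b.
by rewrite -homK_piD !shiftK_pi -homK_piD; exact: homK_ext.
Qed.

Lemma shiftK_iso X Y (a : homc X Y) : is_iso a ->
  is_iso (shiftK a : homc (shift X) (shift Y)).
Proof.
move=> [b [ba ab]]; exists (shiftK b).
by rewrite -!shiftK_comp ba ab !shiftK_id.
Qed.

Section Unshift.
Variable Y : cplx R.

Definition unshift_d (i j : int) : {linear Y (i + 1) -> Y (j + 1)} :=
  \- cd Y (i + 1) (j + 1).

Lemma unshift_shape (i j : int) : i != j + 1 -> forall x, unshift_d i j x = 0.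
Proof.
move=> ij x; rewrite /= cd_shape ?oppr0 //.
by apply: contra ij => /eqP/addIr ->.
Qed.

Lemma unshift_dd i j k x : unshift_d j k (unshift_d i j x) = 0.
Proof. by rewrite /= linearN cdd !oppr0. Qed.

Definition unshift : cplx R :=
  @Cplx R (fun n => Y (n + 1)) unshift_d unshift_shape unshift_dd.

Lemma shift_unshift : @isomorphic (catK R) (shift unshift) Y.
Proof.
have H i x : cidl Y (i - 1 - 1 + 1) (i - 1) (cd (shift unshift) i (i - 1) x) =
    cd Y i (i - 1) (cidl Y (i - 1 + 1) i x).
  by rewrite /= !opprK (@cd_cid Y (i - 1 + 1) i (i - 1 - 1 + 1)) ?subrK.
exists (homK_pi (@mk_cmap (shift unshift) Y (fun n => cidl Y (n - 1 + 1) n) H)).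
apply: cplx_isoI => n.
  by apply: (can_inj (g := cid_fun (n - 1 + 1))) => x; rewrite /= cid_trans ?cid_refl ?subrK.
by move=> y; exists (cid_fun (n - 1 + 1) y); rewrite /= cid_trans ?cid_refl ?subrK.
Qed.
End Unshift.

Section ConeFacts.
Variables (X Y : cplx R) (f : cmap X Y).

Lemma cone_dE i (x : X (i - 1)) (y : Y i) : cd (cone f) i (i - 1) (x, y) =
  (- cd X (i - 1) (i - 1 - 1) x, f (i - 1) x + cd Y i (i - 1) y).
Proof. by rewrite /= /cone_d_fun /= cid_refl. Qed.

End ConeFacts.

(** The square commutes only up to a homotopy [s], which must be added to the second component for
    the differentials to match. *)
Lemma cone_map X Y X' Y' (f : cmap X Y) (f' : cmap X' Y') (a : cmap X X') (b : cmap Y Y') :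
  null_homotopic (cmap_comp b f - cmap_comp f' a) ->
  exists c : cmap (cone f) (cone f'),
    cmap_comp c (cone_in f) = cmap_comp (cone_in f') b /\
    cmap_comp (cone_out f') c = cmap_comp (shift_map a) (cone_out f).
Proof.
move=> /null_homotopicE[s H].
pose c n (z : cone f n) : cone f' n := (a (n - 1) z.1, b n z.2 + s (n - 1) n z.1).
have cL n : linear (@c n).
  by move=> r [x y] [x' y']; congr (_, _); rewrite /= !linearP // scalerDr addrACA.
have cP i (z : cone f i) : lin_of (@cL (i - 1)) (cd (cone f) i (i - 1) z) =
    cd (cone f') i (i - 1) (lin_of (@cL i) z).
  case: z => x y; rewrite cone_dE cone_dE /c /=; congr (_, _); first by rewrite linearN cmapP.
  rewrite !linearD !linearN !cmapP /=.
  have := H i (i - 1) (i - 1 - 1) erefl erefl x.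
  rewrite -[LHS]/(b (i - 1) (f (i - 1) x) - f' (i - 1) (a (i - 1) x)).
  move=> /eqP; rewrite subr_eq => /eqP ->.
  rewrite (addrC (cd Y' _ _ _)) -!addrA [LHS]addrC !addrA subrK.
  by rewrite -addrA addrC -addrA.
exists (mk_cmap cP); split; apply: cmap_ext => n x //=.
by rewrite /c /cone_in_fun /= !linear0 addr0.
Qed.

Lemma cone_id_null X : null_homotopic (cmap_id (cone (cmap_id X))).
Proof.
pose C := cone (cmap_id X).
(* The contraction moves the second coordinate back along the identity component of the
   differential. *)
pose h i j (z : C i) : C j := (cid_fun (j - 1) z.2, 0).
have hL i j : linear (@h i j).
  by move=> r z z'; congr (_, _); rewrite /= ?linearP // scaler0 addr0.
apply: (@null_homotopicI C C _ (fun i j => lin_of (@hL i j))) => m [x y].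
transitivity (((- cd X (m - 1) (m - 1 - 1) y, y) : C (m - 1)) + (x + cd X (m - 1) (m - 1 - 1) y, 0)).
  by congr (_, _); rewrite /= ?addr0 // [RHS]addrC addrK.
congr (_ + _); last by rewrite cone_dE; congr (_, _); rewrite /= !cid_refl.
by rewrite [RHS]cone_dE /= cid_refl linear0 addr0.
Qed.

(** * Rotation of a standard triangle *)

Section Rotation.
Variables (X Y : cplx R) (f : cmap X Y).
Let C := cone (cone_in f).

Definition rot_out_fun n (z : C n) : shift X n := z.2.1.
Lemma rot_out_linear n : linear (@rot_out_fun n). Proof. by []. Qed.
Lemma rot_outP i (z : C i) : lin_of (@rot_out_linear (i - 1)) (cd C i (i - 1) z) =
  cd (shift X) i (i - 1) (lin_of (@rot_out_linear i) z).
Proof. by case: z => y' [x y]; rewrite cone_dE /rot_out_fun cone_dE /= add0r. Qed.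
Definition rot_out : cmap C (shift X) := mk_cmap rot_outP.

(** Compatibility with the differential forces the component [- f], which is the source of the minus
    sign in TR2. *)
Definition rot_in_fun n (x : shift X n) : C n := (- f (n - 1) x, (x, 0)).
Lemma rot_in_linear n : linear (@rot_in_fun n).
Proof.
move=> r x y; congr (_, (_, _)); rewrite /= ?scaler0 ?addr0 //.
by rewrite linearP opprD -scalerN.
Qed.
Lemma rot_inP i (x : shift X i) : lin_of (@rot_in_linear (i - 1)) (cd (shift X) i (i - 1) x) =
  cd C i (i - 1) (lin_of (@rot_in_linear i) x).
Proof.
rewrite cone_dE cone_dE /= /rot_in_fun /cone_in_fun !linear0 addr0.
congr (_, (_, _)); rewrite /= ?add0r ?addNr //.
by rewrite !linearN cmapP.
Qed.
Definition rot_in : cmap (shift X) C := mk_cmap rot_inP.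

Lemma rot_out_in : cmap_comp rot_out rot_in = cmap_id (shift X).
Proof. exact: cmap_ext. Qed.

Lemma rot_in_out : homK_pi (cmap_comp rot_in rot_out) = homK_pi (cmap_id C).
Proof.
(* The outer differential sends [y'] to the place of [y] by the identity; moving [y] back cancels
   the two copies of [Y]. *)
pose h i j (z : C i) : C j := (- cid_fun (j - 1) z.2.2, 0).
have hL i j : linear (@h i j).
  by move=> r z z'; congr (_, _); rewrite /= ?scaler0 ?addr0 // linearP opprD scalerN.
apply: (@homK_eqI C C _ _ (fun i j => lin_of (@hL i j))) => m [y' [x y]].
transitivity (((cd Y (m - 1) (m - 1 - 1) y, (0, - y)) : C (m - 1)) +
    (- (y' + (f (m - 1 - 1) x + cd Y (m - 1) (m - 1 - 1) y)), 0)).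
  rewrite /= /rot_in_fun /rot_out_fun /=; congr (_, (_, _)); rewrite /= ?subrr ?addr0 ?add0r //.
  by rewrite [in RHS]addrA opprD [RHS]addrC subrK opprD [RHS]addrC.
congr (_ + _); last by rewrite cone_dE; congr (_, _); rewrite /= !cid_refl.
rewrite [RHS]cone_dE /= linearN opprK cid_refl linear0 addr0.
by congr (_, (_, _)); rewrite /= ?linearN.
Qed.

Lemma rot_out_iso : @is_iso (catK R) C (shift X) (homK_pi rot_out).
Proof.
by exists (homK_pi rot_in); rewrite !compKE rot_out_in; split; [exact: rot_in_out|].
Qed.

Lemma rot_cone_out : homK_pi (cone_out (cone_in f)) =
  comp (- homK_pi (shift_map f) : homc (shift X) (shift Y)) (homK_pi rot_out : homc C (shift X)).
Proof.
have E : cmap_comp (cone_out (cone_in f)) rot_in = - shift_map f by exact: cmap_ext.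
have rio : comp (homK_pi rot_in : homc (shift X) C) (homK_pi rot_out : homc C (shift X)) = idm (C : catK R).
  by rewrite compKE rot_in_out.
by rewrite -[LHS](@compm1 (catK R)) -rio compA (compKE (cone_out (cone_in f)) rot_in) E homK_piN.
Qed.

End Rotation.

(** * The octahedron on standard cones *)

Section Octahedron.
Variables (X Y Z : cplx R) (u : cmap X Y) (v : cmap Y Z).
Let vu := cmap_comp v u.

Definition octa_f_fun n (z : cone u n) : cone vu n := (z.1, v n z.2).
Lemma octa_f_linear n : linear (@octa_f_fun n).
Proof. by move=> r z z'; congr (_, _); rewrite /= linearP. Qed.
Lemma octa_fP i (z : cone u i) : lin_of (@octa_f_linear (i - 1)) (cd (cone u) i (i - 1) z) =
  cd (cone vu) i (i - 1) (lin_of (@octa_f_linear i) z).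
Proof.
case: z => x y; rewrite [RHS]cone_dE cone_dE /= /octa_f_fun /=.
by rewrite linearD cmapP.
Qed.
Definition octa_f : cmap (cone u) (cone vu) := mk_cmap octa_fP.

Definition octa_g_fun n (z : cone vu n) : cone v n := (u (n - 1) z.1, z.2).
Lemma octa_g_linear n : linear (@octa_g_fun n).
Proof. by move=> r z z'; congr (_, _); rewrite /= linearP. Qed.
Lemma octa_gP i (z : cone vu i) : lin_of (@octa_g_linear (i - 1)) (cd (cone vu) i (i - 1) z) =
  cd (cone v) i (i - 1) (lin_of (@octa_g_linear i) z).
Proof.
case: z => x y; rewrite [RHS]cone_dE cone_dE /= /octa_g_fun /=.
by rewrite linearN cmapP.
Qed.
Definition octa_g : cmap (cone vu) (cone v) := mk_cmap octa_gP.

Let F := cone octa_f.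

(** Its kernel consists of the elements [((x', - u x), (x, 0))], two copies of [X] that cancel; the
    homotopy in [octa_in_out] moves [x] to the place of [x']. *)
Definition octa_out_fun n (z : F n) : cone v n := (z.1.2 + u (n - 1) z.2.1, z.2.2).
Lemma octa_out_linear n : linear (@octa_out_fun n).
Proof. by move=> r z z'; congr (_, _); rewrite /= linearP scalerDr addrACA. Qed.
Lemma octa_outP i (z : F i) : lin_of (@octa_out_linear (i - 1)) (cd F i (i - 1) z) =
  cd (cone v) i (i - 1) (lin_of (@octa_out_linear i) z).
Proof.
case: z => [[x' y] [x z]]; rewrite cone_dE [RHS]cone_dE /= /octa_out_fun.
rewrite cone_dE cone_dE /= /octa_f_fun /=; congr (_, _).
  rewrite (linearB (u _)) /= cmapP (linearD (cd Y _ _)) !opprD.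
  exact: addNKB.
by rewrite linearD addrA.
Qed.
Definition octa_out : cmap F (cone v) := mk_cmap octa_outP.

Definition octa_in_fun n (z : cone v n) : F n := ((0, z.1), (0, z.2)).
Lemma octa_in_linear n : linear (@octa_in_fun n).
Proof. by move=> r z z'; congr ((_, _), (_, _)); rewrite /= scaler0 addr0. Qed.
Lemma octa_inP i (z : cone v i) : lin_of (@octa_in_linear (i - 1)) (cd (cone v) i (i - 1) z) =
  cd F i (i - 1) (lin_of (@octa_in_linear i) z).
Proof.
case: z => y z; rewrite [RHS]cone_dE cone_dE /= /octa_in_fun /= cone_dE cone_dE /octa_f_fun /=.
by congr ((_, _), (_, _)); rewrite /= !linear0 ?oppr0 ?add0r ?addr0.
Qed.
Definition octa_in : cmap (cone v) F := mk_cmap octa_inP.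

Lemma octa_out_in : cmap_comp octa_out octa_in = cmap_id (cone v).
Proof.
by apply: cmap_ext => n [y z]; congr (_, _); rewrite /= linear0 addr0.
Qed.

Lemma octa_in_out : homK_pi (cmap_id F) = homK_pi (cmap_comp octa_in octa_out).
Proof.
pose h i j (z : F i) : F j := ((cid_fun (j - 1 - 1) z.2.1, 0), 0).
have hL i j : linear (@h i j).
  by move=> r z z'; congr ((_, _), _); rewrite /= ?scaler0 ?addr0 // linearP.
apply: (@homK_eqI F F _ _ (fun i j => lin_of (@hL i j))) => m [[x' y] [x z]].
transitivity ((((cd X (m - 1 - 1) (m - 1 - 1 - 1) x, - u (m - 1 - 1) x), (x, 0)) : F (m - 1)) +
    ((x' - cd X (m - 1 - 1) (m - 1 - 1 - 1) x, 0), 0)).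
  rewrite /= /octa_in_fun /octa_out_fun /=.
  congr ((_, _), (_, _)); rewrite /= ?subr0 ?addr0 ?subrr //.
    by rewrite [RHS]addrC subrK.
  by rewrite opprD addrA subrr add0r.
congr (_ + _); last by rewrite cone_dE; congr ((_, _), _); rewrite /= !cid_refl.
rewrite [RHS]cone_dE /= cid_refl cone_dE cone_dE /octa_f_fun /=.
by congr ((_, _), (_, _)); rewrite /= ?linear0 ?opprK ?addr0.
Qed.

Lemma octa_out_iso : @is_iso (catK R) F (cone v) (homK_pi octa_out).
Proof.
by exists (homK_pi octa_in); rewrite !compKE octa_out_in -octa_in_out.
Qed.

Lemma octa_cone_out : homK_pi (cone_out octa_f) =
  comp (homK_pi (cmap_comp (shift_map (cone_in u)) (cone_out v)) : homc (cone v) (shift (cone u)))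
    (homK_pi octa_out : homc F (cone v)).
Proof.
have E : cmap_comp (cone_out octa_f) octa_in = cmap_comp (shift_map (cone_in u)) (cone_out v).
  exact: cmap_ext.
have rio : comp (homK_pi octa_in : homc (cone v) F) (homK_pi octa_out : homc F (cone v)) = idm (F : catK R).
  by rewrite compKE -octa_in_out.
by rewrite -[LHS](@compm1 (catK R)) -rio compA (compKE (cone_out octa_f) octa_in) E.
Qed.

End Octahedron.

End HomotopyCalculus.

(** * The triangulated axioms for [K(R)] and its full subcategories *)

Section TriangulatedK.
Variable R : pzRingType.
Notation K := (triK R).
Notation homc X Y := (@hom (triK R) X Y).
Notation shK a := (@shm (triK R) _ _ a).

Lemma triK_shm_id (X : K) : shm (idm X) = idm (sh X).
Proof. exact: shiftK_id. Qed.
Lemma triK_shm_comp (X Y Z : K) (g : hom Y Z) (f : hom X Y) :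
  shm (comp g f) = comp (shm g) (shm f).
Proof. exact: shiftK_comp. Qed.

Lemma dist_cone (X Y : cplx R) (f : cmap X Y) :
  @dist K X Y (cone f) (homK_pi f) (homK_pi (cone_in f)) (homK_pi (cone_out f)).
Proof.
exists X, Y, f, (idm (X : K)), (idm (Y : K)), (idm (cone f : K)).
split; first by split; exact: is_iso_id.
by split; rewrite ?shiftK_id ?comp1m ?compm1 // (@comp1m K).
Qed.

Lemma dist_iso (X Y Z X' Y' Z' : K) (u : hom X Y) (v : hom Y Z) (w : hom Z (sh X))
    (u' : hom X' Y') (v' : hom Y' Z') (w' : hom Z' (sh X'))
    (a : hom X X') (b : hom Y Y') (c : hom Z Z') :
  dist u v w -> tri_morphism u v w u' v' w' a b c ->
  is_iso a -> is_iso b -> is_iso c -> dist u' v' w'.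
Proof.
move=> [X0 [Y0 [f [a0 [b0 [c0 [[Ia Ib Ic] [e1 e2 e3]]]]]]]] [m1 m2 m3] Ha Hb Hc.
exists X0, Y0, f, (comp a a0), (comp b b0), (comp c c0); split.
  by split; exact: is_iso_comp.
split.
- by rewrite -compA e1 compA m1 -compA.
- by rewrite -compA e2 compA m2 -compA.
- have -> : shiftK (comp a a0) = comp (shm a) (shK a0) by exact: triK_shm_comp.
  by rewrite -compA; rewrite [X in comp _ X](e3) compA m3 -compA.
Qed.

Lemma dist_id (X Z : K) : idm Z = 0 -> dist (idm X) (0 : hom X Z) (0 : hom Z (sh X)).
Proof.
move=> Z0; have cid0 : idm (cone (cmap_id X) : K) = 0.
  exact/homK_null/cone_id_null.
exists X, X, (cmap_id X), (idm X), (idm X), 0; split.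
  split; [exact: is_iso_id | exact: is_iso_id | exists 0].
  by rewrite !comp0m Z0 cid0.
split; first by [].
  by rewrite !comp0m.
by rewrite -[LHS]compm1 [X in comp _ X]cid0 !(compm0, comp0m).
Qed.

Lemma dist_rotate (X Y Z : K) (u : hom X Y) (v : hom Y Z) (w : hom Z (sh X)) :
  dist u v w -> dist v w (- shm u).
Proof.
move=> [X0 [Y0 [f [a [b [c [[Ia Ib Ic] [e1 e2 e3]]]]]]]].
exists Y0, (cone f), (cone_in f), b, c, (comp (shK a) (homK_pi (rot_out f) : homc (cone (cone_in f)) (shift X0))).
split; first split => //.
  apply: is_iso_comp; last exact: rot_out_iso.
  exact: shiftK_iso.
split => //.
- rewrite -compA -e3; congr (comp _ _).
  by rewrite (@compKE R); exact: homK_ext.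
- rewrite rot_cone_out compA [RHS]compA; congr (comp _ _).
  rewrite compmN compNm -triK_shm_comp -e1 triK_shm_comp; congr (- comp _ _).
  by rewrite -shiftK_pi.
Qed.

(** Carried over to the standard triangles, the square commutes up to homotopy for representing
    chain maps, and [cone_map] fills it. *)
Lemma dist_morphism (X Y Z X' Y' Z' : K)
    (u : hom X Y) (v : hom Y Z) (w : hom Z (sh X))
    (u' : hom X' Y') (v' : hom Y' Z') (w' : hom Z' (sh X'))
    (a : hom X X') (b : hom Y Y') :
  dist u v w -> dist u' v' w' -> comp b u = comp u' a ->
  exists c : hom Z Z', tri_morphism u v w u' v' w' a b c.
Proof.
move=> [X0 [Y0 [f [a0 [b0 [c0 [[[a0' [aa aa']] [b0' [bb bb']] [c0' [cc cc']]] [e1 e2 e3]]]]]]]].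
move=> [X1 [Y1 [g [a1 [b1 [c1 [[[a1' [aa1 aa1']] [b1' [bb1 bb1']] _] [h1 h2 h3]]]]]]]] ba.
have [s sE] := homKP (comp a1' (comp a a0) : homc X0 X1).
have [t tE] := homKP (comp b1' (comp b b0) : homc Y0 Y1).
have [|k [kin kout]] := @cone_map R X0 Y0 X1 Y1 f g s t.
  apply/homK_pi_eq; rewrite -!(@compKE R) -sE -tE.
  rewrite -!compA e1 (compA b) ba (compA (homK_pi g : homc X1 Y1)).
  suff -> : comp (homK_pi g : homc X1 Y1) a1' = comp b1' u' by rewrite -!compA.
  by rewrite -[LHS](@comp1m K) -bb1 -compA (compA b1) h1 -compA aa1' compm1.
pose k' : homc (cone f) (cone g) := homK_pi k.
have k'in : comp k' (homK_pi (cone_in f) : homc Y0 (cone f)) =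
    comp (homK_pi (cone_in g) : homc Y1 (cone g)) (homK_pi t : homc Y0 Y1).
  by rewrite !(@compKE R) kin.
have k'out : comp (homK_pi (cone_out g) : homc (cone g) (shift X1)) k' =
    comp (shiftK (homK_pi s) : homc (shift X0) (shift X1)) (homK_pi (cone_out f) : homc (cone f) (shift X0)).
  by rewrite shiftK_pi !(@compKE R) kout.
exists (comp c1 (comp k' c0')); split=> //.
- have vE : comp c0' v = comp (homK_pi (cone_in f) : homc Y0 (cone f)) b0'.
    by rewrite -[v]compm1 -bb' (compA v) -e2 !compA cc comp1m.
  rewrite -!compA vE (compA k') k'in -tE -!compA bb' compm1 (compA c1) h2.
  by rewrite -!compA (compA b1) bb1' comp1m.
- have wE : comp (homK_pi (cone_out f) : homc (cone f) (shift X0)) c0' = comp (shK a0') w.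
    rewrite -[LHS](@comp1m K) -[idm _]triK_shm_id -aa triK_shm_comp -!compA.
    by rewrite (compA (shK a0)) [X in comp _ (comp X _)]e3 -!compA cc' compm1.
  rewrite !compA -h3 -(compA (shK a1)) -(compA (shK a1)) k'out.
  rewrite -!compA wE -sE.
  have -> : shiftK (comp a1' (comp a a0)) = comp (shK a1') (comp (shm a) (shK a0)).
    by rewrite -!triK_shm_comp.
  rewrite -!compA (compA (shK a1)) -triK_shm_comp aa1' triK_shm_id comp1m.
  rewrite (compA (shK a0)) -triK_shm_comp.
  by rewrite aa' triK_shm_id comp1m.
Qed.

Section FullSubcategory.
Variable P : K -> Prop.
Hypothesis P_cone : forall (X Y : cplx R) (f : cmap X Y), P X -> P Y -> P (cone f).
Hypothesis P_unshift : forall Y : cplx R, P Y -> P (unshift Y).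
Variable P_sh : forall X : K, P X -> P (sh X).
Notation F := (full_tridata P_sh).
Hypothesis F_coproducts : has_coproducts F.

Lemma full_shift_autoequivalence : shift_autoequivalence F.
Proof.
split.
- by move=> [X PX]; exact: triK_shm_id.
- by move=> [X PX] [Y PY] [Z PZ]; exact: triK_shm_comp.
- by move=> [X PX] [Y PY]; exact: shiftKD.
- by move=> [X PX] [Y PY]; exact: shiftK_bij.
- move=> [Y PY]; exists (exist _ (unshift Y) (P_unshift PY)).
  exact: shift_unshift.
Qed.

Lemma full_TR1 : TR1 F.
Proof.
split.
- move=> [X PX] [Y PY] [Z PZ] [X' PX'] [Y' PY'] [Z' PZ'] u v w u' v' w' a b c.
  exact: dist_iso.
- move=> [X PX] [Z PZ] Z0; apply: dist_id.
  exact: (Z0 (exist _ Z PZ)).1.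
- move=> [X PX] [Y PY] u; have [f uE] := @homKP R X Y u.
  exists (exist _ (cone f) (P_cone f PX PY)), (homK_pi (cone_in f)), (homK_pi (cone_out f)).
  by rewrite uE; exact: dist_cone.
Qed.

Lemma full_octahedron (X Y Z : F) (u : hom X Y) (v : hom Y Z) :
  exists (Z' : F) (j : hom Y Z') (k : hom Z' (sh X))
    (X' : F) (l : hom Z X') (m : hom X' (sh Y))
    (Y' : F) (p : hom Z Y') (q : hom Y' (sh X)) (f : hom Z' Y') (g : hom Y' X'),
    [/\ dist u j k, dist v l m, dist (comp v u) p q & dist f g (comp (shm j) m)] /\
    [/\ comp f j = comp p v, comp q f = k, comp g p = l & comp m g = comp (shm u) q].
Proof.
case: X Y Z u v => [X PX] [Y PY] [Z PZ] u v.
have [u0 ->] := @homKP R X Y u; have [v0 ->] := @homKP R Y Z v.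
exists (exist _ (cone u0) (P_cone u0 PX PY)), (homK_pi (cone_in u0)), (homK_pi (cone_out u0)).
exists (exist _ (cone v0) (P_cone v0 PY PZ)), (homK_pi (cone_in v0)), (homK_pi (cone_out v0)).
exists (exist _ (cone (cmap_comp v0 u0)) (P_cone (cmap_comp v0 u0) PX PZ)).
exists (homK_pi (cone_in (cmap_comp v0 u0))), (homK_pi (cone_out (cmap_comp v0 u0))).
exists (homK_pi (octa_f u0 v0)), (homK_pi (octa_g u0 v0)).
split.
  split; [exact: dist_cone | exact: dist_cone | |].
    by rewrite /= [compK _ _](@compKE R); exact: dist_cone.
  apply: (dist_iso (a := idm (cone u0 : K)) (b := idm (cone (cmap_comp v0 u0) : K))
    (c := homK_pi (octa_out u0 v0) : homc _ (cone v0)) (dist_cone (octa_f u0 v0))).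
  - split; first by rewrite compm1 comp1m.
      by rewrite compm1 (@compKE R); apply: homK_ext => n [x z];
        congr (_, _); rewrite /= add0r.
    rewrite triK_shm_id comp1m octa_cone_out; congr (comp _ _).
    by rewrite /= shiftK_pi [compK _ _](@compKE R).
  - exact: is_iso_id.
  - exact: is_iso_id.
  - exact: octa_out_iso.
split; rewrite /= ?shiftK_pi ![compK _ _](@compKE R); apply: homK_ext => n.
- by move=> y; congr (_, _).
- by case=> x y.
- by move=> y; congr (_, _); rewrite /= linear0.
- by case=> x z.
Qed.

Lemma full_triangulated : triangulated F.
Proof.
have Fadd := coproducts_additive F_coproducts.
have SH := full_shift_autoequivalence; have T1 := full_TR1.
have T2 (X Y Z : F) (u : hom X Y) (v : hom Y Z) (w : hom Z (sh X)) :
    dist u v w -> dist v w (- shm u) by exact: dist_rotate.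
have T3 : TR3 F by move=> X Y Z X' Y' Z' u v w u' v' w' a b; exact: dist_morphism.
split=> //; split=> //.
- exact: TR2_from_rotation Fadd.1 SH T1 T2 T3.
- exact: TR4_from_octahedron Fadd.1 SH T1 T2 T3 full_octahedron.
Qed.

End FullSubcategory.
End TriangulatedK.

(** * Direct sums of complexes *)

Section DirectSumMap.
Variables (R : pzRingType) (I : choiceType) (M N : I -> lmodType R).
Variable f : forall k, {linear M k -> N k}.

Definition dsum_map : {linear dsum M -> dsum N} :=
  dsum_out (fun k => dsum_inj N k \o f k : {linear M k -> dsum N}).

Lemma dsum_map_inj k x : dsum_map (dsum_inj M k x) = dsum_inj N k (f k x).
Proof. exact: dsum_outK. Qed.

Lemma dsum_mapE k x : dsum_val (dsum_map x) k = f k (dsum_val x k).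
Proof.
apply: (@dsum_hom_ext R I M (N k) (dsum_proj N k \o dsum_map : {linear dsum M -> N k})
  (f k \o dsum_proj M k : {linear dsum M -> N k})) => i y.
rewrite -[LHS]/(dsum_val (dsum_map (dsum_inj M i y)) k) dsum_map_inj.
rewrite -[RHS]/(f k (dsum_val (dsum_inj M i y) k)) !dsum_injE.
have [e|ik] := eqVneq i k; first by case: k / e; rewrite !dsum_inj_refl.
by rewrite !dsum_inj_neq // linear0.
Qed.
End DirectSumMap.

Section Coproducts.
Variables (R : pzRingType) (I : choiceType) (X : I -> cplx R).

Definition dsumC_d (i j : int) :
    {linear dsum (fun k => X k i) -> dsum (fun k => X k j)} :=
  dsum_map (fun k => cd (X k) i j).

Lemma dsumC_shape (i j : int) : i != j + 1 -> forall x, dsumC_d i j x = 0.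
Proof. by move=> ij x; apply: dsum_ext => k; rewrite dsum_mapE cd_shape. Qed.

Lemma dsumC_dd i j k x : dsumC_d j k (dsumC_d i j x) = 0.
Proof. by apply: dsum_ext => l; rewrite !dsum_mapE cdd. Qed.

Definition dsumC : cplx R :=
  @Cplx R (fun n => dsum (fun k => X k n)) dsumC_d dsumC_shape dsumC_dd.

Definition dsumC_inj k : cmap (X k) dsumC :=
  @Cmap R (X k) dsumC (fun n => dsum_inj (fun k => X k n) k)
    (fun i j x => esym (dsum_map_inj (fun k => cd (X k) i j) x)).

Definition dsumC_proj k : cmap dsumC (X k) :=
  @Cmap R dsumC (X k) (fun n => dsum_proj (fun k => X k n) k)
    (fun i j x => dsum_mapE (fun k => cd (X k) i j) k x).

Lemma dsumC_outP (Y : cplx R) (f : forall k, cmap (X k) Y) i j x :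
  dsum_out (fun k => f k j) (cd dsumC i j x) = cd Y i j (dsum_out (fun k => f k i) x).
Proof.
apply: (@dsum_hom_ext R I (fun k => X k i) (Y j)
  (dsum_out (fun k => f k j) \o cd dsumC i j : {linear _ -> _})
  (cd Y i j \o dsum_out (fun k => f k i) : {linear _ -> _})) => k y.
rewrite -[LHS]/(dsum_out (fun k => f k j) (dsumC_d i j (dsum_inj _ k y))).
rewrite -[RHS]/(cd Y i j (dsum_out (fun k => f k i) (dsum_inj _ k y))).
by rewrite dsum_map_inj !dsum_outK cmapP.
Qed.

Definition dsumC_out (Y : cplx R) (f : forall k, cmap (X k) Y) : cmap dsumC Y :=
  @Cmap R dsumC Y (fun n => dsum_out (fun k => f k n)) (dsumC_outP f).

(** Homotopies chosen on the summands assemble to one on the sum; hence direct sums of complexes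
    remain coproducts after passing to homotopy classes. *)
Lemma dsumC_null (Y : cplx R) (D : cmap dsumC Y) :
  (forall k, null_homotopic (cmap_comp D (dsumC_inj k))) -> null_homotopic D.
Proof.
move=> H; pose h k := projT1 (cid (H k)).
have hP k n x : D n (dsum_inj _ k x) =
    cd Y (n + 1) n (h k n (n + 1) x) + h k (n - 1) n (cd (X k) n (n - 1) x).
  exact: (projT2 (cid (H k))).
exists (fun i j => dsum_out (fun k => h k i j)) => n.
apply: (@dsum_hom_ext R I (fun k => X k n) (Y n) (D n)
  ((cd Y (n + 1) n \o dsum_out (fun k => h k n (n + 1))) \+
   (dsum_out (fun k => h k (n - 1) n) \o cd dsumC n (n - 1)) : {linear _ -> _})) => k x.
rewrite hP.
rewrite -[RHS]/(cd Y (n + 1) n (dsum_out (fun k => h k n (n + 1)) (dsum_inj _ k x)) +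
  dsum_out (fun k => h k (n - 1) n) (dsumC_d n (n - 1) (dsum_inj _ k x))).
by rewrite dsum_map_inj !dsum_outK.
Qed.

Lemma dsumC_coproduct :
  @is_coproduct (catK R) I X dsumC (fun k => homK_pi (dsumC_inj k)).
Proof.
move=> Y f.
have G k : homK_pi (homK_repr (f k)) = f k by exact: homK_reprK.
exists (homK_pi (dsumC_out (fun k => homK_repr (f k)))); split=> [k|g gP].
  rewrite compKE -[RHS]G; apply: homK_ext => n x.
  exact: dsum_outK.
have [g0 gE] := homKP g; rewrite gE; apply/homK_pi_eq/dsumC_null => k.
have -> : cmap_comp (dsumC_out (fun k => homK_repr (f k)) - g0) (dsumC_inj k) =
    homK_repr (f k) - cmap_comp g0 (dsumC_inj k).
  apply: cmap_ext => n x; congr (_ - _); exact: dsum_outK.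
by apply/homK_pi_eq; rewrite G -(gP k) gE compKE.
Qed.

End Coproducts.

(** * Complexes of projectives up to homotopy equivalence *)

Section ProjectiveComplexes.
Variable R : pzRingType.
Notation K := (triK R).

Definition proj_cplx (X : cplx R) : Prop := forall n, projective_mod (X n).

Definition projK (X : K) : Prop := exists X' : cplx R, proj_cplx X' /\ isomorphic X (X' : K).

(** All of [K(R)], presented as a full subcategory so that the lemmas on full subcategories and the
    five lemma apply to it. *)
Let FK := @full_tridata K (fun=> True) (fun _ _ => Logic.I).

Let FK_zero : exists Z : FK, is_zero Z.
Proof.
pose X : cplx R := @Cplx R (fun=> (R^o : lmodType R)) (fun _ _ => \0) (fun _ _ _ _ => erefl)
  (fun _ _ _ _ => erefl).
exists (exist _ (cone (cmap_id X)) Logic.I); apply: id0_zero.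
exact/homK_null/cone_id_null.
Qed.

Let FK_sh : shift_autoequivalence FK. Proof. by apply: full_shift_autoequivalence. Qed.
Let FK_TR1 : TR1 FK. Proof. by apply: full_TR1. Qed.

Lemma cone_isomorphic (X Y X' Y' : cplx R) (f : cmap X Y) (f' : cmap X' Y')
    (a : @hom K X X') (b : @hom K Y Y') :
  comp b (homK_pi f : @hom K X Y) = comp (homK_pi f' : @hom K X' Y') a ->
  is_iso a -> is_iso b -> @isomorphic K (cone f) (cone f').
Proof.
move=> ba Ia Ib.
have [c cP] := dist_morphism (dist_cone f) (dist_cone f') ba.
exists c; pose o (Z : cplx R) : FK := exist _ (Z : K) Logic.I.
apply: (@five_lemma FK FK_zero FK_sh FK_TR1 _ _ (o X) (o Y) (o (cone f)) (o X') (o Y') (o (cone f'))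
  _ _ _ _ _ _ a b c (dist_cone f) (dist_cone f') cP Ia Ib).
- by move=> A B C u v w; exact: dist_rotate.
- by move=> A B C A' B' C' u v w u' v' w' ? ?; exact: dist_morphism.
Qed.

Lemma projK_cone (X Y : cplx R) (f : cmap X Y) : projK X -> projK Y -> projK (cone f).
Proof.
move=> [X' [PX' [a Ia]]] [Y' [PY' [b Ib]]]; have [a' [a'a aa']] := Ia.
have [f' fE] := homKP (comp b (comp (homK_pi f : @hom K X Y) a') : @hom (catK R) X' Y').
exists (cone f'); split; first by move=> n; apply: projective_pair.
apply: (cone_isomorphic (a := a) (b := b)) => //.
by rewrite -fE -!compA a'a compm1.
Qed.

Lemma projK_sh (X : K) : projK X -> projK (sh X).
Proof.
move=> [X' [PX' [a [a' [a'a aa']]]]]; exists (shift X'); split; first by move=> n; exact: PX'.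
exists (shm a); exists (shm a').
by rewrite -!triK_shm_comp a'a aa' !triK_shm_id.
Qed.

(** That [unshift] respects isomorphisms is deduced from full faithfulness of the shift. *)
Lemma projK_unshift (Y : cplx R) : projK Y -> projK (unshift Y).
Proof.
move=> [Y' [PY' YY']]; exists (unshift Y'); split; first by move=> n; exact: PY'.
have [s Is] : @isomorphic K (shift (unshift Y)) (shift (unshift Y')).
  apply: isomorphic_trans (shift_unshift Y) _.
  exact: isomorphic_trans YY' (isomorphic_sym (shift_unshift Y')).
pose o (Z : cplx R) : FK := exist _ (Z : K) Logic.I.
have [t tE] := @shm_surj FK FK_sh (o (unshift Y)) (o (unshift Y')) s.
exists t; apply: (@shm_iso_inv FK FK_sh (o (unshift Y)) (o (unshift Y'))).
by rewrite tE.
Qed.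

Lemma projK_coproducts (P : K -> Prop) (shP : forall X, P X -> P (sh X)) :
  (forall X, P X <-> projK X) -> has_coproducts (full_tridata shP).
Proof.
move=> PE I X.
have H i : projK (sval (X i)) by apply/PE; exact: (svalP (X i)).
pose X' i := projT1 (cid (H i)).
have X'P i : proj_cplx (X' i) /\ isomorphic (sval (X i)) (X' i : K) by exact: (projT2 (cid (H i))).
pose a i := projT1 (cid (X'P i).2).
have aP i : is_iso (a i) by exact: (projT2 (cid (X'P i).2)).
have PS : P (dsumC X').
  apply/PE; exists (dsumC X'); split; last by exists (idm _); exact: is_iso_id.
  by move=> n; apply: dsum_projective => i; exact: (X'P i).1.
exists (exist _ (dsumC X' : K) PS), (fun i => comp (homK_pi (dsumC_inj X' i) : @hom K _ _) (a i)).
move=> Y f.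
exact: (@coproduct_precomp_iso (catK R) I (fun i => sval (X i)) X' (dsumC X') _ a
  (@dsumC_coproduct R I X') aP (sval Y) f).
Qed.

End ProjectiveComplexes.

(** * Cartan-Eilenberg short exact sequences *)

Lemma exact_splice (A K P K1 P1 : zmodType) (b : A -> K) (a : K -> P) (b1 : P -> K1)
    (a1 : K1 -> P1) (f : A -> P) (g : P -> P1) :
  surjective_map b -> a1 0 = 0 -> (forall x, a1 x = 0 -> x = 0) -> exact_at a b1 ->
  (forall x, f x = a (b x)) -> (forall x, g x = a1 (b1 x)) -> exact_at f g.
Proof.
move=> bs a10 a1i ex fE gE y; rewrite gE; split.
  move=> /a1i/ex[k <-]; have [x <-] := bs k; by exists x.
by move=> [x <-]; rewrite fE (_ : b1 _ = 0) //; apply/ex; exists (b x).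
Qed.

Section CEExtension.
Variable R : pzRingType.
Implicit Types X Y Z : cplx R.

Lemma ZsubE X n x : (x \in submod_pred (Zsub X n)) <-> cd X n (n - 1) x = 0.
Proof. exact: ker_linE. Qed.
Lemma BsubE X n x : (x \in submod_pred (Bsub X n)) <-> exists y, cd X (n + 1) n y = x.
Proof. exact: im_linE. Qed.

Lemma CZ_pi0 X n x : (\pi_(CZ X n) x = 0) <-> cd X n (n - 1) x = 0.
Proof. by rewrite quot_pi0; exact: ZsubE. Qed.
Lemma CB_pi0 X n x : (\pi_(CB X n) x = 0) <-> exists y, cd X (n + 1) n y = x.
Proof. by rewrite quot_pi0; exact: BsubE. Qed.
Lemma Hc_pi0 X n (x : Zc X n) :
  (\pi_(Hc X n) x = 0) <-> exists y, cd X (n + 1) n y = val x.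
Proof. by rewrite quot_pi0; exact: (BsubE (val x)). Qed.

Lemma CZmap_pi X Y (f : cmap X Y) n x : CZmap f n (\pi_(CZ X n) x) = \pi_(CZ Y n) (f n x).
Proof. exact: (quot_map_fun_pi (@Zsub_map R X Y f n) x). Qed.
Lemma CBmap_pi X Y (f : cmap X Y) n x : CBmap f n (\pi_(CB X n) x) = \pi_(CB Y n) (f n x).
Proof. exact: (quot_map_fun_pi (@Bsub_map R X Y f n) x). Qed.
Lemma Hmap_pi X Y (f : cmap X Y) n x : Hmap f n (\pi_(Hc X n) x) = \pi_(Hc Y n) (Zmap f n x).
Proof. exact: (quot_map_fun_pi (@Hsub_map R X Y f n) x). Qed.

Arguments CZ_pi0 : clear implicits.
Arguments CB_pi0 : clear implicits.
Arguments Hc_pi0 : clear implicits.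

Lemma Bsub_pred X n (x : X n) : cd X n (n - 1) x \in submod_pred (Bsub X (n - 1)).
Proof. by apply/BsubE; exists (cid_fun (n - 1 + 1) x); rewrite (@cd_cid R X n _ (n - 1)) ?subrK // cid_refl. Qed.

Lemma Bsub_Zsub X n x : x \in submod_pred (Bsub X n) -> x \in submod_pred (Zsub X n).
Proof. by move=> /BsubE[y <-]; apply/ZsubE; rewrite cdd. Qed.

(* Short exact sequences inducing short exact sequences on [Z], [B], [C/Z], [C/B], [H]. *)
Definition CE_short_exact X P Y (a : cmap X P) (b : cmap P Y) : Prop :=
  [/\ forall n, injective (a n), forall n, exact_at (a n) (b n),
    forall n, surjective_map (b n) &
    forall i j, i = j + 1 -> forall z, cd Y i j z = 0 ->
      exists z', cd P i j z' = 0 /\ b i z' = z].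

Section ShortExact.
Variables (X P Y : cplx R) (a : cmap X P) (b : cmap P Y).
Hypothesis H : CE_short_exact a b.

Let ainj n x : a n x = 0 -> x = 0.
Proof. by case: H => /(_ n) ai _ _ _ e; apply: ai; rewrite e linear0. Qed.
Let bsurj n : surjective_map (b n). Proof. by case: H. Qed.
Let ba n x : b n (a n x) = 0. Proof. by case: H => _ /(_ n) ex _ _; apply/ex; exists x. Qed.
Let ex n x : b n x = 0 -> exists y, a n y = x.
Proof. by case: H => _ /(_ n) ex _ _ /ex. Qed.
(** When [b] kills the boundary of [p], surjectivity on cycles splits [p] into an element of [X] and
    a cycle. The statements on [B], [C/Z], [C/B] and [H] rest on this. *)
Let correct i j (p : P i) : i = j + 1 -> b j (cd P i j p) = 0 ->
  exists q, cd P i j (a i q) = cd P i j p /\ cd P i j (p - a i q) = 0.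
Proof.
move=> ij; rewrite cmapP; case: H => _ _ _ /(_ i j ij) Zs /Zs[z [dz bz]].
have [|q qP] := @ex i (p - z); first by rewrite linearB bz subrr.
by exists q; rewrite qP subKr dz linearB dz subr0.
Qed.

Lemma CE_short_exact_obj n :
  [/\ forall x, a n x = 0 -> x = 0, exact_at (a n) (b n) & surjective_map (b n)].
Proof. by split; [exact: ainj | case: H | exact: bsurj]. Qed.

Lemma CE_short_exact_Z n :
  [/\ forall x, Zmap a n x = 0 -> x = 0, exact_at (Zmap a n) (Zmap b n) & surjective_map (Zmap b n)].
Proof.
split=> [x /(congr1 val)/= /ainj x0|y|y].
- exact: val_inj.
- split=> [/(congr1 val)/= /ex[k kE]|[x <-]]; last by apply: val_inj; exact: ba.
  have kZ : k \in submod_pred (Zsub X n).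
    by apply/ZsubE; apply: ainj; rewrite cmapP kE; exact: (proj1 (ZsubE _) (valP _)).
  by exists (sub_elt kZ); exact: val_inj.
- have /ZsubE dy := valP y; case: H => _ _ _ /(_ n (n - 1)).
  rewrite subrK => /(_ erefl _ dy)[z [/ZsubE zZ bz]].
  by exists (sub_elt zZ); exact: val_inj.
Qed.

Lemma CE_short_exact_B n :
  [/\ forall x, Bmap a n x = 0 -> x = 0, exact_at (Bmap a n) (Bmap b n) & surjective_map (Bmap b n)].
Proof.
split=> [x /(congr1 val)/= /ainj x0|y|y].
- exact: val_inj.
- split=> [/(congr1 val)/=|[x <-]]; last by apply: val_inj; exact: ba.
  have /BsubE[p pE] := valP y; rewrite -pE => /(correct erefl)[q [qE _]].
  have kB : cd X (n + 1) n q \in submod_pred (Bsub X n) by apply/BsubE; exists q.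
  by exists (sub_elt kB); apply: val_inj; rewrite /= cmapP qE.
- have /BsubE[w wE] := valP y; have [p pE] := bsurj w.
  have kB : cd P (n + 1) n p \in submod_pred (Bsub P n) by apply/BsubE; exists p.
  by exists (sub_elt kB); apply: val_inj; rewrite /= cmapP pE.
Qed.

Lemma CE_short_exact_CZ n :
  [/\ forall x, CZmap a n x = 0 -> x = 0, exact_at (CZmap a n) (CZmap b n) & surjective_map (CZmap b n)].
Proof.
split=> [x|y|y].
- have [x0 <-] := quot_pi_surj x; rewrite CZmap_pi => e0; have := proj1 (CZ_pi0 P n (a n x0)) e0.
  by rewrite -cmapP => /ainj dx; apply: (proj2 (CZ_pi0 X n x0)).
- have [p <-] := quot_pi_surj y; rewrite CZmap_pi; split.
    move=> e0; have := proj1 (CZ_pi0 Y n (b n p)) e0; rewrite -cmapP => bp.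
    have [|q [_ qE]] := correct (p := p) _ bp; first by rewrite subrK.
    exists (\pi_(CZ X n) q); rewrite CZmap_pi; apply/quot_of_eq.
    by rewrite -opprB rpredN; apply/ZsubE.
  move=> [x]; have [x0 <-] := quot_pi_surj x; rewrite CZmap_pi => /quot_of_eq/Zsub_map bE.
  by apply/quot_pi0; have := bE _ b; rewrite linearB ba sub0r rpredN.
- have [y0 <-] := quot_pi_surj y; have [p <-] := bsurj y0.
  by exists (\pi_(CZ P n) p); exact: CZmap_pi.
Qed.

Lemma CE_short_exact_CB n :
  [/\ forall x, CBmap a n x = 0 -> x = 0, exact_at (CBmap a n) (CBmap b n) & surjective_map (CBmap b n)].
Proof.
split=> [x|y|y].
- have [x0 <-] := quot_pi_surj x; rewrite CBmap_pi => e0; have [p pE] := proj1 (CB_pi0 P n (a n x0)) e0.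
  have [|q [qE _]] := correct (p := p) erefl; first by rewrite pE ba.
  apply: (proj2 (CB_pi0 X n x0)); exists q; apply/eqP; rewrite -subr_eq0; apply/eqP/ainj.
  by rewrite linearB cmapP qE pE subrr.
- have [p <-] := quot_pi_surj y; rewrite CBmap_pi; split.
    move=> e0; have [w wE] := proj1 (CB_pi0 Y n (b n p)) e0; have [p' p'E] := bsurj w.
    have [|q qE] := ex (x := p - cd P (n + 1) n p').
      by rewrite linearB cmapP p'E wE subrr.
    exists (\pi_(CB X n) q); rewrite CBmap_pi qE; apply/quot_of_eq; apply/BsubE.
    by exists (- p'); rewrite linearN addrAC subrr add0r.
  move=> [x]; have [x0 <-] := quot_pi_surj x; rewrite CBmap_pi => /quot_of_eq.
  move=> /Bsub_map bE; apply/quot_pi0.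
  by have := bE _ b; rewrite linearB ba sub0r rpredN.
- have [y0 <-] := quot_pi_surj y; have [p <-] := bsurj y0.
  by exists (\pi_(CB P n) p); exact: CBmap_pi.
Qed.

Lemma CE_short_exact_H n :
  [/\ forall x, Hmap a n x = 0 -> x = 0, exact_at (Hmap a n) (Hmap b n) & surjective_map (Hmap b n)].
Proof.
have [_ _ Zs] := CE_short_exact_Z n.
split=> [x|y|y].
- have [x0 <-] := quot_pi_surj x; rewrite Hmap_pi => e0; have [p pE] := proj1 (Hc_pi0 P n (Zmap a n x0)) e0.
  have [|q [qE _]] := correct (p := p) erefl; first by rewrite pE ba.
  apply: (proj2 (Hc_pi0 X n x0)); exists q; apply/eqP; rewrite -subr_eq0; apply/eqP/ainj.
  by rewrite linearB cmapP qE pE subrr.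
- have [z <-] := quot_pi_surj y; rewrite Hmap_pi; split.
    move=> e0; have [w wE] := proj1 (Hc_pi0 Y n (Zmap b n z)) e0; have [p' p'E] := bsurj w.
    have [|q qE] := ex (x := val z - cd P (n + 1) n p').
      by rewrite linearB cmapP p'E wE subrr.
    have qZ : q \in submod_pred (Zsub X n).
      apply/ZsubE; apply: ainj; rewrite cmapP qE linearB cdd subr0.
      by exact: (proj1 (ZsubE _) (valP _)).
    exists (\pi_(Hc X n) (sub_elt qZ)); rewrite Hmap_pi.
    apply/quot_of_eq/(BsubE (val (Zmap a n (sub_elt qZ) - z))); exists (- p').
    by rewrite linearN linearB /= qE addrAC subrr add0r.
  move=> [x]; have [x0 <-] := quot_pi_surj x; rewrite Hmap_pi => /quot_of_eq e0.
  have zB : - b n (val z) \in submod_pred (Bsub Y n).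
    by have := @Bsub_map R P Y b n (val (Zmap a n x0 - z)) e0; rewrite !linearB /= ba sub0r.
  by rewrite rpredN in zB; exact/quot_pi0.
- have [y0 <-] := quot_pi_surj y; have [z <-] := Zs y0.
  by exists (\pi_(Hc P n) z); exact: Hmap_pi.
Qed.

End ShortExact.
End CEExtension.

(** * Discs, spheres and syzygies *)

Section DiscSphere.
Variable R : pzRingType.
Implicit Types X Y Z : cplx R.

Lemma cid_neq X i j (x : X i) : i != j -> cid_fun j x = 0.
Proof. by rewrite /cid_fun; case: eqP. Qed.
Lemma cid_inj0 X i j (x : X i) : i = j -> cid_fun j x = 0 -> x = 0.
Proof. by move=> e; case: j / e; rewrite cid_refl. Qed.

Section DS.
Variables A Q : cplx R.

(* The sum of the discs on [A n] in degrees [n] and [n - 1] and of the spheres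
   on [Q n] in degree [n]; the differentials of [A] and [Q] are not used. *)
Definition disc_sphere_obj n : lmodType R := (A n * A (n + 1)%R * Q n)%type.
Definition disc_sphere_fun i j (z : disc_sphere_obj i) : disc_sphere_obj j :=
  ((0, cid_fun (j + 1) z.1.1), 0).
Lemma disc_sphere_linear i j : linear (@disc_sphere_fun i j).
Proof.
by move=> r z z'; congr ((_, _), _); rewrite /= ?scaler0 ?addr0 // linearP.
Qed.
Lemma disc_sphere_shape (i j : int) : i != j + 1 ->
  forall z, lin_of (@disc_sphere_linear i j) z = 0.
Proof. by move=> ij z; congr ((_, _), _); exact: cid_neq. Qed.
Lemma disc_sphere_dd i j k z :
  lin_of (@disc_sphere_linear j k) (lin_of (@disc_sphere_linear i j) z) = 0.
Proof. by congr ((_, _), _); rewrite /= linear0. Qed.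
Definition disc_sphere : cplx R :=
  Cplx disc_sphere_shape disc_sphere_dd.

Hypotheses (PA : proj_cplx A) (PQ : proj_cplx Q).

(** Cycles, boundaries and homology are the coordinate summands [((0, y), q)], [((0, y), 0)] and
    [((0, 0), q)] of a projective module. *)
Lemma disc_sphere_projective : CE_projective disc_sphere.
Proof.
move=> n.
have PP : projective_mod (disc_sphere n) by exact: (projective_pair (projective_pair (@PA n) (@PA (n + 1))) (@PQ n)).
have dE (z : disc_sphere n) : cd disc_sphere n (n - 1) z = 0 -> z.1.1 = 0.
  by move=> /(congr1 (fun z => z.1.2)) /cid_inj0; apply; rewrite subrK.
have bE (z : disc_sphere n) : (z \in submod_pred (Bsub disc_sphere n)) <-> z.1.1 = 0 /\ z.2 = 0.
  split=> [/BsubE[y <-]//|[z1 z2]]; apply/BsubE; exists ((z.1.2, 0), 0).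
  by case: z z1 z2 => [[x y] q] /= -> ->; congr ((_, _), _); rewrite /= cid_refl.
have zL : linear (fun z : disc_sphere n => ((0, z.1.2), z.2) : disc_sphere n).
  by move=> r z z'; congr ((_, _), _); rewrite /= scaler0 addr0.
have [z|pZ pZE] := @lin_to_sub R _ _ (Zsub disc_sphere n) (lin_of zL).
  by apply/ZsubE; congr ((_, _), _); rewrite /= linear0.
have bL : linear (fun z : disc_sphere n => ((0, z.1.2), 0) : disc_sphere n).
  by move=> r z z'; congr ((_, _), _); rewrite /= scaler0 addr0.
have [z|pB pBE] := @lin_to_sub R _ _ (Bsub disc_sphere n) (lin_of bL).
  by apply/bE.
have hL : linear (fun z : Zc disc_sphere n => ((0, 0), (val z).2) : disc_sphere n).
  by move=> r z z'; congr ((_, _), _); rewrite /= ?scaler0 ?addr0.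
have [z /Hc_pi0 /BsubE/bE[_ z2]|iH iHE] := @linear_factor R _ _ _
    (\pi_(Hc disc_sphere n) : {linear Zc disc_sphere n -> Hc disc_sphere n}) (lin_of hL) (@quot_pi_surj _ _ _).
  by congr ((_, _), _).
have zAux (w : disc_sphere n) : w.1.1 = 0 -> ((0, w.1.2), w.2) = w.
  by case: w => [[x y] q] /= ->.
have bAux (w : disc_sphere n) : w.1.1 = 0 -> w.2 = 0 -> ((0, w.1.2), 0) = w.
  by case: w => [[x y] q] /= -> ->.
split=> //.
- apply: (@projective_retract R _ _ (val : {linear Zc disc_sphere n -> disc_sphere n}) pZ) PP.
  move=> z; apply: val_inj; rewrite pZE /=.
  have /ZsubE/dE := valP z; exact: zAux.
- apply: (@projective_retract R _ _ (val : {linear Bc disc_sphere n -> disc_sphere n}) pB) PP.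
  move=> z; apply: val_inj; rewrite pBE /=.
  have /bE[] := valP z; exact: bAux.
- apply: (@projective_retract R _ _ iH (\pi_(Hc disc_sphere n) \o pZ : {linear disc_sphere n -> Hc disc_sphere n})) PP.
  move=> y; have [z <-] := quot_pi_surj y.
  rewrite /= iHE; apply/quot_of_eq/(bE (val (pZ (lin_of hL z) - z))).
  have /ZsubE/dE z0 := valP z.
  by split; rewrite linearB pZE /= ?subrr //; rewrite [X in 0 - X]z0 subr0.
Qed.
End DS.

(** The discs on [X] make [b] surjective and degreewise split, so its kernel is degreewise
    projective; the spheres on projective covers of the cycles make it surjective on cycles. *)
Lemma CE_syzygy X : proj_cplx X -> exists Y P (a : cmap Y P) (b : cmap P X),
  [/\ proj_cplx Y, CE_projective P & CE_short_exact a b].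
Proof.
move=> PX.
have H n : exists (F : lmodType R) (p : {linear F -> Zc X n}), projective_mod F /\ surjective_map p.
  exact: free_cover.
pose F n := projT1 (cid (H n)).
pose p n := projT1 (cid (projT2 (cid (H n)))) : {linear F n -> Zc X n}.
have pP n : projective_mod (F n) /\ surjective_map (p n).
  exact: (projT2 (cid (projT2 (cid (H n))))).
pose Q : cplx R := @Cplx R F (fun _ _ => \0) (fun _ _ _ _ => erefl) (fun _ _ _ _ => erefl).
pose P := disc_sphere X Q.
have bL n : linear (fun z : P n => z.1.1 + cd X (n + 1) n z.1.2 + val (p n z.2)).
  by move=> r z z'; rewrite /= !linearP /= !scalerDr (addrACA (r *: _)) (addrACA (r *: _ + _)).
have bP i z : lin_of (bL (i - 1)) (cd P i (i - 1) z) = cd X i (i - 1) (lin_of (bL i) z).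
  rewrite /= add0r linear0 addr0 !linearD cdd addr0.
  have /ZsubE -> := valP (p i z.2); rewrite addr0.
  by rewrite (@cd_cid R X i _ (i - 1) (i - 1)) ?subrK // cid_refl.
pose b : cmap P X := mk_cmap bP.
have bsurj n x : b n ((x, 0), 0) = x by rewrite /= !linear0 !addr0.
exists (kerC b), P.
exists (@mk_cmap R (kerC b) P (fun n => val : {linear sub_of (ker_mod (b n)) -> P n}) (fun _ _ => erefl)), b.
split.
- move=> n.
  have rL : linear (fun z : P n => z - ((b n z, 0), 0)).
    move=> r z z'; rewrite linearP scalerBr addrACA -opprD; congr (_ - _).
    by congr ((_, _), _); rewrite /= ?scaler0 ?addr0.
  have [z|q qE] := @lin_to_sub R _ _ (ker_mod (b n)) (lin_of rL).
    by apply/ker_linE; rewrite linearB bsurj subrr.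
  apply: (@projective_retract R _ _ (val : {linear sub_of (ker_mod (b n)) -> P n}) q).
    move=> z; apply: val_inj; rewrite qE /=.
    have /ker_linE z0 := valP z; rewrite -[X in _ - ((X, _), _)]/(b n (val z)) z0.
    by rewrite -[RHS]subr0.
  exact: (projective_pair (projective_pair (PX n) (PX (n + 1))) (pP n).1).
- by apply: disc_sphere_projective => // n; exact: (pP n).1.
- split.
  + by move=> n; exact: val_inj.
  + move=> n z; split=> [zb|[y <-]]; last by apply/ker_linE; exact: (valP y).
    have zK : z \in submod_pred (ker_mod (b n)) by apply/ker_linE.
    by exists (sub_elt zK).
  + by move=> n x; exists ((x, 0), 0).
  + move=> i j ij z dz; have zZ : z \in submod_pred (Zsub X i).
      by apply/ZsubE; have -> : i - 1 = j by rewrite ij addrK.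
    have [q qE] := (pP i).2 (sub_elt zZ).
    exists ((0, 0), q); split; first by congr ((_, _), _); rewrite /= linear0.
    by rewrite /= linear0 !add0r qE.
Qed.

End DiscSphere.

(** * Cosyzygies *)

Section Cosyzygy.
Variable R : pzRingType.
Implicit Types X Y Z : cplx R.

Lemma cid_shift X i j (x : shift X i) :
  @cid_fun R (shift X) i j x = @cid_fun R X (i - 1) (j - 1) x.
Proof.
have [e|ij] := eqVneq i j; first by case: j / e; rewrite !cid_refl.
by rewrite !cid_neq //; apply: contra ij => /eqP/addIr ->.
Qed.

Section Cokernel.
Variables (X P : cplx R) (a : cmap X P).

Lemma cokerC_subproof i j x :
  x \in submod_pred (im_mod (a i)) -> cd P i j x \in submod_pred (im_mod (a j)).
Proof. by move=> /im_linE[y <-]; apply/im_linE; exists (cd X i j y); rewrite cmapP. Qed.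

Definition cokerC_d i j : {linear quot_of (im_mod (a i)) -> quot_of (im_mod (a j))} :=
  quot_map (@cokerC_subproof i j).

Lemma cokerC_dE i j x : cokerC_d i j (\pi_(quot_of (im_mod (a i))) x) =
  \pi_(quot_of (im_mod (a j))) (cd P i j x).
Proof. exact: (quot_map_fun_pi (@cokerC_subproof i j) x). Qed.

Lemma cokerC_shape (i j : int) : i != j + 1 -> forall x, cokerC_d i j x = 0.
Proof. by move=> ij x; have [y <-] := quot_pi_surj x; rewrite cokerC_dE cd_shape // linear0. Qed.

Lemma cokerC_dd i j k x : cokerC_d j k (cokerC_d i j x) = 0.
Proof. by have [y <-] := quot_pi_surj x; rewrite !cokerC_dE cdd linear0. Qed.

Definition cokerC : cplx R :=
  @Cplx R (fun n => quot_of (im_mod (a n))) cokerC_d cokerC_shape cokerC_dd.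

Definition cokerC_pi : cmap P cokerC :=
  @Cmap R P cokerC (fun n => \pi_(quot_of (im_mod (a n))) : {linear P n -> quot_of (im_mod (a n))})
    (fun i j x => esym (cokerC_dE j x)).
End Cokernel.

Hypothesis embed : forall V : lmodType R,
  exists (P : lmodType R) (i : {linear V -> P}), projective_mod P /\ injective i.

(** The disc coordinates split [a] degreewise, so the cokernel stays projective. The sphere
    coordinate embeds [X / B(X)]: boundaries of [P] have none, so if [a y] is a boundary then [y] is
    one, and cycles of the cokernel lift. *)
Lemma CE_cosyzygy X : proj_cplx X -> exists P Y (a : cmap X P) (b : cmap P Y),
  [/\ proj_cplx Y, CE_projective P & CE_short_exact a b].
Proof.
move=> PX.
pose E n := projT1 (cid (embed (CB X n))).
pose e n := projT1 (cid (projT2 (cid (embed (CB X n))))) : {linear CB X n -> E n}.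
have eP n : projective_mod (E n) /\ injective (e n).
  exact: (projT2 (cid (projT2 (cid (embed (CB X n)))))).
pose Q : cplx R := @Cplx R E (fun _ _ => \0) (fun _ _ _ _ => erefl) (fun _ _ _ _ => erefl).
pose P := disc_sphere (shift X) Q.
pose af n (x : X n) : P n := ((cd X n (n - 1) x, cid_fun (n + 1 - 1) x), e n (\pi_(CB X n) x)).
have aL n : linear (@af n) by move=> r x y; congr ((_, _), _); rewrite !linearP.
have aP i x : lin_of (@aL (i - 1)) (cd X i (i - 1) x) = cd P i (i - 1) (lin_of (@aL i) x).
  congr ((_, _), _); first by rewrite cdd.
    by rewrite /= cid_shift.
  rewrite (_ : \pi_(CB X (i - 1)) _ = 0) ?linear0 //.
  by apply/quot_pi0; exact: Bsub_pred.
pose a : cmap X P := mk_cmap aP.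
have retL n : linear (fun z : P n => cidl X (n + 1 - 1) n z.1.2 : X n).
  by move=> r z z'; rewrite /= linearP.
pose ret n : {linear P n -> X n} := lin_of (retL n).
have retK n : cancel (a n) (ret n) by move=> x; rewrite /= cid_trans ?cid_refl // addrK.
exists P, (cokerC a), a, (cokerC_pi a).
have PP : CE_projective P.
  by apply: disc_sphere_projective => n; [exact: PX | exact: (eP n).1].
split=> //.
  move=> n.
  have gL : linear (fun z : P n => z - a n (ret n z)).
    by move=> r z z'; rewrite (linearP (ret n)) (linearP (a n)) scalerBr opprD addrACA.
  have [z /quot_pi0/im_linE[x <-]|g gE] := @linear_factor R _ _ _
    (\pi_(quot_of (im_mod (a n))) : {linear P n -> quot_of (im_mod (a n))}) (lin_of gL) (@quot_pi_surj _ _ _).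
    by rewrite [LHS]/= -[X in _ - X]/(a n (ret n (a n x))) retK subrr.
  apply: (@projective_retract R _ _ g (\pi_(quot_of (im_mod (a n))) : {linear P n -> quot_of (im_mod (a n))})).
    move=> y; have [z <-] := quot_pi_surj y; rewrite gE; apply/quot_of_eq.
    rewrite [X in X - _]/= addrAC subrr add0r rpredN.
    by apply/im_linE; exists (ret n z).
  by have [] := PP n.
split.
- by move=> n; exact: can_inj (retK n).
- move=> n z; split=> [/quot_pi0/im_linE //|[x <-]].
  by apply/quot_pi0/im_linE; exists x.
- by move=> n; exact: quot_pi_surj.
- move=> i j -> z; have [p <-] := quot_pi_surj z.
  move=> dz; have /quot_pi0/im_linE[y yE] : \pi_(quot_of (im_mod (a j))) (cd P (j + 1) j p) = 0.
    by rewrite -cokerC_dE.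
  have /BsubE[x xE] : y \in submod_pred (Bsub X j).
    apply/quot_pi0; apply: (eP j).2; rewrite linear0.
    exact: (congr1 snd yE).
  exists (p - a (j + 1) x); split; first by rewrite linearB -cmapP xE yE subrr.
  apply/quot_of_eq; rewrite addrAC subrr add0r rpredN.
  by apply/im_linE; exists x.
Qed.

End Cosyzygy.

(** * Homotopy classes of maps into Cartan-Eilenberg projective complexes *)

Section HomExact.
Variable R : pzRingType.
Hypothesis projective_injective : forall P : lmodType R, projective_mod P -> injective_mod P.

(* Maps up to homotopy into a complex with zero differential and injective
   components are families of maps out of the homology. *)
Lemma zero_diff_hom_exact (E P1 P2 P3 : cplx R) (f : cmap P1 P2) (g : cmap P2 P3) :
  (forall i j x, cd E i j x = 0) -> (forall n, injective_mod (E n)) ->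
  (forall n, exact_at (Hmap f n) (Hmap g n)) ->
  forall p : cmap P2 E, null_homotopic (cmap_comp p f) ->
  exists q : cmap P3 E, null_homotopic (p - cmap_comp q g).
Proof.
move=> E0 IE ex p [h pf].
(* [p] induces a map on [H(P2)] that kills the image of [H(f)]. It extends along [H(g)], and then
   from the cycles to all of [P3 n], each time by injectivity of [E n]. *)
have H n : exists q : {linear P3 n -> E n},
    (forall x, x \in submod_pred (Bsub P3 n) -> q x = 0) /\
    (forall x, cd P2 n (n - 1) x = 0 -> p n x = q (g n x)).
  have [z|pb pbE] := @linear_factor R _ _ _
    (\pi_(Hc P2 n) : {linear Zc P2 n -> Hc P2 n}) (p n \o (val : {linear Zc P2 n -> P2 n})) (@quot_pi_surj _ _ _).
    by move=> /Hc_pi0[y yE]; rewrite /= -yE cmapP E0.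
  have [x|qb qbE] := @injective_factor R _ _ _ (Hmap g n) pb (IE n).
    move=> /ex[y <-]; have [z <-] := quot_pi_surj y; rewrite Hmap_pi pbE /=.
    have /ZsubE dz := valP z.
    by rewrite -[LHS]/(cmap_comp p f n (val z)) pf E0 dz linear0 addr0.
  have [q qE] := IE n _ _ (val : {linear Zc P3 n -> P3 n})
    (qb \o (\pi_(Hc P3 n) : {linear Zc P3 n -> Hc P3 n}) : {linear Zc P3 n -> E n}) val_inj.
  exists q; split=> [x xB|x xZ].
    have xZ : x \in submod_pred (Zsub P3 n) by exact: Bsub_Zsub.
    rewrite -[x]/(val (sub_elt xZ)) qE /= (_ : \pi_(Hc P3 n) _ = 0) ?linear0 //.
    by apply/Hc_pi0/BsubE.
  have xZ' : x \in submod_pred (Zsub P2 n) by apply/ZsubE.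
  rewrite -[g n x]/(val (Zmap g n (sub_elt xZ'))) qE /= -Hmap_pi qbE pbE.
  by [].
pose q n := projT1 (cid (H n)).
have qP n : (forall x, x \in submod_pred (Bsub P3 n) -> q n x = 0) /\
    (forall x, cd P2 n (n - 1) x = 0 -> p n x = q n (g n x)).
  exact: (projT2 (cid (H n))).
have qC i x : q (i - 1) (cd P3 i (i - 1) x) = cd E i (i - 1) (q i x).
  by rewrite E0 (qP (i - 1)).1 // Bsub_pred.
exists (mk_cmap qC).
(* [p] and [q g] agree on cycles, so their difference factors through the differential; as [E] has
   zero differential, this is a null homotopy. *)
have K n : exists k : {linear P2 (n - 1) -> E n}, forall x,
    k (cd P2 n (n - 1) x) = (p - cmap_comp (mk_cmap qC) g) n x.
  apply: injective_factor => // x dx.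
  by apply/eqP; rewrite subr_eq0; apply/eqP; exact: (qP n).2.
pose k n := projT1 (cid (K n)).
have kP n x : k n (cd P2 n (n - 1) x) = (p - cmap_comp (mk_cmap qC) g) n x.
  exact: (projT2 (cid (K n)) x).
exists (fun i j => k j \o cidl P2 i (j - 1)) => n x.
by rewrite E0 add0r /= cid_refl kP.
Qed.

Definition homology_cplx (Q : cplx R) : cplx R :=
  @Cplx R (fun n => Hc Q n) (fun _ _ => \0) (fun _ _ _ _ => erefl) (fun _ _ _ _ => erefl).

(** Projectivity of boundaries and homology splits [Q n] into its homology, its boundaries and a
    copy of the boundaries of degree [n - 1]; the sections [t] of the differential contract all but
    the homology. *)
Lemma CE_projective_homology (Q : cplx R) : CE_projective Q ->
  exists (p : cmap Q (homology_cplx Q)) (s : cmap (homology_cplx Q) Q),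
    homK_pi (cmap_comp s p) = homK_pi (cmap_id Q).
Proof.
move=> PQ.
have Hd n : exists d : {linear Q n -> Bc Q (n - 1)}, exists t : {linear Bc Q (n - 1) -> Q n},
    (forall x, val (d x) = cd Q n (n - 1) x) /\ cancel t d.
  have [x|d dE] := @lin_to_sub R _ _ (Bsub Q (n - 1)) (cd Q n (n - 1)); first exact: Bsub_pred.
  have [_ _ PB _] := PQ (n - 1).
  have [y|t tK] := projective_section PB (g := d); last by exists d, t.
  have /BsubE[x xE] := valP y; exists (cid_fun n x); apply: val_inj.
  by rewrite dE (@cd_cid R Q (n - 1 + 1) n (n - 1) (n - 1)) ?subrK // cid_refl.
pose d n := projT1 (cid (Hd n)).
pose t n := projT1 (cid (projT2 (cid (Hd n)))) : {linear Bc Q (n - 1) -> Q n}.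
have dtP n : (forall x, val (d n x) = cd Q n (n - 1) x) /\ cancel (t n) (d n).
  exact: (projT2 (cid (projT2 (cid (Hd n))))).
have dt n b : cd Q n (n - 1) (t n b) = val b by rewrite -(dtP n).1 (dtP n).2.
have Hr n : exists r : {linear Q n -> Zc Q n}, forall x, val (r x) = x - t n (d n x).
  have L : linear (fun x : Q n => x - t n (d n x)).
    by move=> c x y; rewrite (linearP (d n)) (linearP (t n)) scalerBr opprD addrACA.
  apply: (@lin_to_sub R _ _ (Zsub Q n) (lin_of L)) => x.
  by apply/ZsubE; rewrite linearB dt (dtP n).1 subrr.
pose r n := projT1 (cid (Hr n)).
have rP n x : val (r n x) = x - t n (d n x) by exact: (projT2 (cid (Hr n)) x).
have rd n x : val (r (n - 1) (cd Q n (n - 1) x)) = cd Q n (n - 1) x.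
  rewrite rP (_ : d (n - 1) _ = 0) ?linear0 ?addr0 //.
  by apply: val_inj; rewrite (dtP (n - 1)).1 cdd.
have Hs n : exists s : {linear Hc Q n -> Zc Q n}, cancel s (\pi_(Hc Q n)).
  have [_ _ _ PH] := PQ n.
  exact: (projective_section PH (g := \pi_(Hc Q n) : {linear Zc Q n -> Hc Q n}) (@quot_pi_surj _ _ _)).
pose s n := projT1 (cid (Hs n)).
have sP n : cancel (s n) (\pi_(Hc Q n)) by exact: (projT2 (cid (Hs n))).
have prd n x : \pi_(Hc Q (n - 1)) (r (n - 1) (cd Q n (n - 1) x)) = 0.
  by apply/Hc_pi0/BsubE; rewrite rd; exact: Bsub_pred.
pose p : cmap Q (homology_cplx Q) :=
  @mk_cmap R Q (homology_cplx Q) (fun n => \pi_(Hc Q n) \o r n) prd.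
have sC i x : val (s (i - 1) (cd (homology_cplx Q) i (i - 1) x)) = cd Q i (i - 1) (val (s i x)).
  by rewrite linear0; have /ZsubE -> := valP (s i x).
pose s' : cmap (homology_cplx Q) Q :=
  @mk_cmap R (homology_cplx Q) Q (fun n => (val : {linear Zc Q n -> Q n}) \o s n) sC.
exists p, s'; apply: esym.
have Hu n : exists u : {linear Q n -> Bc Q n}, forall x, val (u x) = val (r n x) - s' n (p n x).
  have L : linear (fun x : Q n => val (r n x) - s' n (p n x)).
    by move=> c x y; rewrite (linearP (r n)) (linearP (p n)) (linearP (s' n)) linearP scalerBr opprD addrACA.
  apply: (@lin_to_sub R _ _ (Bsub Q n) (lin_of L)) => x.
  have /quot_of_eq : \pi_(Hc Q n) (r n x) = \pi_(Hc Q n) (s n (\pi_(Hc Q n) (r n x))).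
    by rewrite sP.
  by [].
pose u n := projT1 (cid (Hu n)).
have uP n x : val (u n x) = val (r n x) - s' n (p n x) by exact: (projT2 (cid (Hu n)) x).
apply: (@homK_eqI R Q Q _ _ (fun i j => t j \o u (j - 1) \o cidl Q i (j - 1))) => m x.
rewrite /= !cid_refl dt uP.
have -> : u (m - 1 - 1) (cd Q (m - 1) (m - 1 - 1) x) = d (m - 1) x.
  apply: val_inj; rewrite uP rd (dtP (m - 1)).1.
  by rewrite -[p _ _]/(\pi_(Hc Q (m - 1 - 1)) (r (m - 1 - 1) (cd Q (m - 1) (m - 1 - 1) x))) prd linear0 subr0.
by rewrite rP [RHS]addrAC subrK.
Qed.

(** In [K(R)], [Q] is a retract of its homology, to which [zero_diff_hom_exact] applies; [s] carries
    the factorization back. *)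
Lemma CE_projective_hom_exact (P1 P2 P3 Q : cplx R) (f : cmap P1 P2) (g : cmap P2 P3) :
  CE_projective Q -> (forall n, exact_at (Hmap f n) (Hmap g n)) ->
  (forall n x, g n (f n x) = 0) ->
  exact_at (fun b : homK P3 Q => compK b (homK_pi g)) (fun b : homK P2 Q => compK b (homK_pi f)).
Proof.
move=> PQ ex gf y; split; last first.
  move=> [x <-]; rewrite -compKA compK_pi.
  have -> : homK_pi (cmap_comp g f) = 0 by rewrite -homK_pi0; apply: homK_ext => n z; exact: gf.
  exact: (@compm0 (catK R)).
have [p [s sp]] := CE_projective_homology PQ.
have [y0 ->] := homKP y; rewrite compK_pi => /homK_null yf.
have IE n : injective_mod (homology_cplx Q n).
  by apply: projective_injective; have [] := PQ n.
have pyf : null_homotopic (cmap_comp (cmap_comp p y0) f).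
  have := null_comp (g := p) (or_intror yf).
  by rewrite (_ : cmap_comp p (cmap_comp y0 f) = cmap_comp (cmap_comp p y0) f) //; exact: cmap_ext.
have [q qP] := zero_diff_hom_exact (E := homology_cplx Q) (fun _ _ _ => erefl) IE ex pyf.
exists (homK_pi (cmap_comp s q)).
have E1 : compK (homK_pi q) (homK_pi g) = compK (homK_pi p) (homK_pi y0).
  by rewrite !compK_pi; apply/esym/homK_pi_eq.
by rewrite -compK_pi -compKA E1 compKA compK_pi sp compK1m.
Qed.

End HomExact.

(** * Gorenstein projective objects as complexes of projectives *)

Section GorensteinProjective.
Variable R : pzRingType.
Notation K := (triK R).
Implicit Types X Y Z : cplx R.

(** The degreewise splitting makes the kernel of [f 0] a direct summand of [P 0] in every degree. *)
Lemma Gorenstein_projective_projK (X : K) : Gorenstein_projective X -> projK X.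
Proof.
move=> [P [f [PP [_ sf] XK _]]]; exists (kerC (f 0)); split=> // n.
have [s sP] := sf n 0; have [g gE gsurj] := im_surj (f 0 n).
have L : linear (fun x : P 0 n => x - s (g x)).
  by move=> c x y; rewrite (linearP g) (linearP s) scalerBr opprD addrACA.
have [x|q qE] := @lin_to_sub R _ _ (ker_mod (f 0 n)) (lin_of L).
  by apply/ker_linE; rewrite linearB sP gE subrr.
apply: (@projective_retract R _ _ (val : {linear sub_of (ker_mod (f 0 n)) -> P 0 n}) q).
  move=> x; apply: val_inj; rewrite qE /= (_ : g _ = 0) ?linear0 ?addr0 //.
  by apply: val_inj; rewrite gE; apply/ker_linE; exact: (valP x).
by have [] := PP 0 n.
Qed.

Lemma CZmap_comp X Y Z (g : cmap Y Z) (f : cmap X Y) n x :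
  CZmap (cmap_comp g f) n x = CZmap g n (CZmap f n x).
Proof.
by have [y <-] := quot_pi_surj x; rewrite (CZmap_pi f) (CZmap_pi g) (CZmap_pi (cmap_comp g f)).
Qed.
Lemma CBmap_comp X Y Z (g : cmap Y Z) (f : cmap X Y) n x :
  CBmap (cmap_comp g f) n x = CBmap g n (CBmap f n x).
Proof.
by have [y <-] := quot_pi_surj x; rewrite (CBmap_pi f) (CBmap_pi g) (CBmap_pi (cmap_comp g f)).
Qed.
Lemma Hmap_comp X Y Z (g : cmap Y Z) (f : cmap X Y) n x :
  Hmap (cmap_comp g f) n x = Hmap g n (Hmap f n x).
Proof.
have [y <-] := quot_pi_surj x; rewrite (Hmap_pi f) (Hmap_pi g) (Hmap_pi (cmap_comp g f)).
by congr (\pi_(Hc _ _) _); exact: val_inj.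
Qed.

Section Splice.
Variables (C P : int -> cplx R).
Variables (a : forall i, cmap (C i) (P i)) (b : forall i, cmap (P i) (C (i + 1))).
Hypotheses (PC : forall i, proj_cplx (C i)) (H : forall i, CE_short_exact (a i) (b i)).

Definition splice i : cmap (P i) (P (i + 1)) := cmap_comp (a (i + 1)) (b i).

Lemma splice_CE_exact : CE_exact splice.
Proof.
move=> n; split; last split; move=> i.
- have [_ _ bs] := CE_short_exact_obj (H i) n.
  have [_ ex _] := CE_short_exact_obj (H (i + 1)) n.
  have [inj _ _] := CE_short_exact_obj (H (i + 1 + 1)) n.
  exact: (exact_splice bs (linear0 _) inj ex).
- have [_ _ bs] := CE_short_exact_Z (H i) n.
  have [_ ex _] := CE_short_exact_Z (H (i + 1)) n.
  have [inj _ _] := CE_short_exact_Z (H (i + 1 + 1)) n.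
  by apply: (exact_splice bs (linear0 _) inj ex) => x; exact: val_inj.
- have [_ _ bs] := CE_short_exact_B (H i) n.
  have [_ ex _] := CE_short_exact_B (H (i + 1)) n.
  have [inj _ _] := CE_short_exact_B (H (i + 1 + 1)) n.
  by apply: (exact_splice bs (linear0 _) inj ex) => x; exact: val_inj.
- have [_ _ bs] := CE_short_exact_CZ (H i) n.
  have [_ ex _] := CE_short_exact_CZ (H (i + 1)) n.
  have [inj _ _] := CE_short_exact_CZ (H (i + 1 + 1)) n.
  by apply: (exact_splice bs (linear0 _) inj ex) => x; exact: CZmap_comp.
- have [_ _ bs] := CE_short_exact_CB (H i) n.
  have [_ ex _] := CE_short_exact_CB (H (i + 1)) n.
  have [inj _ _] := CE_short_exact_CB (H (i + 1 + 1)) n.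
  by apply: (exact_splice bs (linear0 _) inj ex) => x; exact: CBmap_comp.
- have [_ _ bs] := CE_short_exact_H (H i) n.
  have [_ ex _] := CE_short_exact_H (H (i + 1)) n.
  have [inj _ _] := CE_short_exact_H (H (i + 1 + 1)) n.
  by apply: (exact_splice bs (linear0 _) inj ex) => x; exact: Hmap_comp.
Qed.

(** The image of [splice i] is a copy of the projective module [C (i + 1) n], over which [b i] has a
    section. *)
Lemma splice_split n : split_seq (fun i => splice i n).
Proof.
move=> i; have [g gE gsurj] := im_surj (splice i n).
have [inj _ _] := CE_short_exact_obj (H (i + 1)) n.
have [_ _ bs] := CE_short_exact_obj (H i) n.
have [x|h hE] := @linear_factor R _ _ _ g (b i n) gsurj.
  move=> gx; apply: inj; have := gE x; rewrite gx /= => <-.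
  by [].
have [t tK] := projective_section (@PC (i + 1) n) bs.
exists (t \o h) => y; have [x <-] := gsurj y.
by rewrite gE /= tK hE.
Qed.

Lemma splice_kernel : @isomorphic K (C 0) (kerC (splice 0)).
Proof.
have fE n x : splice 0 n x = 0 <-> exists y, a 0 n y = x.
  have [_ ex _] := CE_short_exact_obj (H 0) n.
  have [inj _ _] := CE_short_exact_obj (H (0 + 1)) n.
  rewrite -ex; split=> [/inj //|e].
  by rewrite /= e linear0.
have Hk n : exists k : {linear C 0 n -> sub_of (ker_mod (splice 0 n))}, forall x, val (k x) = a 0 n x.
  by apply: lin_to_sub => x; apply/ker_linE/fE; exists x.
pose k n := projT1 (cid (Hk n)).
have kP n x : val (k n x) = a 0 n x by exact: (projT2 (cid (Hk n)) x).
have kC i x : k (i - 1) (cd (C 0) i (i - 1) x) = cd (kerC (splice 0)) i (i - 1) (k i x).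
  by apply: val_inj; rewrite kP cmapP /= kP.
exists (homK_pi (@mk_cmap R (C 0) (kerC (splice 0)) k kC)); apply: cplx_isoI => n.
  apply: linear_inj0 => x kx; have [inj _ _] := CE_short_exact_obj (H 0) n.
  by apply: inj; rewrite -kP [k n x]kx.
move=> y; have /ker_linE/fE[x xE] := valP y; exists x.
by apply: val_inj; rewrite /= kP.
Qed.

End Splice.

Hypothesis embed : forall V : lmodType R,
  exists (P : lmodType R) (i : {linear V -> P}), projective_mod P /\ injective i.
Hypothesis projective_injective : forall P : lmodType R, projective_mod P -> injective_mod P.

Definition CE_link X Y : Prop := exists P (a : cmap X P) (b : cmap P Y),
  CE_projective P /\ CE_short_exact a b.

Lemma CE_chain X : proj_cplx X -> exists C : int -> cplx R,
  [/\ C 0 = X, forall i, proj_cplx (C i) & forall i, CE_link (C i) (C (i + 1))].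
Proof.
move=> PX; pose T := {Y : cplx R | proj_cplx Y}.
have Hr (Y : T) : exists Z : T, CE_link (sval Y) (sval Z).
  case: Y => Y PY; have [P [Z [a [b [PZ PP ab]]]]] := CE_cosyzygy embed PY.
  by exists (exist _ Z PZ), P, a, b.
have Hl (Y : T) : exists Z : T, CE_link (sval Z) (sval Y).
  case: Y => Y PY; have [Z [P [a [b [PZ PP ab]]]]] := CE_syzygy PY.
  by exists (exist _ Z PZ), P, a, b.
pose r t := projT1 (cid (Hr t)); pose l t := projT1 (cid (Hl t)).
have rP t : CE_link (sval t) (sval (r t)) by exact: (projT2 (cid (Hr t))).
have lP t : CE_link (sval (l t)) (sval t) by exact: (projT2 (cid (Hl t))).
pose X0 : T := exist _ X PX.
(* [Negz n] is [-(n + 1)], hence [n.+1] syzygies. *)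
pose C (i : int) : T := match i with Posz n => iter n r X0 | Negz n => iter n.+1 l X0 end.
exists (fun i => sval (C i)); split=> // i; first exact: (svalP (C i)).
case: i => [n|[|n]].
- have -> : Posz n + 1 = Posz n.+1 by rewrite -addn1 PoszD.
  exact: rP.
- exact: (lP X0).
- have -> : Negz n.+1 + 1 = Negz n by rewrite !NegzE -addn1 PoszD opprD addrNK.
  exact: (lP (C (Negz n))).
Qed.

Lemma projK_Gorenstein_projective (X : K) : projK X -> Gorenstein_projective X.
Proof.
move=> [X' [PX' XX']]; have [C [C0 PC CC]] := CE_chain PX'.
pose P i := projT1 (cid (CC i)).
pose a i := projT1 (cid (projT2 (cid (CC i)))) : cmap (C i) (P i).
pose b i := projT1 (cid (projT2 (cid (projT2 (cid (CC i)))))) : cmap (P i) (C (i + 1)).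
have abP i : CE_projective (P i) /\ CE_short_exact (a i) (b i).
  exact: (projT2 (cid (projT2 (cid (projT2 (cid (CC i))))))).
have H i := (abP i).2.
exists P, (splice a b); split.
- by move=> i; exact: (abP i).1.
- by split; [exact: splice_CE_exact | exact: splice_split].
- apply: isomorphic_trans XX' _; rewrite -C0; exact: splice_kernel.
- move=> Q PQ i; have ex := splice_CE_exact H.
  apply: (CE_projective_hom_exact projective_injective PQ) => n.
    by have [_ [_ _ _ _ /(_ i)]] := ex n.
  by move=> x; have [/(_ i) exi _] := ex n; apply/exi; exists x.
Qed.

Lemma Gorenstein_projectiveE (X : K) : Gorenstein_projective X <-> projK X.
Proof. by split; [exact: Gorenstein_projective_projK | exact: projK_Gorenstein_projective]. Qed.

End GorensteinProjective.

(** * Compact generators *)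

Section IntChoice.
Variables (T : int -> Type) (n : int) (Inv : forall i, T i -> Prop).
Variables (Step : forall i, T i -> T (i - 1) -> Prop) (t0 : T n).
Hypotheses (dflt : forall i, T i) (Inv0 : Inv t0).
Hypothesis next : forall i (t : T i), i <= n -> Inv t -> exists t', Step t t' /\ Inv t'.

(** Recursion on [n - i] going down from degree [n]; [dflt] fills the degrees above [n], where the
    coresolutions vanish. *)
Lemma int_dependent_choice :
  exists h : forall i, T i, h n = t0 /\ forall i, i <= n -> Step (h i) (h (i - 1)).
Proof.
pose S i := {t : T i | i <= n /\ Inv t}.
have Sn i (s : S i) : exists s' : S (i - 1), Step (sval s) (sval s').
  case: s => t [le_in It]; have [t' [tt' It']] := next le_in It.
  have le_in1 : i - 1 <= n by lia.
  by exists (exist _ t' (conj le_in1 It')).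
pose nxt i (s : S i) := projT1 (cid (Sn i s)).
have nxtP i s : Step (sval s) (sval (@nxt i s)) by exact: (projT2 (cid (Sn i s))).
pose cast i j (e : i = j) (s : S i) : S j := ecast k (S k) e s.
have castK i j (e : i = j) x : cast _ _ (esym e) (cast _ _ e x) = x by case: _ / e.
have e0 : n = n - Posz 0 by rewrite subr0.
have eS k : n - Posz k - 1 = n - Posz k.+1 by lia.
pose s := fix s k : S (n - Posz k) := match k with
  | 0 => cast _ _ e0 (exist _ t0 (conj (Order.POrderTheory.lexx n) Inv0))
  | k.+1 => cast _ _ (eS k) (nxt _ (s k)) end.
have ei i : i <= n -> n - Posz `|n - i|%N = i by lia.
pose h i : T i := if pselect (i <= n) is left le_in then sval (cast _ _ (ei i le_in) (s `|n - i|%N)) else dflt i.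
have hE i k (e : n - Posz k = i) : h i = sval (cast _ _ e (s k)).
  rewrite /h; case: pselect => [le_in|]; last by lia.
  have ek : `|n - i|%N = k by lia.
  (* The two casts rest on two proofs of one equation in [int], which coincide. *)
  move: (ei i le_in); rewrite ek => e'; congr (sval (cast _ _ _ _)).
  exact: eq_irrelevance.
exists h; split.
  by rewrite (hE n 0%N (esym e0)) /= castK.
move=> i le_in; have [k ik] : exists k : nat, n - Posz k = i by exists `|n - i|%N; lia.
case: i / ik le_in => _.
rewrite (hE _ k erefl) (hE _ k.+1 (esym (eS k))).
suff -> : cast _ _ (esym (eS k)) (s k.+1) = nxt _ (s k) by exact: nxtP.
by rewrite /= castK.
Qed.
End IntChoice.

Section Coresolution.
Variable R : pzRingType.
Hypothesis embed : forall V : lmodType R,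
  exists (P : lmodType R) (i : {linear V -> P}), projective_mod P /\ injective i.

Let E V := projT1 (cid (embed V)).
Let e (V : lmodType R) : {linear V -> E V} := projT1 (cid (projT2 (cid (embed V)))).
Let eP (V : lmodType R) : projective_mod (E V) /\ injective (e V).
Proof. exact: (projT2 (cid (projT2 (cid (embed V))))). Qed.

Variable M : lmodType R.

Definition cosyz k : lmodType R := iter k (fun V : lmodType R => quot_of (im_mod (e V)) : lmodType R) M.
Definition cores k : lmodType R := E (cosyz k).
Definition cores_d k : {linear cores k -> cores k.+1} :=
  e (cosyz k.+1) \o (\pi_(quot_of (im_mod (e (cosyz k)))) : {linear cores k -> cosyz k.+1}).

Lemma cores_d0 k x : cores_d k x = 0 <-> exists y, e (cosyz k) y = x.
Proof.
rewrite -(im_linE (e (cosyz k)) x) -quot_pi0; split=> [dx|x0].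
  by apply: (eP (cosyz k.+1)).2; rewrite linear0.
by rewrite /= (_ : \pi_(quot_of _) x = 0) ?linear0.
Qed.

Lemma cores_exact k x : cores_d k.+1 x = 0 <-> exists y, cores_d k y = x.
Proof.
rewrite cores_d0; split=> [[y <-]|[y <-]].
  by have [z <-] := quot_pi_surj y; exists z.
by exists (\pi_(quot_of (im_mod (e (cosyz k)))) y).
Qed.

Definition zero_mod : lmodType R := sub_of (ker_mod (idfun : {linear R^o -> R^o})).
Lemma zero_modE (x : zero_mod) : x = 0.
Proof. by apply: val_inj; have /ker_linE := valP x. Qed.
Lemma zero_mod_projective : projective_mod zero_mod.
Proof.
apply: (@projective_retract R R^o zero_mod (val : {linear _ -> R^o}) \0) (@regular_projective R).
by move=> x; rewrite (zero_modE x).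
Qed.

Definition coresZ (a : int) : lmodType R := if a is Posz k then cores k else zero_mod.

Definition cores_dd k l (x : cores k) : cores l :=
  if @eqP _ k.+1 l is ReflectT e then ecast m (cores m) e (cores_d k x) else 0.
Lemma cores_dd_linear k l : linear (@cores_dd k l).
Proof.
rewrite /cores_dd; case: eqP => [e'|_] c x y; last by rewrite scaler0 addr0.
by case: l / e'; rewrite linearP.
Qed.
Lemma cores_ddE k x : @cores_dd k k.+1 x = cores_d k x.
Proof. by rewrite /cores_dd; case: eqP => // e'; rewrite eq_axiomK. Qed.
Lemma cores_dd_neq k l x : k.+1 != l -> @cores_dd k l x = 0.
Proof. by rewrite /cores_dd; case: eqP. Qed.

Definition coresZ_d (a b : int) : {linear coresZ a -> coresZ b} :=
  match a, b return {linear coresZ a -> coresZ b} with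
  | Posz k, Posz l => lin_of (@cores_dd_linear k l)
  | _, _ => \0 end.

Lemma coresZ_shape a b x : b != a + 1 -> coresZ_d a b x = 0.
Proof.
case: a x => [k|k] x; case: b => [l|l] //= ab; apply: cores_dd_neq.
by apply: contra ab => /eqP <-; apply/eqP; lia.
Qed.

Lemma coresZ_dd a b c x : coresZ_d b c (coresZ_d a b x) = 0.
Proof.
case: a x => [k|k] x; last by rewrite (_ : coresZ_d _ b x = 0) ?linear0 //; case: b.
case: b => [l|l] //; case: c => [m|m] //=.
have [e1|] := eqVneq k.+1 l; last first.
  by move=> /cores_dd_neq ->; exact: linear0 (lin_of (@cores_dd_linear l m)).
case: l / e1; rewrite cores_ddE.
have [e2|] := eqVneq k.+2 m; last exact: cores_dd_neq.
by case: m / e2; rewrite cores_ddE; apply/cores_exact; exists x.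
Qed.

Lemma coresZ_exact a b c x : b = a + 1 -> c = b + 1 -> 0 <= a ->
  coresZ_d b c x = 0 -> exists y, coresZ_d a b y = x.
Proof.
case: a => // k bE cE _; have {}bE : b = Posz k.+1 by lia.
have {}cE : c = Posz k.+2 by lia.
rewrite bE in x cE *; rewrite cE /= cores_ddE => /cores_exact[y yE].
by exists y; rewrite cores_ddE.
Qed.

Lemma coresZ_aug b c : b = 0 -> c = 1 -> exists i : {linear M -> coresZ b},
  injective i /\ forall x, coresZ_d b c x = 0 <-> exists y, i y = x.
Proof.
move=> -> ->; exists (e M); split; first exact: (eP M).2.
by move=> x; rewrite /= cores_ddE cores_d0.
Qed.

(** The term of index [k] sits in degree [n - k]: the coresolution descends from degree [n]. *)
Lemma coresolution (n : int) : exists (G : cplx R) (i : {linear M -> G n}),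
  [/\ proj_cplx G /\ injective i, forall m, n < m -> forall x : G m, x = 0,
      forall x, cd G n (n - 1) x = 0 <-> exists y, i y = x &
      forall k l m, l = k - 1 -> m = l - 1 -> k <= n ->
        forall x, cd G l m x = 0 -> exists y, cd G k l y = x].
Proof.
have sh (i j : int) : i != j + 1 -> forall x, coresZ_d (n - i) (n - j) x = 0.
  by move=> ij x; apply: coresZ_shape; apply: contra ij => /eqP e'; apply/eqP; lia.
pose G : cplx R := @Cplx R (fun i => coresZ (n - i)) (fun i j => coresZ_d (n - i) (n - j))
  sh (fun i j k x => @coresZ_dd (n - i) (n - j) (n - k) x).
have [||i [iinj iE]] := @coresZ_aug (n - n) (n - (n - 1)); [lia | lia |].
exists G, i; split=> //.
- split=> // m; rewrite /=; case: (n - m) => k; first exact: (eP (cosyz k)).1.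
  exact: zero_mod_projective.
- move=> m nm x; have : n - m < 0 by lia.
  by move: x; rewrite /=; case: (n - m) => // k x _; exact: zero_modE.
- move=> k l m lE mE kn x; apply: coresZ_exact; lia.
Qed.

End Coresolution.

(** * Maps from a coresolution to a complex of injectives *)

Section Generator.
Variable R : pzRingType.
Variables (M : lmodType R) (n : int) (G : cplx R) (i : {linear M -> G n}) (X : cplx R).
Hypotheses (iinj : injective i) (G0 : forall m, n < m -> forall x : G m, x = 0).
Hypothesis Gn : forall x, cd G n (n - 1) x = 0 <-> exists y, i y = x.
Hypothesis Gex : forall k l m, l = k - 1 -> m = l - 1 -> k <= n ->
  forall x, cd G l m x = 0 -> exists y, cd G k l y = x.
Hypothesis IX : forall m, injective_mod (X m).

(** Descending induction: a component that sends cycles to cycles induces the next one by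
    injectivity, and exactness of [G] below [n] restores the invariant. *)
Lemma coresolution_extend (f : {linear M -> X n}) : (forall m, cd X n (n - 1) (f m) = 0) ->
  exists p : cmap G X, forall m, p n (i m) = f m.
Proof.
move=> df; have [t tE] := @IX n _ _ i f iinj.
have [|k g kn Ig|p [pn pS]] := @int_dependent_choice (fun k => {linear G k -> X k}) n
  (fun k g => forall x, cd G k (k - 1) x = 0 -> cd X k (k - 1) (g x) = 0)
  (fun k g g' => forall x, g' (cd G k (k - 1) x) = cd X k (k - 1) (g x)) t (fun k => \0).
- by move=> x /Gn[m <-]; rewrite tE.
- have [x /Ig //|g' g'E] := @injective_factor R _ _ _ (cd G k (k - 1))
    (cd X k (k - 1) \o g : {linear G k -> X (k - 1)}) (@IX (k - 1)).
  exists g'; split=> // x dx.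
  have [y <-] := Gex erefl erefl kn dx.
  by rewrite g'E /= cdd.
have pC k x : p (k - 1) (cd G k (k - 1) x) = cd X k (k - 1) (p k x).
  by have [/pS //|/G0 x0] := Order.TotalTheory.leP k n; rewrite (x0 x) !linear0.
by exists (mk_cmap pC) => m; rewrite /= pn tE.
Qed.

Lemma coresolution_null (p : cmap G X) (f : {linear M -> X (n + 1)}) :
  (forall m, p n (i m) = cd X (n + 1) n (f m)) -> null_homotopic p.
Proof.
move=> pf; have [t tE] := @IX (n + 1) _ _ i f iinj.
(* All targets [X j] are kept to fit the doubly indexed shape of a homotopy; only [j = k + 1]
   matters. The invariant says that on cycles the homotopy built so far already accounts for [p]. *)
have [|k g kn Ig|h [hn hS]] := @int_dependent_choice (fun k => forall j, {linear G k -> X j}) n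
  (fun k g => forall x, cd G k (k - 1) x = 0 -> p k x = cd X (k + 1) k (g (k + 1) x))
  (fun k g g' => forall x, p k x = cd X (k + 1) k (g (k + 1) x) + g' k (cd G k (k - 1) x))
  (fun j => cidl X (n + 1) j \o t) (fun k j => \0).
- by move=> x /Gn[m <-]; rewrite /= cid_refl tE pf.
- have [x /Ig e|u uE] := @injective_factor R _ _ _ (cd G k (k - 1))
    (p k \- (cd X (k + 1) k \o g (k + 1)) : {linear G k -> X k}) (@IX k).
    by rewrite /= e subrr.
  exists (fun j => cidl X k j \o u); split=> x.
    by rewrite /= cid_refl uE /= addrC subrK.
  move=> dx; have [y <-] := Gex erefl erefl kn dx.
  rewrite /= uE (@cd_cid R X k (k - 1 + 1) (k - 1) (k - 1)) ?subrK // cid_refl.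
  by rewrite linearB /= cdd subr0 cmapP.
exists h => k x; have [/hS //|/G0 x0] := Order.TotalTheory.leP k n.
by rewrite (x0 x) !linear0 addr0.
Qed.

End Generator.

(** * A contractibility criterion *)

Section Contractible.
Variable R : pzRingType.
Variable X : cplx R.
Hypothesis IX : forall n, injective_mod (X n).
Hypothesis HX : forall (L : submod R^o) (n : int) (x : X n), cd X n (n - 1) x = 0 ->
  (forall r : R, (r : R^o) \in submod_pred L -> r *: x = 0) ->
  exists y, cd X (n + 1) n y = x /\ forall r : R, (r : R^o) \in submod_pred L -> r *: y = 0.

(** Injectivity of [X n] represents [f] by an element [c], perhaps not a cycle. Its boundary is
    killed by [L], hence equals that of some [y] killed by [L], and [c - y] is a cycle representing
    [f]. *)
Lemma cycles_injective n : injective_mod (Zc X n).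
Proof.
apply: Baer_injective => L f HL fL.
have [c cP] : exists c : X n, forall r, L r -> val (f r) = r *: c.
  apply: (@injective_Baer R (X n) (@IX n) L (fun r => val (f r))) => // a x y Lx Ly.
  by rewrite fL // linearP.
have [||y [yE yL]] := @HX (mksub HL) (n - 1) (cd X n (n - 1) c).
- by rewrite cdd.
- move=> r /(mksubE HL) Lr; rewrite -linearZ -cP //.
  by exact: (proj1 (ZsubE _) (valP _)).
have cZ : c - cid_fun n y \in submod_pred (Zsub X n).
  apply/ZsubE; rewrite linearB (@cd_cid R X (n - 1 + 1) n (n - 1) (n - 1)) ?subrK // cid_refl.
  by rewrite yE subrr.
exists (sub_elt cZ) => r Lr; apply: val_inj; rewrite cP //.
change (r *: c = r *: (c - cidl X (n - 1 + 1) n y)).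
by rewrite scalerBr -linearZ yL ?linear0 ?addr0 //; exact/(mksubE HL).
Qed.

(* The complex is acyclic with injective cycles, hence splits. *)
Lemma contractible : null_homotopic (cmap_id X).
Proof.
have Hr n : exists r : {linear X n -> Zc X n}, forall z, r (val z) = z.
  have [r rE] := @cycles_injective n _ _ (val : {linear Zc X n -> X n}) (idfun : {linear Zc X n -> Zc X n}) val_inj.
  by exists r.
pose r n := projT1 (cid (Hr n)).
have rP n z : r n (val z) = z by exact: (projT2 (cid (Hr n)) z).
have Hd n : exists2 d : {linear X n -> Zc X (n - 1)}, forall x, val (d x) = cd X n (n - 1) x & surjective_map d.
  have [x|d dE] := @lin_to_sub R _ _ (Zsub X (n - 1)) (cd X n (n - 1)).
    by apply/ZsubE; rewrite cdd.
  exists d => // z; have /ZsubE dz := valP z.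
  (* For the zero ideal, [HX] is acyclicity. *)
  have L0 : is_submod (fun r : R^o => r = 0).
    by split=> // a x y -> ->; rewrite scaler0 addr0.
  have [x0 /(mksubE L0) ->|y [yE _]] := @HX (mksub L0) (n - 1) (val z) dz; first by rewrite scale0r.
  exists (cid_fun n y); apply: val_inj.
  by rewrite dE (@cd_cid R X (n - 1 + 1) n (n - 1) (n - 1)) ?subrK // cid_refl.
(* The retraction [r] fixes cycles, so [x - r x] depends only on the boundary of [x]; this is a
   section of the differential. *)
have Hs n : exists s : {linear Zc X (n - 1) -> X n},
    (forall z, cd X n (n - 1) (s z) = val z) /\
    forall x (z : Zc X (n - 1)), val z = cd X n (n - 1) x -> s z = x - val (r n x).
  have [d dE ds] := Hd n.
  have L : linear (fun x : X n => x - val (r n x)).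
    have vE (a : R) (u v : Zc X n) : val (a *: u + v) = a *: val u + val v by [].
    by move=> c x y; rewrite (linearP (r n)) vE scalerBr opprD addrACA.
  have [x dx|s sE] := @linear_factor R _ _ _ d (lin_of L) ds.
    have xZ : x \in submod_pred (Zsub X n) by apply/ZsubE; rewrite -dE dx.
    by rewrite /= -[x]/(val (sub_elt xZ)) rP subrr.
  exists s; split=> [z|x z zx].
    have [x <-] := ds z; rewrite sE /= linearB dE.
    by have /ZsubE -> := valP (r n x); rewrite subr0.
  by rewrite (_ : z = d x) ?sE //; apply: val_inj; rewrite dE.
pose s n := projT1 (cid (Hs n)).
have sP n : (forall z, cd X n (n - 1) (s n z) = val z) /\
    forall x (z : Zc X (n - 1)), val z = cd X n (n - 1) x -> s n z = x - val (r n x).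
  exact: (projT2 (cid (Hs n))).
have rd k x : val (r (k - 1) (cd X k (k - 1) x)) = cd X k (k - 1) x.
  have dZ : cd X k (k - 1) x \in submod_pred (Zsub X (k - 1)) by apply/ZsubE; rewrite cdd.
  by rewrite -[cd X k (k - 1) x]/(val (sub_elt dZ)) rP.
apply: (@null_homotopicI R X X _ (fun i j => s j \o r (j - 1) \o cidl X i (j - 1))) => m x.
rewrite /= !cid_refl (sP m).1 ((sP (m - 1)).2 x _ (rd (m - 1) x)).
by rewrite [RHS]addrC subrK.
Qed.

End Contractible.

(** * Compactness of the coresolutions of cyclic modules *)

Section CompactGeneration.
Variable R : pzRingType.
Notation K := (triK R).
Hypothesis embed : forall V : lmodType R,
  exists (P : lmodType R) (i : {linear V -> P}), projective_mod P /\ injective i.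
Hypothesis projective_injective : forall P : lmodType R, projective_mod P -> injective_mod P.

Variable L : submod R^o.

Lemma cyclic_map (V : lmodType R) (x : V) : (forall r : R, (r : R^o) \in submod_pred L -> r *: x = 0) ->
  exists f : {linear quot_of L -> V}, f (\pi_(quot_of L) 1) = x.
Proof.
move=> Lx; have H : linear (fun r : R^o => (r : R) *: x).
  by move=> a b c; rewrite scalerDl -scalerA.
have [r /quot_pi0/Lx //|f fE] := @linear_factor R _ _ _ (\pi_(quot_of L) : {linear R^o -> quot_of L})
  (lin_of H) (@quot_pi_surj _ _ _).
by exists f; rewrite fE /= scale1r.
Qed.

Lemma cyclic_scale (r : R) : \pi_(quot_of L) r = r *: \pi_(quot_of L) 1.
Proof. by rewrite -linearZ; congr (\pi_(quot_of L) _); rewrite /= /GRing.scale /= mulr1. Qed.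

Lemma cyclic_hom_ext (V : lmodType R) (f g : {linear quot_of L -> V}) :
  f (\pi_(quot_of L) 1) = g (\pi_(quot_of L) 1) -> f =1 g.
Proof.
move=> fg y; have [r <-] := quot_pi_surj y.
by rewrite cyclic_scale !linearZ fg.
Qed.

(* [c] represents the functor of homotopy classes of maps from [R / L],
   placed in degree [n], to complexes of projectives. *)
Definition represents_cyclic (n : int) (G : cplx R) (c : G n) : Prop :=
  [/\ proj_cplx G, cd G n (n - 1) c = 0,
    forall r : R, (r : R^o) \in submod_pred L -> r *: c = 0,
    forall X, proj_cplx X -> forall x : X n, cd X n (n - 1) x = 0 ->
      (forall r : R, (r : R^o) \in submod_pred L -> r *: x = 0) -> exists p : cmap G X, p n c = x &
    forall X, proj_cplx X -> forall p : cmap G X, p n c = 0 -> null_homotopic p].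

Lemma represents_cyclic_exists n : exists (G : cplx R) (c : G n), represents_cyclic c.
Proof.
have [G [i [[PG iinj] G0 Gn Gex]]] := coresolution embed (quot_of L) n.
exists G, (i (\pi_(quot_of L) 1)); split=> //.
- by apply/Gn; exists (\pi_(quot_of L) 1).
- move=> r rL; rewrite -linearZ -cyclic_scale (_ : \pi_(quot_of L) r = 0) ?linear0 //.
  exact/quot_pi0.
- move=> X PX x dx Lx; have [f fE] := cyclic_map Lx.
  have [m|p pE] := coresolution_extend iinj G0 Gn Gex (fun m => projective_injective (@PX m)) (f := f).
    by rewrite -[LHS]/((cd X n (n - 1) \o f) m) (@cyclic_hom_ext _ _ \0) //= fE.
  by exists p; rewrite pE.
- move=> X PX p pc.
  apply: (coresolution_null iinj G0 Gn Gex (fun m => projective_injective (@PX m)) (f := \0)) => m.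
  rewrite /= linear0 -[LHS]/((p n \o i) m).
  by rewrite (@cyclic_hom_ext _ _ \0).
Qed.

Variables (n : int) (G : cplx R) (c : G n).
Hypothesis Gc : represents_cyclic c.

Lemma cmap_sumE (X Y : cplx R) (J : Type) (s : seq J) (p : J -> cmap X Y) k x :
  (\sum_(j <- s) p j) k x = \sum_(j <- s) p j k x.
Proof.
elim: s => [|j s IH]; first by rewrite !big_nil.
by rewrite !big_cons -IH.
Qed.

Lemma homK_pi_sum (X Y : cplx R) (J : Type) (s : seq J) (p : J -> cmap X Y) :
  homK_pi (\sum_(j <- s) p j) = \sum_(j <- s) homK_pi (p j).
Proof.
elim: s => [|j s IH]; first by rewrite !big_nil homK_pi0.
by rewrite !big_cons homK_piD IH.
Qed.

(* The generator of [R / L] goes to an element of finite support. *)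
Lemma represents_cyclic_finite (I : choiceType) (X : I -> cplx R) (p : cmap G (dsumC X)) :
  (forall i, proj_cplx (X i)) ->
  exists (A : set I) (q : forall i, cmap G (X i)), [/\ finite_set A,
    forall i, ~ A i -> q i = 0 &
    homK_pi p = \sum_(i <- fset_set A) homK_pi (cmap_comp (dsumC_inj X i) (q i))].
Proof.
move=> PX; have [PG dc Lc ext nul] := Gc.
pose x : dsum (fun i => X i n) := p n c.
pose A : set I := [set i | dsum_val x i != 0].
have Af : finite_set A by exact: dsum_finite.
have H i : exists q : cmap G (X i), q n c = dsum_val x i /\ (~ A i -> q = 0).
  have [Ai|nA] := pselect (A i); last first.
    exists 0; split=> //; apply/esym/eqP/negPn/negP; exact: nA.
  have [||q qE] := ext _ (PX i) (dsum_val x i); last by exists q.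
  - rewrite -[dsum_val x i]/(cmap_comp (dsumC_proj X i) p n c) -cmapP dc.
    exact: linear0.
  - move=> r rL; rewrite -[dsum_val x i]/(cmap_comp (dsumC_proj X i) p n c) -linearZ Lc //.
    exact: linear0.
pose q i := projT1 (cid (H i)).
have qP i : q i n c = dsum_val x i /\ (~ A i -> q i = 0) by exact: (projT2 (cid (H i))).
exists A, q; split=> // [i|]; first exact: (qP i).2.
have PS : proj_cplx (dsumC X) by move=> k; apply: dsum_projective => i; exact: PX.
(* Chain maps that agree at [c] are homotopic, so it is enough to compare both sides at [c]. *)
rewrite -homK_pi_sum; apply/homK_pi_eq/(nul _ PS).
rewrite -[LHS]/(p n c - (\sum_(i <- fset_set A) cmap_comp (dsumC_inj X i) (q i)) n c) cmap_sumE.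
apply/eqP; rewrite subr_eq0; apply/eqP.
rewrite -[LHS]/x [LHS]dsum_sum -(fsbig_widen A setT) //; last first.
  move=> i [_ /=/negP]; rewrite negbK => /eqP e.
  by change (dsum_inj (fun i => X i n) i (dsum_val x i) = 0); rewrite e linear0.
rewrite fsbig_finite //; apply: eq_bigr => i _.
by rewrite -(qP i).1.
Qed.

Variables (P : K -> Prop) (shP : forall X : K, P X -> P (sh X)).
Hypothesis PE : forall X : K, P X <-> projK X.
Notation F := (full_tridata shP).

(** The coproduct is computed on isomorphic complexes of projectives, where
    [represents_cyclic_finite] applies; the inverses of the [a i] carry the components back. *)
Lemma represents_cyclic_compact (PG : P G) : compact_obj (exist _ (G : K) PG : F).
Proof.
apply: compact_objI => I X.
have H i : projK (sval (X i)) by apply/PE; exact: (svalP (X i)).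
pose X' i := projT1 (cid (H i)).
have X'P i : proj_cplx (X' i) /\ isomorphic (sval (X i)) (X' i : K) by exact: (projT2 (cid (H i))).
pose a i := projT1 (cid (X'P i).2).
have aP i : is_iso (a i) by exact: (projT2 (cid (X'P i).2)).
pose a' i := projT1 (cid (aP i)).
have a'P i : comp (a i) (a' i) = idm (X' i : K) by exact: (projT2 (cid (aP i))).2.
have PS : P (dsumC X').
  apply/PE; exists (dsumC X'); split; last by exists (idm _); exact: is_iso_id.
  by move=> k; apply: dsum_projective => i; exact: (X'P i).1.
exists (exist _ (dsumC X' : K) PS), (fun i => comp (homK_pi (dsumC_inj X' i) : @hom K _ _) (a i)).
split.
  move=> Y f.
  exact: (@coproduct_precomp_iso (catK R) I (fun i => sval (X i)) X' (dsumC X') _ a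
    (@dsumC_coproduct R I X') aP (sval Y) f).
move=> f; have [p fE] := @homKP R G (dsumC X') f.
have [A [q [Af qA pE]]] := represents_cyclic_finite p (fun i => (X'P i).1).
pose g i : @hom K G (sval (X i)) := comp (a' i) (homK_pi (q i) : @hom K G (X' i)).
have gA i : ~ A i -> g i = 0.
  by move=> /qA; rewrite /g => ->; rewrite [X in comp _ X]homK_pi0 compm0.
have gf : finite_set [set i | g i != 0].
  by apply: sub_finite_set Af => i /= gi; apply: contrapT => /gA g0; rewrite g0 eqxx in gi.
exists (exist (fun g : forall i, @hom K G (sval (X i)) => finite_set [set i | g i != 0]) g gf).
rewrite /dsum_hom_map -(fsbig_widen A setT) //; last first.
  by move=> i [_ /= /gA g0]; rewrite /preimage /= g0; exact: (@compm0 K).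
rewrite fsbig_finite // fE pE; apply: eq_bigr => i _ /=.
rewrite -[LHS]/(comp (comp (homK_pi (dsumC_inj X' i) : @hom K _ _) (a i)) (g i)).
by rewrite /g -compA (compA (a i)) a'P comp1m; exact: compK_pi.
Qed.

End CompactGeneration.

(** * Generation, and the conclusion *)

Section Generation.
Variable R : pzRingType.
Notation K := (triK R).
Hypothesis embed : forall V : lmodType R,
  exists (P : lmodType R) (i : {linear V -> P}), projective_mod P /\ injective i.
Hypothesis projective_injective : forall P : lmodType R, projective_mod P -> injective_mod P.
Variables (P : K -> Prop) (shP : forall X : K, P X -> P (sh X)).
Hypothesis PE : forall X : K, P X <-> projK X.

Lemma projK_compactly_generated : compactly_generated (full_tridata shP).
Proof.
pose ideal := {S : set R | is_submod (S : set R^o)}.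
pose J : choiceType := ({classic ideal} * int)%type.
pose I (j : J) : submod R^o := mksub (svalP (j.1 : ideal)).
have H (j : J) : exists (G : cplx R) (c : G j.2), represents_cyclic (I j) c.
  exact: represents_cyclic_exists.
pose G j := projT1 (cid (H j)).
pose c j : G j j.2 := projT1 (cid (projT2 (cid (H j)))).
have Gc j : represents_cyclic (I j) (c j) by exact: (projT2 (cid (projT2 (cid (H j))))).
have PG j : P (G j).
  apply/PE; exists (G j); split; first by case: (Gc j).
  by exists (idm _); exact: is_iso_id.
exists J, (fun j => exist _ (G j : K) (PG j)); split=> [j|].
  exact: represents_cyclic_compact.
move=> [X PX] homX.
have [X' [PX' [a [a' [a'a aa']]]]] : projK X by apply/PE.
apply: id0_zero.
have X'0 : homK_pi (cmap_id X') = 0.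
  apply/homK_null/contractible => [k|L k x dx Lx]; first exact: projective_injective.
  pose j : J := (exist _ _ (submodP L) : ideal, k).
  have LE r : (r \in submod_pred (I j)) <-> (r \in submod_pred L) by exact: mksubE.
  have [_ dc Lc ext _] := Gc j.
  have [|p pE] := ext X' PX' x dx; first by move=> r /LE; exact: Lx.
  have p0 : homK_pi p = 0.
    rewrite -[LHS](@comp1m K) -aa' -compA.
    have := homX j (comp a' (homK_pi p : @hom K (G j) X')).
    by move=> e; rewrite [X in comp _ X]e compm0.
  (* At [c] the homotopy formula reads [x = d (h c)], because [d c = 0]; and [L] kills [h c] since
     it kills [c]. *)
  have [h hE] := (iffLR (homK_null _)) p0.
  exists (h k (k + 1) (c j)); split.
    by have := hE k (c j); rewrite dc linear0 addr0 pE => ->.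
  by move=> r /LE rL; rewrite -linearZ (Lc r rL) linear0.
rewrite -[LHS]/(idm (X : K)) -a'a -[a](@comp1m K) [idm (X' : K)]X'0.
by rewrite comp0m compm0.
Qed.
End Generation.

Theorem proposition4p2 (R : pzRingType) (HR : zero_Gorenstein R) :
  exists shGP : forall X : triK R,
      Gorenstein_projective X -> Gorenstein_projective (sh X),
    compactly_generated_triangulated (full_tridata shGP).
Proof.
have [NL NR [IR _]] := HR.
have embed := @embeds_in_projective R NL NR IR.
have PI := fun P => @projective_injective R NL P IR.
have GE := Gorenstein_projectiveE embed PI.
have shGP (X : triK R) : Gorenstein_projective X -> Gorenstein_projective (sh X).
  by move=> /GE/projK_sh/GE.
exists shGP.
(* Coproducts come first, since additivity is deduced from them. *)
have cop : has_coproducts (full_tridata shGP) by exact: projK_coproducts.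
split=> //; last exact: projK_compactly_generated.
apply: full_triangulated => //.
- by move=> X Y f /GE PX /GE PY; apply/GE; exact: projK_cone.
- by move=> Y /GE PY; apply/GE; exact: projK_unshift.
Qed.
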